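(* Let $f:\mathbb{CP}(1)\to\mathbb{R}$ be a $C^\infty$ function and let $f^*$ be its decreasing rearrangement, regarded as an element of $L^2([0,1])$. For each $m$, let $T^m_f$ be the Toeplitz quantization of $f$, let $\lambda^m=(\lambda^m_0,\dots,\lambda^m_m)\in\mathbb{R}^{m+1}$ be its eigenvalues, and let $E_m=p^m\big(\mathrm{co}(\Sigma_m\cdot\lambda^m)\big)\subset L^2([0,1])$. Then the closed convex hull in $L^2([0,1])$ of the set $$\mathrm{Smeas}(I)\cdot f^*=\{f^*\circ\phi \;:\; \phi\in \mathrm{Smeas}(I)\}$$ is equal to the closure, in the weak topology of $L^2([0,1])$, of the topological lim sup $\mathrm{Ls}\,E_m$ of the sequence of convex sets $(E_m)_m$.
   Context: Fubini-Study form and measure: on the Riemann sphere $\mathbb{CP}(1)$, in the local coordinate $[1,w]$, let $\Omega=\frac{i}{(1+w\overline{w})^2}\,dw\wedge d\overline{w}$ (total mass $2\pi$), and let $\mu$ be the probability measure on $\mathbb{CP}(1)$ given by $\Omega/(2\pi)$. Toeplitz quantization: let $\mathbf{L}$ be the standard hyperplane bundle on $\mathbb{CP}(1)$. The holomorphic sections of $\mathbf{L}^{\otimes m}$ form an $(m+1)$-dimensional space $\Gamma^m_{hol}$, which in the local coordinate $w$ is the span of $1,w,\dots,w^m$. The bundle $\mathbf{L}^{\otimes m}$ carries the Hermitian metric $\langle s_1,s_2\rangle(w)=\frac{1}{(1+|w|^2)^m}s_1(w)\overline{s_2(w)}$. Let $\Gamma^m_2$ be the Hilbert space of square-integrable sections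 of $\mathbf{L}^{\otimes m}$, with inner product $\int_{\mathbb{CP}(1)}\langle s_1,s_2\rangle\,\Omega$, and let $P^m:\Gamma^m_2\to\Gamma^m_{hol}$ be the orthogonal projection. The Toeplitz quantization of $f$ is the operator $T^m_f:\Gamma^m_{hol}\to\Gamma^m_{hol}$, $T^m_f=P^m\circ \mathbf{M}_f\circ P^m$, where $\mathbf{M}_f$ is multiplication by $f$. For real $f$ it is Hermitian, so it has $m+1$ real eigenvalues (counted with multiplicity). Decreasing rearrangement: put $F_f(t)=\mu(\{\omega: f(\omega)<t\})$ and $d_f(t)=\mu(\mathbb{CP}(1))-F_f(t)=1-F_f(t)$. The decreasing rearrangement of $f$ is $f^*(s)=\inf\{t\in\mathbb{R}: d_f(t)<s\}$, defined for $s\in(0,1)$, hence almost everywhere on $[0,1]$. The sets $E_m$: $\Sigma_m$ is the group of all permutations of the $m+1$ letters $0,1,\dots,m$. For $x=(x_0,\dots,x_m)\in\mathbb{R}^{m+1}$, $\Sigma_m\cdot x$ is the set of points $(x_{\sigma(0)},\dots,x_{\sigma(m)})$, $\sigma\in\Sigma_m$, and $\mathrm{co}$ denotes the convex hull. The map $p^m:\mathbb{R}^{m+1}\to L^2([0,1])$ is $p^m(a_0,\dots,a_m)=\sum_{k=0}^m a_k\chi_{I^m_k}$, where $\chi_{I^m_k}$ is the characteristic function of $I^m_k=\left[\frac{k}{m+1},\frac{k+1}{m+1}\right)$. Measure preserving transformations: $L^2([0,1])$ is the space of real-valued square-integrable functions with respect to Lebesgue measure $|\cdot|$ on $I=[0,1]$.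 $\mathrm{Smeas}(I)$ is the set of all (not necessarily invertible) measure preserving transformations of $[0,1]$, i.e. measurable maps $\phi:[0,1]\to[0,1]$ with $|\phi^{-1}(A)|=|A|$ for every Borel set $A$. Topological lim sup: for a sequence $(E_m)$ of subsets of a topological space $X$, a point $x\in X$ belongs to $\mathrm{Ls}\,E_m$ if for every neighborhood $V$ of $x$ there are infinitely many $m$ with $V\cap E_m\neq\emptyset$. Here $X=L^2([0,1])$ with the norm topology of $\|\cdot\|_2$; equivalently, $g\in \mathrm{Ls}\,E_m$ if and only if there is a subsequence $(g_{m_k})_k$ with $g_{m_k}\in E_{m_k}$ converging to $g$ in $L^2([0,1])$. *)

(* Defs.v *)
From HB Require Import structures.
From mathcomp Require Import all_boot all_order all_algebra perm qpoly.
From mathcomp Require Import complex.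
From mathcomp Require Import all_classical all_reals all_analysis.
From mathcomp Require Import measurable_realfun ess_sup_inf.
Set Implicit Arguments.
Unset Strict Implicit.
Unset Printing Implicit Defensive.
Import Order.TTheory GRing.Theory Num.Theory.
Import numFieldNormedType.Exports.
Local Open Scope classical_set_scope.
Local Open Scope ring_scope.

(* The library provides the Lp space as a type of a.e.-classes of functions
   ([LspaceType]) but no vector space or norm on it. *)
Lemma ae_eq_Lnorm d (T : measurableType d) (R : realType)
    (mu : {measure set T -> \bar R}) (p : \bar R) (f g : T -> R) :
  (1 <= p)%E -> measurable_fun setT f -> measurable_fun setT g ->
  f = g %[ae mu] -> 'N[mu]_p[EFin \o f]%E = 'N[mu]_p[EFin \o g]%E.
Proof.
rewrite unlock; case: p => [r||] //= r1 mf mg fg.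
- congr (_ `^ _)%E; apply: ae_eq_integral => //.
  + apply/measurable_EFinP; apply: (measurableT_comp (measurable_powR _)).
    exact: measurableT_comp.
  + apply/measurable_EFinP; apply: (measurableT_comp (measurable_powR _)).
    exact: measurableT_comp.
  + by apply: filterS fg => x /(_ I) -> _.
- case: ifP => // _; apply: eq_ess_sup.
  by apply: filterS fg => x /(_ I) /= ->.
Qed.

Section Lspace_normed_module.
Context d (T : measurableType d) (R : realType).
Variables (mu : {measure set T -> \bar R}) (p : \bar R) (p1 : (1 <= p)%E).
Local Notation L := (LspaceType mu p1).
Local Notation LF := (LfunType mu p1).
Local Notation MF := {mfun_ mu, T >-> measurableTypeR R}.
Local Open Scope quotient_scope.

Let repr_measurable (g : MF) : measurable_fun setT (g : T -> R).
Proof. by move=> _ B mB; exact: (@measurable_funPT _ _ T (measurableTypeR R) (repr g)). Qed.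

Section Lspace_class.
Variable f : LF.

Let mf0 : @measurable_fun _ _ T (measurableTypeR R) setT f.
Proof. by move=> _ B mB; exact: measurable_funPT. Qed.
Let mf := @isMeasurableFun.Build _ _ T (measurableTypeR R) f mf0.

Let cl : MF := \pi_MF (MeasurableFun.Pack (MeasurableFun.Class mf)).

Let clE : (cl : T -> R) = f %[ae mu].
Proof. by have /eqmodP/asboolP := reprK cl. Qed.

Let clL : finite_norm mu p cl.
Proof.
by rewrite /finite_norm (ae_eq_Lnorm p1 _ _ clE)//; exact: Lfunction_finite.
Qed.

Definition Lspace_class : L :=
  LebesgueSpace.Pack (LebesgueSpace.Class
    (isFinLebesgue.Build d T R mu p p1 cl clL)).

Lemma Lspace_classE : (Lspace_class : T -> R) = f %[ae mu].
Proof. exact: clE. Qed.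

End Lspace_class.

Lemma Lspace_eqP (g h : L) : (g : T -> R) = h %[ae mu] -> g = h.
Proof.
case: g h => [g [[gL]]] [h [[hL]]] /= gh.
have E : g = h.
  rewrite -(reprK g) -(reprK h); apply/eqmodP/asboolP; exact: gh.
by case: _ / E in hL gh *; rewrite (Prop_irrelevance gL hL).
Qed.

Section Lspace_repr.
Variable g : L.
#[local] HB.instance Definition _ :=
  @isMeasurableFun.Build _ _ T R (g : T -> R) (repr_measurable g).
#[local] HB.instance Definition _ :=
  @isLfunction.Build d T R mu p p1 (g : T -> R) (@Lebesgue_finite _ _ _ _ _ p1 g).
Definition Lspace_repr : LF := (g : T -> R).
End Lspace_repr.


Let reprE (g : L) : Lspace_repr g = g :> (T -> R). Proof. by []. Qed.

Let zero : L := Lspace_class 0.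
Let opp (g : L) : L := Lspace_class (- Lspace_repr g).
Let add (g h : L) : L := Lspace_class (Lspace_repr g + Lspace_repr h).
Let scale (a : R) (g : L) : L := Lspace_class (a *: Lspace_repr g).

Let zeroE : (zero : T -> R) = (fun=> 0) %[ae mu].
Proof. exact: Lspace_classE. Qed.
Let oppE (g : L) : (opp g : T -> R) = (fun x => - (g : T -> R) x) %[ae mu].
Proof. exact: Lspace_classE. Qed.
Let addE (g h : L) :
  (add g h : T -> R) = (fun x => (g : T -> R) x + (h : T -> R) x) %[ae mu].
Proof. exact: Lspace_classE. Qed.
Let scaleE a (g : L) : (scale a g : T -> R) = (fun x => a * (g : T -> R) x) %[ae mu].
Proof. exact: Lspace_classE. Qed.

Let addA : associative add.
Proof.
move=> f g h; apply: Lspace_eqP; near=> x => _.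
rewrite (near (addE f (add g h)) x)// (near (addE g h) x)//.
by rewrite (near (addE (add f g) h) x)// (near (addE f g) x)// addrA.
Unshelve. all: by end_near. Qed.

Let addC : commutative add.
Proof.
move=> f g; apply: Lspace_eqP; near=> x => _.
by rewrite (near (addE f g) x)// (near (addE g f) x)// addrC.
Unshelve. all: by end_near. Qed.

Let add0 : left_id zero add.
Proof.
move=> f; apply: Lspace_eqP; near=> x => _.
by rewrite (near (addE zero f) x)// (near zeroE x)// add0r.
Unshelve. all: by end_near. Qed.

Let addN : left_inverse zero opp add.
Proof.
move=> f; apply: Lspace_eqP; near=> x => _.
rewrite (near (addE (opp f) f) x)// (near (oppE f) x)// (near zeroE x)//.
exact: addNr.
Unshelve. all: by end_near. Qed.

HB.instance Definition _ := gen_eqMixin L.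
HB.instance Definition _ := gen_choiceMixin L.
HB.instance Definition _ := GRing.isZmodule.Build L addA addC add0 addN.

Let scaleA (a b : R) (f : L) : scale a (scale b f) = scale (a * b) f.
Proof.
apply: Lspace_eqP; near=> x => _.
rewrite (near (scaleE a (scale b f)) x)// (near (scaleE b f) x)//.
by rewrite (near (scaleE (a * b) f) x)// mulrA.
Unshelve. all: by end_near. Qed.

Let scale1 : left_id 1 scale.
Proof.
move=> f; apply: Lspace_eqP; near=> x => _.
by rewrite (near (scaleE 1 f) x)// mul1r.
Unshelve. all: by end_near. Qed.

Let scaleDr : right_distributive scale +%R.
Proof.
move=> a f g; apply: Lspace_eqP; near=> x => _.
rewrite (near (scaleE a (f + g)) x)// (near (addE f g) x)// mulrDr.
rewrite (near (addE (scale a f) (scale a g)) x)//.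
by rewrite (near (scaleE a f) x)// (near (scaleE a g) x).
Unshelve. all: by end_near. Qed.

Let scaleDl (f : L) : {morph scale^~ f : a b / a + b}.
Proof.
move=> a b; apply: Lspace_eqP; near=> x => _.
rewrite (near (scaleE (a + b) f) x)// mulrDl.
rewrite (near (addE (scale a f) (scale b f)) x)//.
by rewrite (near (scaleE a f) x)// (near (scaleE b f) x).
Unshelve. all: by end_near. Qed.

HB.instance Definition _ :=
  GRing.Zmodule_isLmodule.Build R L scaleA scale1 scaleDr scaleDl.

Let norm (g : L) : R := fine ('N[mu]_p[EFin \o (g : T -> R)])%E.

Let normE (f : LF) : norm (Lspace_class f) = fine ('N[mu]_p[EFin \o f])%E.
Proof.
by rewrite /norm (ae_eq_Lnorm p1 _ _ (Lspace_classE f))//.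
Qed.

Let ler_normD (f g : L) : norm (f + g) <= norm f + norm g.
Proof. by rewrite normE ler_LnormD. Qed.

Let normZ (a : R) (f : L) : norm (a *: f) = `|a| * norm f.
Proof.
rewrite normE /norm.
have -> := LnormZ (Lspace_repr f) a.
by rewrite -(finite_norm_fine (Lspace_repr f)).
Qed.

Let norm0_eq0 (f : L) : norm f = 0 -> f = 0.
Proof.
move=> f0; apply: Lspace_eqP; apply: ae_eq_trans; last first.
  exact/ae_eq_sym/zeroE.
exact: (@fine_Lnormr_eq0 _ _ _ mu p p1 (Lspace_repr f) f0).
Qed.

HB.instance Definition _ :=
  Lmodule_isNormed.Build R L ler_normD normZ norm0_eq0.

Lemma Lspace_normE (f : L) :
  `|f| = fine ('N[mu]_p[EFin \o (f : T -> R)])%E.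
Proof. by []. Qed.

Lemma LspaceDE (f g : L) :
  (f + g : L) = (fun x => (f : T -> R) x + (g : T -> R) x) %[ae mu].
Proof. exact: addE. Qed.

Lemma LspaceZE a (f : L) :
  (a *: f : L) = (fun x => a * (f : T -> R) x) %[ae mu].
Proof. exact: scaleE. Qed.

End Lspace_normed_module.


Section hulls_and_limits.
Context {R : realType}.

Definition conv_hull {V : lmodType R} (A : set V) : set V :=
  smallest (@convex_set R V) A.

Definition closed_conv_hull {V : normedModType R} (A : set V) : set V :=
  smallest [set C : set V | closed C /\ @convex_set R V C] A.

Definition weak_topology (V : normedModType R) : topologicalType :=
  sup_topology (fun l : {l : {linear V -> R^o} | continuous l} =>
    Topological.class (initial_topology (sval l : V -> R^o))).

Definition weak_closure {V : normedModType R} (A : set V) : set V :=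
  @closure (weak_topology V) A.

Definition Ls {X : topologicalType} (E : nat -> set X) : set X :=
  [set x | forall V, nbhs x V -> infinite_set [set m | V `&` E m !=set0]].

End hulls_and_limits.

Section L2_unit_interval.
Variable R : realType.

Definition lebesgue01 : {measure set (measurableTypeR R) -> \bar R} :=
  mrestr (@lebesgue_measure R) (measurable_itv `[0, 1]).

Definition L2I : normedModType R := LspaceType2 lebesgue01.

(* h may be arbitrary outside [0, 1], as [lebesgue01] vanishes there. The value is 0
   if h is not a.e. equal on [0, 1] to a square-integrable function. *)
Definition L2_class (h : R -> R) : L2I :=
  xget 0 [set g : L2I | (g : LspaceType2 lebesgue01) = h %[ae lebesgue01]].

Definition Smeas : set (R -> R) := [set phi : R -> R |
  [/\ measurable_fun (`[0, 1] : set R) phi,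
      forall x, x \in `[0, 1] -> phi x \in `[0, 1] &
      forall A : set R, measurable A -> A `<=` `[0, 1] ->
        lebesgue_measure (`[0, 1] `&` phi @^-1` A) = lebesgue_measure A]].

Definition Smeas_orbit (h : R -> R) : set L2I :=
  [set L2_class (h \o phi) | phi in Smeas].

Definition step_fun m (a : 'rV[R]_m.+1) : L2I :=
  L2_class (fun t => \sum_(k < m.+1)
    a 0 k * \1_(`[k%:R / m.+1%:R, k.+1%:R / m.+1%:R[) t).

Definition perm_orbit n (x : 'rV[R]_n) : set 'rV[R]_n :=
  range (fun s : 'S_n => col_perm s x).

End L2_unit_interval.

Section projective_line.
Variable R : realType.

(* The points of the complex projective line are the lines of C^2. *)
Definition CP1 := {U : {vspace 'rV[R[i]]_2} | \dim U == 1%N}.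

Definition hvec (z0 z1 : R[i]) : 'rV[R[i]]_2 :=
  \row_j (if j == 0 then z0 else z1).

Lemma hvec1l_dim w : \dim <[hvec 1 w]> == 1%N.
Proof.
rewrite dim_vline; suff -> : hvec 1 w != 0 by [].
apply/eqP => /(congr1 (fun v : 'rV_2 => v 0 0)) /eqP.
by rewrite !mxE oner_eq0.
Qed.

Lemma hvec1r_dim w : \dim <[hvec w 1]> == 1%N.
Proof.
rewrite dim_vline; suff -> : hvec w 1 != 0 by [].
apply/eqP => /(congr1 (fun v : 'rV_2 => v 0 1)) /eqP.
by rewrite !mxE oner_eq0.
Qed.

Definition chart0 (w : R[i]) : CP1 := exist _ <[hvec 1 w]>%VS (hvec1l_dim w).
Definition chart1 (z : R[i]) : CP1 := exist _ <[hvec z 1]>%VS (hvec1r_dim z).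

Definition xy (z : R * R) : R[i] := Complex z.1 z.2.

Fixpoint Ck (n : nat) (F : R * R -> R) : Prop :=
  if n is n'.+1 then
    (forall z, differentiable F z) /\ forall v, Ck n' (fun z => 'D_v F z)
  else continuous F.

(* C^oo in the two standard charts [1,w] and [z,1], which form an atlas. *)
Definition smooth_CP1 (f : CP1 -> R) : Prop :=
  forall n, Ck n (f \o chart0 \o xy) /\ Ck n (f \o chart1 \o xy).

(* i dw /\ d(conj w) = 2 dx /\ dy for w = x + i y. *)
Definition FS_density (z : R * R) : R := 2 / (1 + z.1 ^+ 2 + z.2 ^+ 2) ^+ 2.

Definition lebesgue2 :
    {measure set (measurableTypeR R * measurableTypeR R) -> \bar R} :=
  (@lebesgue_measure R \x @lebesgue_measure R)%E.

(* The form Omega has a smooth extension to the one point [0,1] outside the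
   chart [1,w], so that this point is null. *)
Definition FS_measure (A : set CP1) : \bar R :=
  (\int[lebesgue2]_(z in (chart0 \o xy) @^-1` A) (FS_density z)%:E)%E.

Definition FS_prob (A : set CP1) : \bar R := ((2 * pi)^-1%:E * FS_measure A)%E.

Definition distr_fun (f : CP1 -> R) (t : R) : R :=
  fine (FS_prob [set omega | f omega < t]).

(* Meaningful for 0 < s < 1; elsewhere [inf] may take its default value 0. *)
Definition decr_rearr (f : CP1 -> R) (s : R) : R :=
  inf [set t | 1 - distr_fun f t < s].

End projective_line.

Section toeplitz.
Variable R : realType.
Implicit Types s : R[i] -> R[i].

(* A section of the m-th power of the hyperplane bundle is given by its
   expression in the local coordinate w of the chart [1,w], i.e. up to its value
   at a null point. A holomorphic one is a polynomial in w of degree <= m. *)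

Definition FS_integral (h : R[i] -> R[i]) : R[i] :=
  Complex (\int[lebesgue2 R]_z (complex.Re (h (xy z)) * FS_density z))
          (\int[lebesgue2 R]_z (complex.Im (h (xy z)) * FS_density z)).

Definition sec_inner m s1 s2 : R[i] :=
  FS_integral (fun w => (1 + `|w| ^+ 2) ^- m * s1 w * (s2 w)^* ).

Definition hol_sec m (p : {poly_m.+1 R[i]}) : R[i] -> R[i] := fun w => p.[w].

(* Orthogonal projection of a square-integrable section: the holomorphic p such
   that s - p is orthogonal to all holomorphic sections. *)
Definition hol_proj m s : {poly_m.+1 R[i]} :=
  xget 0 [set p | forall q : {poly_m.+1 R[i]},
    sec_inner m (fun w => s w - hol_sec p w) (hol_sec q) = 0].

Definition mult_sec (f : CP1 R -> R) s : R[i] -> R[i] :=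
  fun w => (f (chart0 w))%:C%C * s w.

Definition toeplitz m (f : CP1 R -> R) (p : {poly_m.+1 R[i]}) : {poly_m.+1 R[i]} :=
  hol_proj m (mult_sec f (hol_sec (hol_proj m (hol_sec p)))).

(* Row i holds the coordinates of the image of w^i in the basis 1, w, .., w^m. *)
Definition toeplitz_mx m (f : CP1 R -> R) : 'M[R[i]]_m.+1 :=
  \matrix_(i, j) (toeplitz f (tnth (npolyX R[i] m.+1) i))`_j.

(* The real eigenvalues, listed with multiplicity in some order. *)
Definition toeplitz_eigenvalues m (f : CP1 R -> R) : 'rV[R]_m.+1 :=
  xget 0 [set l : 'rV[R]_m.+1 |
    char_poly (toeplitz_mx m f) = \prod_(k < m.+1) ('X - ((l 0 k)%:C%C)%:P)].

Definition toeplitz_hull (f : CP1 R -> R) (m : nat) : set (L2I R) :=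
  @step_fun R m @` conv_hull (perm_orbit (toeplitz_eigenvalues m f)).

End toeplitz.

(* Main.v *)
From HB Require Import structures.
Require Import Defs.
From mathcomp Require Import all_boot all_order all_algebra.
From mathcomp Require Import perm qpoly spectral sesquilinear complex.
From mathcomp Require Import all_classical all_reals all_analysis.
From mathcomp Require Import measurable_realfun ring lra zify.

(** Write q for the decreasing rearrangement of f, F for f in the chart [1, w],
    N = m + 1, and K for the closed convex hull of the orbit of q.

    The analytic input is that the eigenvalues of the Toeplitz operator, sorted in
    decreasing order and seen as a step function on N equal cells, converge to q
    in L2 ([szego_rearrangement]). Let v_j be an orthonormal basis of eigensections
    with eigenvalues l_j. The weights p_j = |v_j|^2 / N are nonnegative, sum to 1,
    have mean 1 / N each, and F has mean l_j for the probability density N p_j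
    ([toeplitz_spectrum]); so sum_j E[(F - l_j)^2 p_j] = E[F^2] - (sum_j l_j^2) / N.
    The trace formula turns the right side into one half of the double integral of
    (F z - F w)^2 against the squared modulus of the reproducing kernel, divided by
    N, which concentrates on the diagonal; uniform continuity of f on the sphere makes it tend to 0
    ([Ex_variance], [sphere_modulus]). On the other hand, matching the values of F
    with the numbers l_j in a monotone way is optimal for the quadratic cost, so
    that the same sum bounds the squared L2 distance between q and the step
    function of the sorted eigenvalues ([coupling]).

    The upper limit of the hulls E_m lies in K: a permutation of the cells is an
    interval exchange phi, so the step function of permuted eigenvalues is as close
    to q o phi as the sorted one is to q, and this closeness passes to convex
    combinations ([hull_near_orbit]). Since K is convex, closed and bounded, it is
    weakly closed ([weakly_closed]), and contains the weak closure of the upper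
    limit.

    Conversely, the lower limit of the sets E_m is closed and convex, so it is
    enough to see that it contains each q o phi with phi measure preserving. Such a
    function is approximated by a step function on the N cells; sorting the steps
    brings it close to q, again by the coupling inequality, hence close to the
    sorted eigenvalues, and undoing the sorting permutation gives a permutation of
    the eigenvalues close to q o phi ([orbit_sub_Li]). Thus K is contained in the
    lower limit, hence in the upper one. *)

Set Implicit Arguments.
Unset Strict Implicit.
Unset Printing Implicit Defensive.
Import Order.TTheory GRing.Theory Num.Theory.
Import numFieldNormedType.Exports.
Local Open Scope classical_set_scope.
Local Open Scope ring_scope.

(** * Expectations of bounded measurable functions *)

Section bounded_measurable.
Context d (T : measurableType d) (R : realType).
Implicit Types (h : T -> R).

(** Such functions are integrable for every probability measure and are closed
    under ring operations: working with them leaves no integrability side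
    condition. *)
Definition bdm h := measurable_fun [set: T] h /\ exists M, forall x, `|h x| <= M.

Lemma bdm_meas h : bdm h -> measurable_fun [set: T] h. Proof. by case. Qed.

Lemma bdm_bound h : bdm h -> exists M, 0 <= M /\ forall x, `|h x| <= M.
Proof.
move=> [_ [M hM]]; exists (Num.max M 0); split; first by rewrite le_max lexx orbT.
by move=> x; rewrite le_max hM.
Qed.

Lemma bdm_cst c : bdm (fun=> c).
Proof. by split; [exact: measurable_cst | exists `|c|]. Qed.

Lemma bdmD h1 h2 : bdm h1 -> bdm h2 -> bdm (fun x => h1 x + h2 x).
Proof.
move=> [m1 [M1 b1]] [m2 [M2 b2]]; split; first exact: measurable_funD.
by exists (M1 + M2) => x; rewrite (le_trans (ler_normD _ _))// lerD.
Qed.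

Lemma bdmN h : bdm h -> bdm (fun x => - h x).
Proof.
move=> [m1 [M1 b1]]; split; first exact: measurableT_comp.
by exists M1 => x; rewrite normrN.
Qed.

Lemma bdmB h1 h2 : bdm h1 -> bdm h2 -> bdm (fun x => h1 x - h2 x).
Proof. by move=> b1 b2; apply: bdmD => //; exact: bdmN. Qed.

Lemma bdmM h1 h2 : bdm h1 -> bdm h2 -> bdm (fun x => h1 x * h2 x).
Proof.
move=> b1 b2; split; first by apply: measurable_funM; exact: bdm_meas.
have [M1 [M10 {}b1]] := bdm_bound b1; have [M2 [M20 {}b2]] := bdm_bound b2.
by exists (M1 * M2) => x; rewrite normrM ler_pM.
Qed.

Lemma bdmX h n : bdm h -> bdm (fun x => h x ^+ n).
Proof.
move=> bh; elim: n => [|n IH]; first exact: (bdm_cst 1).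
rewrite [X in bdm X](_ : _ = (fun x => h x * h x ^+ n)); first exact: bdmM.
by apply/funext => x; rewrite exprS.
Qed.

Lemma bdm_sum (I : Type) (r : seq I) (P : pred I) (h : I -> T -> R) :
  (forall i, P i -> bdm (h i)) -> bdm (fun x => \sum_(i <- r | P i) h i x).
Proof.
move=> hb; elim: r => [|i r IH].
  by under eq_fun do rewrite big_nil; exact: (bdm_cst 0).
case Pi: (P i).
  rewrite [X in bdm X](_ : _ = (fun x => h i x + \sum_(j <- r | P j) h j x)).
    by apply: bdmD => //; exact: hb.
  by apply/funext => x; rewrite big_cons Pi.
by under eq_fun do rewrite big_cons Pi.
Qed.

Lemma bdm_max0 h : bdm h -> bdm (fun x => Num.max (h x) 0).
Proof.
move=> [m1 [M1 b1]]; split; first exact: measurable_funrpos.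
exists M1 => x; rewrite ger0_norm; last by rewrite le_max lexx orbT.
by rewrite ge_max (le_trans (ler_norm _) (b1 x)) (le_trans (normr_ge0 _) (b1 x)).
Qed.

Lemma bdm_indic (A : set T) : measurable A -> bdm (\1_A : T -> R).
Proof.
move=> mA; split; first exact: measurable_indic.
by exists 1 => x; rewrite indicE; case: (_ \in _); rewrite ?normr1 ?normr0.
Qed.

End bounded_measurable.

Section expectation.
Context d (T : measurableType d) (R : realType).
Variable mu : {measure set T -> \bar R}.
Hypothesis mu1 : mu setT = 1%E.
Implicit Types (h : T -> R).

Definition Ex h : R := \int[mu]_x h x.

Lemma bdm_integrable h : bdm h -> mu.-integrable setT (EFin \o h).
Proof.
move=> [mh [M hM]]; apply: measurable_bounded_integrable => //.
  by rewrite mu1 ltry.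
exists M; split; first by rewrite num_real.
by move=> M' MM' x _ /=; rewrite (le_trans (hM x))// ltW.
Qed.

Lemma Ex_cst c : Ex (fun=> c) = c.
Proof. by rewrite /Ex Rintegral_cst// mu1 /= mulr1. Qed.

Lemma ExD h1 h2 : bdm h1 -> bdm h2 -> Ex (fun x => h1 x + h2 x) = Ex h1 + Ex h2.
Proof. by move=> b1 b2; rewrite /Ex RintegralD//; exact: bdm_integrable. Qed.

Lemma ExB h1 h2 : bdm h1 -> bdm h2 -> Ex (fun x => h1 x - h2 x) = Ex h1 - Ex h2.
Proof. by move=> b1 b2; rewrite /Ex RintegralB//; exact: bdm_integrable. Qed.

Lemma ExZ c h : bdm h -> Ex (fun x => c * h x) = c * Ex h.
Proof. by move=> b1; rewrite /Ex RintegralZl//; exact: bdm_integrable. Qed.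

Lemma Ex_sum (I : Type) (r : seq I) (P : pred I) (h : I -> T -> R) :
  (forall i, P i -> bdm (h i)) ->
  Ex (fun x => \sum_(i <- r | P i) h i x) = \sum_(i <- r | P i) Ex (h i).
Proof.
move=> hb; elim: r => [|i r IH].
  by under eq_fun do rewrite big_nil; rewrite big_nil Ex_cst.
rewrite big_cons; case Pi: (P i); last first.
  by under eq_fun do rewrite big_cons Pi.
under eq_fun do rewrite big_cons Pi.
by rewrite ExD ?IH//; [exact: hb | exact: bdm_sum].
Qed.

Lemma Ex_le h1 h2 : bdm h1 -> bdm h2 -> (forall x, h1 x <= h2 x) -> Ex h1 <= Ex h2.
Proof. by move=> b1 b2 h12; apply: le_Rintegral => //; exact: bdm_integrable. Qed.

Lemma Ex_norm h : bdm h -> `|Ex h| <= Ex (fun x => `|h x|).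
Proof. by move=> bh; apply: le_normr_Rintegral => //; exact: bdm_integrable. Qed.

Lemma Ex_indic (A : set T) : measurable A -> Ex \1_A = fine (mu A).
Proof.
by move=> mA; rewrite /Ex /Rintegral integral_indic// setIT.
Qed.

Lemma Ex_ae h1 h2 : bdm h1 -> bdm h2 -> h1 = h2 %[ae mu] -> Ex h1 = Ex h2.
Proof.
move=> b1 b2 h12; rewrite /Ex /Rintegral; congr fine; apply: ae_eq_integral => //.
- by apply/measurable_EFinP; exact: bdm_meas.
- by apply/measurable_EFinP; exact: bdm_meas.
- by apply: filterS h12 => x hx /hx ->.
Qed.

End expectation.

Section equimeasurable.
Context d1 d2 (T1 : measurableType d1) (T2 : measurableType d2) (R : realType).
Variables (mu1 : {measure set T1 -> \bar R}) (mu2 : {measure set T2 -> \bar R}).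
Hypotheses (mu11 : mu1 setT = 1%E) (mu21 : mu2 setT = 1%E).
Variables (F1 : T1 -> R) (F2 : T2 -> R).

(** Equality in law, tested on upper half-lines only: this is the form in which
    a rearrangement provides it. *)
Definition equimeas := forall c : R,
  mu1 [set x | c < F1 x] = mu2 [set x | c < F2 x].

Hypotheses (b1 : bdm F1) (b2 : bdm F2).

(** The half-lines ]c, +oo[ are stable under intersection and generate the Borel
    sets, so two finite measures that agree on them are equal. *)
Lemma equimeas_law : equimeas -> forall A : set (measurableTypeR R), measurable A ->
  mu1 (F1 @^-1` A) = mu2 (F2 @^-1` A).
Proof.
move=> eqm A mA.
have m1 := bdm_meas b1; have m2 := bdm_meas b2.
pose n1 := @pushforward _ _ T1 (measurableTypeR R) R mu1 F1.
pose n2 := @pushforward _ _ T2 (measurableTypeR R) R mu2 F2.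
have m1' : @measurable_fun _ _ T1 (measurableTypeR R) setT F1 by [].
have m2' : @measurable_fun _ _ T2 (measurableTypeR R) setT F2 by [].
pose G := [set A : set R | exists c, A = `]c, +oo[%classic].
apply: (@measure_unique _ R (measurableTypeR R) (RGenOInfty.G (R:=R))
   (fun n => `]- n%:R, +oo[%classic) _ _ _ _ n1 n2) => //.
- exact: RGenOInfty.measurableE.
- move=> _ _ [a ->] [b ->]; exists (Num.max a b).
  by apply/seteqP; split => x /=; rewrite !in_itv/= !andbT gt_max => /andP.
- by move=> n; exists (- n%:R).
- rewrite -subTset => x _; exists (Num.truncn `|x|).+1 => //=; rewrite in_itv/= andbT.
  by rewrite ltrNl (le_lt_trans _ (truncnS_gt _))// -normrN ler_norm.
- move=> _ [c ->]; rewrite /n1 /n2 /pushforward.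
  have E d (T : measurableType d) (F : T -> R) :
     F @^-1` `]c, +oo[%classic = [set x | c < F x].
    by apply/seteqP; split => x /=; rewrite in_itv/= andbT.
  by have := eqm c; rewrite -!E.
- move=> k; rewrite (le_lt_trans (le_measure _ _ _ (subsetT _)))// ?inE//.
  suff : (mu1 setT < +oo)%E by [].
  by rewrite mu11 ltry.
Qed.

Lemma equimeas_Ex (phi : R -> R) : equimeas -> measurable_fun setT phi ->
  bdm (phi \o F1) -> bdm (phi \o F2) -> Ex mu1 (phi \o F1) = Ex mu2 (phi \o F2).
Proof.
move=> eqm mphi p1 p2; rewrite /Ex /Rintegral; congr fine.
have m1 := bdm_meas b1; have m2 := bdm_meas b2.
have m1' : @measurable_fun _ _ T1 (measurableTypeR R) setT F1 by [].
have m2' : @measurable_fun _ _ T2 (measurableTypeR R) setT F2 by [].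
pose n1 := @pushforward _ _ T1 (measurableTypeR R) R mu1 F1.
pose n2 := @pushforward _ _ T2 (measurableTypeR R) R mu2 F2.
have mE : @measurable_fun _ _ (measurableTypeR R) (measurableTypeR R) setT phi by [].
transitivity (\int[n1]_y (phi y)%:E)%E.
  rewrite (integral_pushforward m1') ?preimage_setT//.
  - exact/measurable_EFinP.
  - exact: bdm_integrable.
transitivity (\int[n2]_y (phi y)%:E)%E.
  by apply: eq_measure_integral => A mA _; exact: equimeas_law.
rewrite (integral_pushforward m2') ?preimage_setT//.
- exact/measurable_EFinP.
- exact: bdm_integrable.
Qed.

End equimeasurable.

Section complex_expectation.
Context d (T : measurableType d) (R : realType).
Implicit Types (h : T -> R[i]).

Definition cbdm h := bdm (fun x => complex.Re (h x)) /\ bdm (fun x => complex.Im (h x)).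

Lemma cbdm_cst c : cbdm (fun=> c).
Proof. by split; exact: bdm_cst. Qed.

Lemma cbdm_real (g : T -> R) : bdm g -> cbdm (fun x => (g x)%:C%C).
Proof. by move=> bg; split => //=; exact: bdm_cst. Qed.

Lemma cbdm_ext h1 h2 : (forall x, h1 x = h2 x) -> cbdm h1 -> cbdm h2.
Proof. by move=> e; rewrite (_ : h1 = h2)//; exact/funext. Qed.

Lemma cbdmD h1 h2 : cbdm h1 -> cbdm h2 -> cbdm (fun x => h1 x + h2 x).
Proof.
by move=> [r1 i1] [r2 i2]; split; [have := bdmD r1 r2 | have := bdmD i1 i2];
  congr bdm; apply/funext => x; case: (h1 x) => ? ?; case: (h2 x) => ? ?.
Qed.

Lemma cbdmM h1 h2 : cbdm h1 -> cbdm h2 -> cbdm (fun x => h1 x * h2 x).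
Proof.
move=> [r1 i1] [r2 i2]; split.
  by have := bdmB (bdmM r1 r2) (bdmM i1 i2);
  congr bdm; apply/funext => x; case: (h1 x) => ? ?; case: (h2 x) => ? ?.
by have := bdmD (bdmM r1 i2) (bdmM i1 r2);
  congr bdm; apply/funext => x; case: (h1 x) => ? ?; case: (h2 x) => ? ?.
Qed.

Lemma cbdm_sum (I : Type) (r : seq I) (P : pred I) (h : I -> T -> R[i]) :
  (forall i, P i -> cbdm (h i)) -> cbdm (fun x => \sum_(i <- r | P i) h i x).
Proof.
move=> hb; elim: r => [|i r IH].
  by apply: (cbdm_ext _ (cbdm_cst 0)) => x; rewrite big_nil.
case Pi: (P i); last by apply: (cbdm_ext _ IH) => x; rewrite big_cons Pi.
apply: (cbdm_ext (h1 := fun x => h i x + \sum_(j <- r | P j) h j x)).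
  by move=> x; rewrite big_cons Pi.
by apply: cbdmD => //; exact: hb.
Qed.

Variable mu : {measure set T -> \bar R}.
Hypothesis mu1 : mu setT = 1%E.

Definition cEx h : R[i] :=
  Complex (Ex mu (fun x => complex.Re (h x))) (Ex mu (fun x => complex.Im (h x))).

Lemma cEx_ext h1 h2 : (forall x, h1 x = h2 x) -> cEx h1 = cEx h2.
Proof. by move=> e; congr cEx; exact/funext. Qed.

Lemma cEx_cst c : cEx (fun=> c) = c.
Proof. by rewrite /cEx !Ex_cst//; case: c. Qed.

Lemma cEx_real (g : T -> R) : cEx (fun x => (g x)%:C%C) = (Ex mu g)%:C%C.
Proof. by rewrite /cEx /= Ex_cst. Qed.

Lemma cExD h1 h2 : cbdm h1 -> cbdm h2 -> cEx (fun x => h1 x + h2 x) = cEx h1 + cEx h2.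
Proof.
move=> [r1 i1] [r2 i2]; rewrite /cEx; simpc; congr Complex; rewrite -ExD//;
  by congr Ex; apply/funext => x; case: (h1 x) => ? ?; case: (h2 x) => ? ?.
Qed.

Lemma cExZ c h : cbdm h -> cEx (fun x => c * h x) = c * cEx h.
Proof.
case: c => a b [r1 i1]; rewrite /cEx; simpc; congr Complex.
  by rewrite -!ExZ// -ExB//; [congr Ex; apply/funext => x; case: (h x)
    | exact: bdmM (bdm_cst _ _) r1 | exact: bdmM (bdm_cst _ _) i1].
by rewrite -!ExZ// -ExD//; [congr Ex; apply/funext => x; case: (h x)
    | exact: bdmM (bdm_cst _ _) i1 | exact: bdmM (bdm_cst _ _) r1].
Qed.

Lemma cEx_conj h : cbdm h -> cEx (fun x => (h x)^*) = (cEx h)^*.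
Proof.
move=> [r1 i1]; rewrite /cEx /=; congr Complex.
  by congr Ex; apply/funext => x; case: (h x).
rewrite -[RHS]mulN1r -ExZ//; congr Ex; apply/funext => x.
by rewrite mulN1r; case: (h x).
Qed.

Lemma cEx_sum (I : Type) (r : seq I) (P : pred I) (h : I -> T -> R[i]) :
  (forall i, P i -> cbdm (h i)) ->
  cEx (fun x => \sum_(i <- r | P i) h i x) = \sum_(i <- r | P i) cEx (h i).
Proof.
move=> hb; elim: r => [|i r IH].
  by rewrite big_nil -[RHS]cEx_cst; apply: cEx_ext => x; rewrite big_nil.
rewrite big_cons; case Pi: (P i); last first.
  by rewrite -IH; apply: cEx_ext => x; rewrite big_cons Pi.
rewrite -IH -cExD; [|exact: hb|exact: cbdm_sum].
by apply: cEx_ext => x; rewrite big_cons Pi.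
Qed.

End complex_expectation.

(** * Integrals on the line and total mass of the Fubini-Study form *)

Section plane_integral.
Variable R : realType.
Lemma integrable_oneDsqr (C : R) : (@lebesgue_measure R).-integrable setT (fun x => (C / (1 + x ^+ 2))%:E).
Proof.
rewrite (_ : (fun x => _) = (fun x => C%:E * ((1 + x ^+ 2)^-1)%:E))%E; last first.
  by apply/funext => x; rewrite EFinM.
apply: integrableZl => //; apply/integrableP; split.
  apply/measurable_EFinP; apply: continuous_measurable_fun; exact: continuous_oneDsqrV.
have -> : (\int[@lebesgue_measure R]_x `|((1 + x ^+ 2)^-1)%:E| =
    \int[@lebesgue_measure R]_x ((oneDsqr x)^-1)%:E)%E.
  by apply: eq_integral => x _; rewrite gee0_abs// lee_fin invr_ge0 -/(oneDsqr x).
rewrite ge0_symfun_integralT//=; first last.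
- by move=> x /=; rewrite /oneDsqr sqrrN.
- exact: continuous_oneDsqrV.
by rewrite -set_itvcy integral0y_oneDsqr -EFinM ltry.
Qed.

(** The fundamental theorem of calculus on the whole line: the bound by C / (1 +
    x^2) lets dominated convergence pass from the segments [-n, n] to R. *)
Lemma integral_derivative_line (F f : R -> R) (C l : R) :
  (forall x : R, is_derive x 1 F (f x)) -> continuous f ->
  (forall x, `|f x| <= C / (1 + x ^+ 2)) ->
  (F n%:R - F (- n%:R)) @[n --> \oo] --> l ->
  (\int[@lebesgue_measure R]_x (f x)%:E = l%:E)%E.
Proof.
move=> dF cf fC Fl.
have mf : measurable_fun setT f by exact: continuous_measurable_fun.
pose D (n : nat) : set R := `[- n%:R, n%:R]%classic.
pose g n := EFin \o (f \_ (D n)).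
have mg n : measurable_fun setT (g n).
  apply/measurable_EFinP; apply/(measurable_restrictT _ _).1; last exact: measurable_funTS.
  exact: measurable_itv.
have mf' : measurable_fun setT (EFin \o f) by exact/measurable_EFinP.
have gf : {ae @lebesgue_measure R, forall x, setT x -> g ^~ x @ \oo --> (EFin \o f) x}.
  apply/aeW => x _; apply/fine_cvgP; split; first by apply: nearW.
  apply: cvg_near_cst; near=> n; rewrite /g /= patchE mem_set// /D /= in_itv/=.
  rewrite -ler_norml; near: n; exists (Num.truncn `|x|).+1 => // n /= xn.
  by rewrite (le_trans (ltW (truncnS_gt _)))// ler_nat.
have gC : {ae @lebesgue_measure R, forall x n, setT x -> (`|g n x| <= (C / (1 + x ^+ 2))%:E)%E}.
  apply/aeW => x n _; rewrite /g /= lee_fin patchE; case: ifP => // _.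
  by rewrite normr0 (le_trans _ (fC x)).
have [_ _ cv] := @dominated_convergence _ (measurableTypeR R) R (@lebesgue_measure R) setT
  measurableT g (EFin \o f) _ mg mf' gf (integrable_oneDsqr C) gC.
have E n : (\int[@lebesgue_measure R]_x (g n x))%E = (F n%:R - F (- n%:R))%:E.
  transitivity (\int[@lebesgue_measure R]_(x in D n) (f x)%:E)%E.
    by rewrite [RHS]integral_mkcond; apply: eq_integral => x _; rewrite restrict_EFin.
  have [->|n0] := eqVneq n 0%N.
    by rewrite /D oppr0 set_itv1 integral_set1 subrr.
  rewrite (@continuous_FTC2 _ f F (- n%:R) n%:R)//.
  - by rewrite gtrN// ltr0n lt0n.
  - exact: continuous_subspaceT.
  - have cF x : F @ x --> F x.
      by apply: differentiable_continuous; apply/derivable1_diffP; apply: ex_derive.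
    split => [x _||].
    + by apply: ex_derive.
    + exact: cvg_at_right_filter.
    + exact: cvg_at_left_filter.
  - by move=> x _; rewrite derive1E; exact: derive_val.
have E2 : (fun n => \int[@lebesgue_measure R]_x g n x)%E = EFin \o (fun n : nat => F n%:R - F (- n%:R)).
  by apply/funext => n; rewrite E.
have cv' : (EFin \o (fun n : nat => F n%:R - F (- n%:R))) @ \oo --> l%:E.
  by apply: cvg_EFin; [exact: nearW|exact: Fl].
have cv2 : (fun n => \int[@lebesgue_measure R]_x g n x)%E @ \oo --> (\int[@lebesgue_measure R]_x (f x)%:E)%E by exact: cv.
rewrite E2 in cv2; exact: (cvg_unique _ cv2 cv').
Unshelve. all: by end_near. Qed.

(** The differentiation rules, for functions given by explicit formulas, so that
    the derivative of a composite formula is found by unification. *)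
Lemma is_derive_fun_cst (c x : R) : is_derive x 1 (fun=> c) 0.
Proof. exact: is_derive_cst. Qed.
Lemma is_derive_fun_id (x : R) : is_derive x 1 (fun y : R => y) 1.
Proof. exact: is_derive_id. Qed.
Lemma is_derive_funD (f g : R -> R) (x df dg : R) : is_derive x 1 f df -> is_derive x 1 g dg ->
  is_derive x 1 (fun y => f y + g y) (df + dg).
Proof. by move=> a b; exact: is_deriveD. Qed.
Lemma is_derive_funN (f : R -> R) (x df : R) : is_derive x 1 f df ->
  is_derive x 1 (fun y => - f y) (- df).
Proof. by move=> a; exact: is_deriveN. Qed.
Lemma is_derive_funM (f g : R -> R) (x df dg : R) : is_derive x 1 f df -> is_derive x 1 g dg ->
  is_derive x 1 (fun y => f y * g y) (f x * dg + g x * df).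
Proof. by move=> a b; exact: is_deriveM. Qed.
Lemma is_derive_funX (f : R -> R) n (x df : R) : is_derive x 1 f df ->
  is_derive x 1 (fun y => f y ^+ n) (n%:R * f x ^+ n.-1 * df).
Proof.
move=> a; elim: n => [|n IH].
  by rewrite mul0r mul0r; under eq_fun do rewrite expr0; exact: is_derive_fun_cst.
under eq_fun do rewrite exprS.
have h := is_derive_funM a IH; apply: is_derive_eq h _.
case: n {IH} => [|n]; first by rewrite /= expr0; ring.
by rewrite /= [in RHS]mulrS !exprS; ring.
Qed.
Lemma is_derive_funV (f : R -> R) (x df : R) : f x != 0 -> is_derive x 1 f df ->
  is_derive x 1 (fun y => (f y)^-1) (- f x ^- 2 * df).
Proof. by move=> a b; exact: is_deriveV. Qed.
Lemma is_derive_continuous (f df : R -> R) : (forall x : R, is_derive x 1 f (df x)) ->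
  continuous f.
Proof.
move=> d x; apply: differentiable_continuous; apply/derivable1_diffP.
by have dx := d x; apply: ex_derive.
Qed.

Lemma integral_inv_sqrD (a : R) : 1 <= a ->
  (\int[@lebesgue_measure R]_x ((a ^+ 2 + x ^+ 2) ^- 2)%:E = (pi / 2 / a ^+ 3)%:E)%E.
Proof.
move=> a1; have a0 : 0 < a by rewrite (lt_le_trans ltr01).
have an0 : a != 0 by rewrite gt_eqF.
have D0 (x : R) : 0 < a ^+ 2 + x ^+ 2 by rewrite ltr_pwDl ?sqr_ge0// exprn_gt0.
have Dn0 (x : R) : a ^+ 2 + x ^+ 2 != 0 by rewrite gt_eqF.
pose F (x : R) : R := (x * (a ^+ 2 + x ^+ 2)^-1 * (a ^+ 2)^-1 + atan (x * a^-1) * (a ^+ 3)^-1) * 2^-1.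
apply: (@integral_derivative_line F _ 1).
- move=> x; rewrite /F.
  apply: is_derive_eq.
  have := Dn0 x; rewrite /= => h.
  have h2 : 1 + (x / a) ^+ 2 != 0 by rewrite gt_eqF// ltr_pwDl// sqr_ge0.
  rewrite !scaler0 !(add0r,addr0) /GRing.scale/= mulr1.
  field.
  by rewrite h an0.
- apply: (is_derive_continuous (df := fun x => - ((a ^+ 2 + x ^+ 2) ^+ 2) ^- 2 *
    (2%:R * (a ^+ 2 + x ^+ 2) ^+ 1 * (0 + 2%:R * x ^+ 1 * 1)))) => x.
  apply: is_derive_funV; first by rewrite expf_neq0.
  by apply: is_derive_funX; apply: is_derive_funD; first [exact: is_derive_fun_cst | apply: is_derive_funX; exact: is_derive_fun_id].
- move=> x; rewrite ger0_norm; last by rewrite invr_ge0 exprn_ge0// ltW.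
  have x0 := sqr_ge0 x; have a2 : 1 <= a ^+ 2 by rewrite exprn_ege1.
  rewrite div1r lef_pV2 ?posrE; [|by rewrite exprn_gt0|].
    by set X := x ^+ 2 in x0 *; set A := a ^+ 2 in a2 *; nra.
  by rewrite ltr_pwDl.
have -> : (fun n : nat => F n%:R - F (- n%:R)) =
  (fun n : nat => (n%:R / (a ^+ 2 + n%:R ^+ 2) / a ^+ 2 + atan (n%:R / a) / a ^+ 3)).
  apply/funext => n; rewrite /F sqrrN !mulNr atanN; field.
  by rewrite Dn0 an0.
rewrite -[X in _ --> X]add0r; apply: cvgD; last first.
  apply: cvgM; last exact: cvg_cst.
  have h : (fun n : nat => n%:R / a) @ \oo --> +oo.
    have ai : 0 < a^-1 by rewrite invr_gt0.
    exact: (@gt0_cvgMly R ((fun n => n%:R) @ \oo) _ a^-1 id ai (@cvgr_idn R)).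
  exact: (cvg_comp _ _ h (@cvgy_atan R)).
rewrite -[X in _ --> X](mul0r (a ^+ 2)^-1); apply: cvgM; last exact: cvg_cst.
apply: (@squeeze_cvgr _ _ _ _ (fun=> 0) (fun n : nat => 2 * harmonic n)); first last.
- by rewrite -[X in _ --> X](mulr0 2); apply: cvgM; [exact: cvg_cst|exact: cvg_harmonic].
- exact: cvg_cst.
apply: nearW => n; rewrite mulr_ge0 ?invr_ge0 ?(ltW (D0 _))//= /harmonic.
rewrite ler_pdivrMr// mulrAC ler_pdivlMr// -natr1.
have n0 : 0 <= n%:R :> R by [].
have a2 : 1 <= a ^+ 2 by rewrite exprn_ege1.
by set A := a ^+ 2 in a2 *; set N := n%:R in n0 *; nra.
Qed.

Lemma continuous_sqrt_cube : continuous (fun y : R => Num.sqrt (1 + y ^+ 2) ^- 3).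
Proof.
move=> x.
  have x1 : 0 < 1 + x ^+ 2 by rewrite ltr_pwDl// sqr_ge0.
  apply: cvgV. by rewrite expf_neq0// gt_eqF// sqrtr_gt0.
  apply: (continuous_comp (f := fun x : R => Num.sqrt (1 + x ^+ 2)) (g := fun x => x ^+ 3)); last first.
   exact: exprn_continuous.
  apply: (continuous_comp (f := fun x : R => (1 + x ^+ 2)) (g := Num.sqrt)).
    exact: continuous_oneDsqr.
  exact: sqrt_continuous.
Qed.

(** A primitive of (1 + y^2)^(-3/2) is y / sqrt (1 + y^2) = sin (atan y), and in
    the second form its limits at infinity are known. *)
Lemma integral_sqrt_cube : (\int[@lebesgue_measure R]_y ((Num.sqrt (1 + y ^+ 2)) ^- 3)%:E = 2%:E)%E.
Proof.
pose F (y : R) := sin (atan y).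
apply: (@integral_derivative_line F _ 1).
- move=> x; rewrite /F; apply: is_derive_eq.
  have x1 : 0 < 1 + x ^+ 2 by rewrite ltr_pwDl// sqr_ge0.
  rewrite cos_atan.
  by rewrite -{2}(sqr_sqrtr (ltW x1)) -invfM -exprS.
- exact: continuous_sqrt_cube.
- move=> x.
  have x1 : 1 <= 1 + x ^+ 2 by rewrite lerDl// sqr_ge0.
  have x0 : 0 < 1 + x ^+ 2 by rewrite (lt_le_trans ltr01).
  rewrite ger0_norm ?invr_ge0 ?exprn_ge0 ?sqrtr_ge0// div1r lef_pV2 ?posrE ?exprn_gt0 ?sqrtr_gt0//.
  rewrite -{1}(sqr_sqrtr (ltW x0)) ler_weXn2l//.
  by rewrite -[leLHS]sqrtr1 ler_wsqrtr.
have -> : (fun n : nat => F n%:R - F (- n%:R)) = (fun n => 2 * sin (atan n%:R)).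
  by apply/funext => n; rewrite /F atanN sinN; ring.
rewrite -[X in _ --> X]mulr1; apply: cvgM; first exact: cvg_cst.
have h : (fun n : nat => atan (n%:R : R)) @ \oo --> pi / 2.
  exact: (cvg_comp _ _ (@cvgr_idn R) (@cvgy_atan R)).
rewrite -[X in _ --> X](@sin_pihalf R); apply: (cvg_comp _ _ h).
exact: continuous_sin.
Qed.

Definition plane : measurableType _ := (measurableTypeR R * measurableTypeR R)%type.

(** Inversion is not continuous at 0, but on [1, +oo[ it agrees with the
    continuous map r |-> 1 / max r 1. *)
Lemma inv_ge1_measurable d (T : measurableType d) (h : T -> R) :
  measurable_fun setT h -> (forall x, 1 <= h x) -> measurable_fun setT (fun x => (h x)^-1).
Proof.
move=> mh h1.
have -> : (fun x => (h x)^-1) = (fun r : R => (Num.max r 1)^-1) \o h.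
  by apply/funext => x /=; rewrite (max_idPl (h1 x)).
apply: measurableT_comp => //; apply: continuous_measurable_fun => x.
have c : {for x, continuous (fun r : R => Num.max r 1)}.
  by apply: continuous_max; [exact: cvg_id|exact: cvg_cst].
by apply: cvgV => //; rewrite gt_eqF// lt_max ltr01 orbT.
Qed.

Lemma measurable_z1 : measurable_fun setT (fun z : plane => z.1 : R).
Proof. exact: measurable_fst. Qed.
Lemma measurable_z2 : measurable_fun setT (fun z : plane => z.2 : R).
Proof. exact: measurable_snd. Qed.

Lemma r2_ge1 (z : plane) : 1 <= 1 + z.1 ^+ 2 + z.2 ^+ 2 :> R.
Proof. by rewrite -addrA lerDl addr_ge0// sqr_ge0. Qed.

Lemma measurable_r2 : measurable_fun setT (fun z : plane => 1 + z.1 ^+ 2 + z.2 ^+ 2 : R).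
Proof.
apply: measurable_funD; first apply: measurable_funD => //.
  by apply: measurable_funX; exact: measurable_z1.
by apply: measurable_funX; exact: measurable_z2.
Qed.

Lemma FS_densityE z : FS_density z = 2 * ((1 + z.1 ^+ 2 + z.2 ^+ 2)^-1) ^+ 2 :> R.
Proof. by rewrite /FS_density exprVn. Qed.

Lemma measurable_FS_density : measurable_fun setT (@FS_density R : plane -> R).
Proof.
rewrite (_ : @FS_density R = (fun z => 2 * ((1 + z.1 ^+ 2 + z.2 ^+ 2)^-1) ^+ 2)); last first.
  by apply/funext => z; exact: FS_densityE.
apply: measurable_funM => //; apply: measurable_funX.
by apply: inv_ge1_measurable; [exact: measurable_r2|exact: r2_ge1].
Qed.

Lemma FS_density_gt0 z : 0 < FS_density z :> R.
Proof.
rewrite FS_densityE mulr_gt0// exprn_gt0// invr_gt0.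
exact: lt_le_trans (r2_ge1 z).
Qed.

(** By Tonelli, integrating in x first leaves pi (1 + y^2)^(-3/2), whose
    integral is 2 pi. *)
Lemma integral_FS_density : (\int[lebesgue2 R]_z (FS_density z)%:E = (2 * pi)%:E)%E.
Proof.
rewrite /lebesgue2 (fubini_tonelli2 (fun z : plane => (FS_density z)%:E)) /=; first last.
- by move=> z; rewrite lee_fin ltW// FS_density_gt0.
- by apply/measurable_EFinP; exact: measurable_FS_density.
transitivity (\int[@lebesgue_measure R]_y (pi%:E * ((Num.sqrt (1 + y ^+ 2)) ^- 3)%:E))%E.
  apply: eq_integral => y _; rewrite /fubini_G/=.
  have y1 : 1 <= Num.sqrt (1 + y ^+ 2).
    by rewrite -[leLHS]sqrtr1 ler_wsqrtr// lerDl sqr_ge0.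
  have E x : FS_density (x, y) = 2 * ((Num.sqrt (1 + y ^+ 2)) ^+ 2 + x ^+ 2) ^- 2.
    by rewrite /FS_density/= sqr_sqrtr ?addr_ge0 ?sqr_ge0// addrAC.
  under eq_integral do rewrite E EFinM.
  rewrite ge0_integralZl//=.
  - rewrite integral_inv_sqrD// -!EFinM; congr EFin.
    by field; rewrite gt_eqF// (lt_le_trans ltr01).
  - apply/measurable_EFinP; apply: continuous_measurable_fun => x.
    apply: cvgV; first by rewrite expf_neq0// gt_eqF// ltr_pwDl ?sqr_ge0// exprn_gt0// (lt_le_trans ltr01).
    apply: (continuous_comp (f := fun x : R => _ + x ^+ 2) (g := fun x => x ^+ 2)).
      by apply: cvgD; [exact: cvg_cst|exact: exprn_continuous].
    exact: exprn_continuous.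
  - by move=> x _; rewrite lee_fin invr_ge0 exprn_ge0// addr_ge0 ?sqr_ge0.
rewrite ge0_integralZl//=.
- by rewrite integral_sqrt_cube -EFinM mulrC.
- apply/measurable_EFinP; apply: continuous_measurable_fun; exact: continuous_sqrt_cube.
- by rewrite lee_fin pi_ge0.
Qed.
End plane_integral.

(** * The Fubini-Study probability measure in a chart *)

(** The values of g are rounded down to the grid - M + e nat, which is finite
    because g is bounded. *)
Lemma bdm_staircase d (T : measurableType d) (R : realType) (g : T -> R) (e : R) :
  bdm g -> 0 < e -> exists n (c : 'I_n -> R) (A : 'I_n -> set T),
    (forall k, measurable (A k)) /\ forall x, `|g x - \sum_k c k * \1_(A k) x| <= e.
Proof.
move=> bg e0; have [M [M0 gM]] := bdm_bound bg.
have gM0 x : 0 <= g x + M by have := gM x; rewrite ler_norml => /andP[]; lra.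
have q0 x : 0 <= (g x + M) / e by rewrite divr_ge0// ltW.
pose j x := Num.truncn ((g x + M) / e).
have jn x : (j x < (Num.truncn (2 * M / e)).+1)%N.
  rewrite ltnS; apply: le_truncn; rewrite ler_wpM2r ?invr_ge0 ?(ltW e0)//.
  by have := gM x; rewrite ler_norml => /andP[]; lra.
exists (Num.truncn (2 * M / e)).+1, (fun k => k%:R * e - M), (fun k => [set x | j x = k]).
split=> [k|x].
  have -> : [set x | j x = k] = g @^-1` `[k%:R * e - M, k.+1%:R * e - M[%classic.
    apply/seteqP; split => x /=; rewrite in_itv/= lerBlDr ltrBrDr -ler_pdivlMr// -ltr_pdivrMr//.
      by move=> <-; exact: truncn_itv.
    exact: truncn_def.
  by rewrite -[X in measurable X]setTI; apply: (bdm_meas bg); first exact: measurableT.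
rewrite (bigD1 (Ordinal (jn x)))//= big1 => [|k kj]; last first.
  rewrite indicE memNset ?mulr0// => /= jk; case/negP: kj; apply/eqP; exact: val_inj.
rewrite addr0 indicE mem_set// mulr1.
have /andP[] := truncn_itv (q0 x); rewrite -/(j x) ler_pdivlMr// ltr_pdivrMr// -natr1 => h1 h2.
by rewrite ger0_norm; lra.
Qed.

Section density.
Context d (T : measurableType d) (R : realType).
Variables (mu : {measure set T -> \bar R}) (w : T -> R).
Hypotheses (mw : measurable_fun setT w) (w0 : forall x, 0 <= w x).

(** The two proofs are arguments so that the measure structure can be attached
    to the constant. *)
Definition density of measurable_fun setT w & (forall x, 0 <= w x) :=
  fun A : set T => (\int[mu]_(x in A) (w x)%:E)%E.
Local Notation nu := (density mw w0).

Let density0 : nu set0 = 0%E. Proof. exact: integral_set0. Qed.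
Let density_ge0 A : (0 <= nu A)%E. Proof. by apply: integral_ge0 => x _; rewrite lee_fin. Qed.
Let density_add : semi_sigma_additive nu.
Proof.
apply: semi_sigma_additive_nng_induced; first exact/measurable_EFinP.
by move=> x; rewrite lee_fin.
Qed.
HB.instance Definition _ := isMeasure.Build _ _ _ nu density0 density_ge0 density_add.

Hypothesis w1 : (\int[mu]_x (w x)%:E = 1)%E.
Let nu1 : nu setT = 1%E. Proof. by []. Qed.

Let Phi (g : T -> R) := \int[mu]_x (g x * w x).

Let Phi_integrable g : bdm g -> mu.-integrable setT (EFin \o (fun x => g x * w x)).
Proof.
move=> bg; have [M [M0 gM]] := bdm_bound bg.
have iw : mu.-integrable setT (EFin \o w).
  apply/integrableP; split; first exact/measurable_EFinP.
  by under eq_integral do rewrite /= ger0_norm//; rewrite w1 ltry.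
apply: le_integrable (integrableZl measurableT M iw) => //.
  by apply/measurable_EFinP; apply: measurable_funM => //; exact: bdm_meas bg.
by move=> x _ /=; rewrite lee_fin !normrM ler_wpM2r// (le_trans (gM x))// ler_norm.
Qed.

Let PhiD g h : bdm g -> bdm h -> Phi (fun x => g x + h x) = Phi g + Phi h.
Proof.
move=> bg bh; rewrite /Phi -RintegralD//; [|exact: Phi_integrable..].
by apply: eq_Rintegral => x _; rewrite mulrDl.
Qed.

Let PhiZ c g : bdm g -> Phi (fun x => c * g x) = c * Phi g.
Proof.
move=> bg; rewrite /Phi -RintegralZl//; last exact: Phi_integrable.
by apply: eq_Rintegral => x _; rewrite mulrA.
Qed.

Let Phi_norm g e : bdm g -> (forall x, `|g x| <= e) -> `|Phi g| <= e.
Proof.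
move=> bg ge; have ie := Phi_integrable (bdm_cst _ e).
apply: le_trans (le_normr_Rintegral measurableT (Phi_integrable bg)) _.
apply: (@le_trans _ _ (\int[mu]_x (e * w x))).
  apply: le_Rintegral => //; last by move=> x _; rewrite normrM (ger0_norm (w0 x)) ler_wpM2r.
  by have := integrable_abse (Phi_integrable bg); apply: eq_integrable.
rewrite RintegralZl//; last by have := Phi_integrable (bdm_cst _ 1); under eq_fun do rewrite mul1r.
by rewrite /Rintegral w1 mulr1.
Qed.

Let Phi_indic A : measurable A -> Phi \1_A = Ex nu \1_A.
Proof.
move=> mA; rewrite Ex_indic// /Phi /Rintegral; congr fine.
rewrite [RHS]integral_mkcond; apply: eq_integral => x _.
by rewrite patchE indicE; case: ifP; rewrite ?mul1r ?mul0r.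
Qed.

(** Both sides are linear in g, agree on indicators, and are bounded by the sup
    norm of g; staircase functions are dense for that norm. *)
Lemma Ex_density g : bdm g -> Ex nu g = Phi g.
Proof.
move=> bg; apply/eqP; rewrite -subr_eq0 -normr_le0; apply/ler_addgt0Pr => e e0; rewrite add0r.
have e2 : 0 < e / 2 by rewrite divr_gt0.
have [n [c [A [mA gs]]]] := bdm_staircase bg e2.
pose s x := \sum_k c k * \1_(A k) x.
have bA k : bdm (fun x => c k * \1_(A k) x).
  by apply: bdmM; [exact: bdm_cst|exact: bdm_indic].
have bs : bdm s by exact: bdm_sum.
have bgs : bdm (fun x => g x - s x) by exact: bdmB.
have EPs : Ex nu s = Phi s.
  rewrite /s; elim: (index_enum _) => [|k r IH].
    under eq_fun do rewrite big_nil.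
    by rewrite Ex_cst// -[LHS](mul0r (Phi (fun=> 0))) -PhiZ ?mul0r//; exact: bdm_cst.
  have br : bdm (fun x => \sum_(k <- r) c k * \1_(A k) x) by exact: bdm_sum.
  under eq_fun do rewrite big_cons.
  by rewrite ExD// PhiD// IH ExZ ?PhiZ ?Phi_indic//; exact: bdm_indic.
have bNs : bdm (fun x => - 1 * s x) by apply: bdmM => //; exact: bdm_cst.
have -> : Ex nu g - Phi g = Ex nu (fun x => g x - s x) - Phi (fun x => g x - s x).
  rewrite ExB// (_ : (fun x => g x - s x) = (fun x => g x + -1 * s x)); last first.
    by apply/funext => x; rewrite mulN1r.
  by rewrite PhiD// PhiZ// EPs; ring.
rewrite (le_trans (ler_normB _ _))// [leRHS]splitr lerD//; last exact: Phi_norm.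
apply: le_trans (Ex_norm nu1 bgs) _; rewrite -[leRHS](Ex_cst nu1).
apply: Ex_le => //; last exact: bdm_cst.
by split; [apply: measurableT_comp => //; exact: bdm_meas bgs|exists (e / 2) => x; rewrite normr_id].
Qed.
End density.

Section FS_probability.
Variable R : realType.
Notation plane := (plane R).

Lemma FSw_measurable : measurable_fun setT (fun z : plane => (2 * pi)^-1 * FS_density z : R).
Proof. by apply: measurable_funM => //; exact: measurable_FS_density. Qed.

Lemma twopiV_gt0 : 0 < (2 * pi)^-1 :> R.
Proof. by rewrite invr_gt0 mulr_gt0// pi_gt0. Qed.

Lemma FSw_ge0 (z : plane) : 0 <= (2 * pi)^-1 * FS_density z :> R.
Proof. by rewrite ltW// mulr_gt0 ?twopiV_gt0 ?FS_density_gt0. Qed.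

(** The probability measure mu of the sphere, transported to the plane by the
    chart [1, w]. *)
Definition FSP : {measure set plane -> \bar R} := density (lebesgue2 R) FSw_measurable FSw_ge0.

Lemma FSP_setT : FSP setT = 1%E.
Proof.
rewrite /FSP/= /density; under eq_integral do rewrite EFinM.
rewrite ge0_integralZl//=.
- by rewrite integral_FS_density -EFinM mulVf// -invr_eq0 gt_eqF// twopiV_gt0.
- by apply/measurable_EFinP; exact: measurable_FS_density.
- by move=> z _; rewrite lee_fin ltW// FS_density_gt0.
- by rewrite lee_fin ltW// twopiV_gt0.
Qed.

Lemma FSP_prob (f : CP1 R -> R) (A : set R) :
  measurable ((f \o @chart0 R \o @xy R) @^-1` A : set plane) ->
  FS_prob (f @^-1` A) = FSP ((f \o @chart0 R \o @xy R) @^-1` A).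
Proof.
move=> mA; rewrite /FS_prob /FS_measure /FSP/= /density.
under [RHS]eq_integral do rewrite EFinM.
rewrite ge0_integralZl//=.
- by apply/measurable_EFinP; apply: measurable_funTS; exact: measurable_FS_density.
- by move=> z _; rewrite lee_fin ltW// FS_density_gt0.
- by rewrite lee_fin ltW// twopiV_gt0.
Qed.

Lemma FS_density_integrable (C : R) : (lebesgue2 R).-integrable setT
  (fun z : plane => (C * FS_density z)%:E).
Proof.
under eq_fun do rewrite EFinM.
apply: integrableZl => //; apply/integrableP; split.
  by apply/measurable_EFinP; exact: measurable_FS_density.
under eq_integral do rewrite /= ger0_norm ?(ltW (FS_density_gt0 _))//.
by rewrite integral_FS_density ltry.
Qed.

Lemma FS_dom_integrable (g : plane -> R) (C : R) : measurable_fun setT g ->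
  (forall z, `|g z| <= C * FS_density z) -> (lebesgue2 R).-integrable setT (EFin \o g).
Proof.
move=> mg gC; apply: le_integrable (FS_density_integrable C) => //.
  exact/measurable_EFinP.
by move=> z _ /=; rewrite lee_fin (le_trans (gC z))// ler_norm.
Qed.

Lemma Ex_FSP (g : plane -> R) : bdm g ->
  Ex FSP g = (2 * pi)^-1 * \int[lebesgue2 R]_z (g z * FS_density z).
Proof.
move=> bg; rewrite /FSP Ex_density//; last exact: FSP_setT.
rewrite -RintegralZl//.
  by apply: eq_Rintegral => z _; rewrite mulrCA.
have [M [M0 gM]] := bdm_bound bg.
apply: (@FS_dom_integrable _ M).
  by apply: measurable_funM; [exact: bdm_meas|exact: measurable_FS_density].
by move=> z; rewrite normrM (gtr0_norm (FS_density_gt0 z)) ler_wpM2r ?gM// ltW// FS_density_gt0.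
Qed.

(** A derivative has integral 0 when its primitive vanishes at both ends of the
    line. *)
Lemma line_integral_eq0 (g g' : R -> R) (K c : R) : 1 <= c ->
  (forall x : R, is_derive x 1 g (g' x)) -> continuous g' ->
  (forall x, `|g' x| <= K * (2 / (c + x ^+ 2) ^+ 2)) ->
  (forall x, `|g x| <= K / (c + x ^+ 2)) ->
  (\int[@lebesgue_measure R]_x (g' x)%:E = 0)%E.
Proof.
move=> c1 dg cg bg' bg.
have c0 : 0 < c by rewrite (lt_le_trans ltr01).
have D0 (x : R) : 0 < c + x ^+ 2 by rewrite ltr_pwDl ?sqr_ge0.
have K0 : 0 <= K.
  have := le_trans (normr_ge0 _) (bg 0); rewrite pmulr_lge0// invr_gt0; exact: D0.
apply: (@integral_derivative_line _ g g' (2 * K)) => //.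
- move=> x; rewrite (le_trans (bg' _))// mulrA [K * 2]mulrC ler_wpM2l ?mulr_ge0//.
  rewrite lef_pV2 ?posrE ?exprn_gt0 ?ltr_pwDl ?sqr_ge0//.
  by have := sqr_ge0 x; set X := x ^+ 2; nra.
have cB (s : R) : `|s| = 1 -> (fun n : nat => g (s * n%:R)) @ \oo --> 0.
  move=> s1; apply/norm_cvg0P.
  apply: (@squeeze_cvgr _ _ _ _ (fun=> 0) (fun n : nat => 2 * K * harmonic n)); last 2 first.
  - exact: cvg_cst.
  - by rewrite -[X in _ --> X](mulr0 (2 * K)); apply: cvgM; [exact: cvg_cst|exact: cvg_harmonic].
  apply: nearW => n; rewrite normr_ge0/= (le_trans (bg _))//=.
  rewrite mulrAC mulrC ler_wpM2r// /harmonic ler_pdivlMr// mulrC ler_pdivrMr//.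
  rewrite exprMn -(real_normK (num_real s)) s1 expr1n mul1r -natr1.
  have n0 : 0 <= n%:R :> R by [].
  by set N := n%:R in n0 *; nra.
rewrite -[X in _ --> X](subr0 0); apply: cvgB.
  by have := cB 1 (normr1 _); under eq_fun do rewrite mul1r.
by have := cB (-1) (normrN1 _); under eq_fun do rewrite mulN1r.
Qed.

(** Stokes' formula without boundary term, in the x direction: by Fubini the
    inner integral vanishes on each horizontal line. *)
Lemma integral_dx (G G' : plane -> R) (C : R) : measurable_fun setT G' ->
  (forall z, `|G' z| <= C * FS_density z) ->
  (forall x y : R, is_derive x 1 (fun x => G (x, y)) (G' (x, y))) ->
  (forall y, continuous (fun x : R => G' (x, y))) ->
  (forall z, `|G z| <= C / (1 + z.1 ^+ 2 + z.2 ^+ 2)) ->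
  \int[lebesgue2 R]_z G' z = 0.
Proof.
move=> mG GC dG cG G0; rewrite /Rintegral.
have := @integral21_prod_meas1 _ _ _ _ R (@lebesgue_measure R) (@lebesgue_measure R) (EFin \o G') (FS_dom_integrable mG GC).
rewrite /lebesgue2 => <-.
rewrite integral0_eq// => y _.
apply: (@line_integral_eq0 (fun x => G (x, y)) (fun x => G' (x, y)) C (1 + y ^+ 2)) => //.
- by rewrite lerDl sqr_ge0.
- by move=> x; rewrite addrAC; exact: GC.
- by move=> x; rewrite addrAC; exact: G0.
Qed.

Lemma integral_dy (G G' : plane -> R) (C : R) : measurable_fun setT G' ->
  (forall z, `|G' z| <= C * FS_density z) ->
  (forall x y : R, is_derive y 1 (fun y => G (x, y)) (G' (x, y))) ->
  (forall x, continuous (fun y => G' (x, y))) ->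
  (forall z, `|G z| <= C / (1 + z.1 ^+ 2 + z.2 ^+ 2)) ->
  \int[lebesgue2 R]_z G' z = 0.
Proof.
move=> mG GC dG cG G0; rewrite /Rintegral.
have := @integral12_prod_meas1 _ _ _ _ R (@lebesgue_measure R) (@lebesgue_measure R) (EFin \o G') (FS_dom_integrable mG GC).
rewrite /lebesgue2 => <-.
rewrite integral0_eq// => x _.
apply: (@line_integral_eq0 (fun y => G (x, y)) (fun y => G' (x, y)) C (1 + x ^+ 2)) => //.
by rewrite lerDl sqr_ge0.
Qed.
End FS_probability.

(** * Integrals of monomials *)

Section monomials.
Variable R : realType.
Notation plane := (plane R).
Local Notation "z ^~" := (z^*) (at level 2, only parsing).

Definition cmeasurable d (T : measurableType d) (h : T -> R[i]) :=
  measurable_fun setT (fun x => complex.Re (h x)) /\ measurable_fun setT (fun x => complex.Im (h x)).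

Lemma cmeasurable_cst d (T : measurableType d) c : cmeasurable (fun _ : T => c).
Proof. by split; exact: measurable_cst. Qed.

Lemma cmeasurableM d (T : measurableType d) (h1 h2 : T -> R[i]) : cmeasurable h1 -> cmeasurable h2 -> cmeasurable (fun x => h1 x * h2 x).
Proof.
move=> [r1 i1] [r2 i2]; split.
  have := measurable_funB (measurable_funM r1 r2) (measurable_funM i1 i2).
  by congr measurable_fun; apply/funext => x /=; case: (h1 x) => ? ?; case: (h2 x) => ? ?.
have := measurable_funD (measurable_funM r1 i2) (measurable_funM i1 r2).
by congr measurable_fun; apply/funext => x /=; case: (h1 x) => ? ?; case: (h2 x) => ? ?.
Qed.

Lemma cmeasurableX d (T : measurableType d) (h : T -> R[i]) n : cmeasurable h -> cmeasurable (fun x => h x ^+ n).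
Proof.
move=> mh; elim: n => [|n IH]; first exact: (cmeasurable_cst _ 1).
by under eq_fun do rewrite exprS; exact: cmeasurableM.
Qed.

Lemma norm_ge_Im (c : R[i]) : `|complex.Im c|%:C%C <= `|c|.
Proof.
case: c => a b; rewrite normc_def/= lecR -sqrtr_sqr ler_wsqrtr//.
by rewrite lerDr sqr_ge0.
Qed.

Lemma cmeasurable_cbdm d (T : measurableType d) (h : T -> R[i]) (K : R) : cmeasurable h ->
  (forall x, `|h x| <= K%:C%C) -> cbdm h.
Proof.
move=> [mr mi] hK; split; split => //; exists K => x.
  by rewrite -lecR (le_trans _ (hK x))// normc_ge_Re.
by rewrite -lecR (le_trans _ (hK x))// norm_ge_Im.
Qed.

Definition rho (z : plane) : R := 1 + z.1 ^+ 2 + z.2 ^+ 2.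

Lemma rho_ge1 z : 1 <= rho z. Proof. exact: r2_ge1. Qed.
Lemma rho_gt0 z : 0 < rho z. Proof. exact: lt_le_trans (rho_ge1 z). Qed.
Lemma rhoV_ge0 z : 0 <= (rho z)^-1. Proof. by rewrite invr_ge0 ltW// rho_gt0. Qed.
Lemma rhoV_le1 z : (rho z)^-1 <= 1. Proof. by rewrite invf_le1 ?rho_ge1 ?rho_gt0. Qed.
Lemma norm_xy (z : plane) : `|xy z| = (Num.sqrt (z.1 ^+ 2 + z.2 ^+ 2))%:C%C.
Proof. by rewrite /xy normc_def. Qed.

Lemma pow_le1 (s r : R) p q : 0 <= s -> 0 <= r -> r <= 1 -> s ^+ 2 * r <= 1 ->
  (p <= 2 * q)%N -> s ^+ p * r ^+ q <= 1.
Proof.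
move=> s0 r0 r1 sr pq.
rewrite -(@ler_pXn2r _ 2)// ?nnegrE ?mulr_ge0 ?exprn_ge0// expr1n exprMn -!exprM.
rewrite mulnC exprM [(q * 2)%N]mulnC -(subnK pq) exprD mulrCA -exprMn.
by rewrite mulr_ile1 ?exprn_ge0 ?mulr_ge0 ?exprn_ge0 ?exprn_ile1 ?mulr_ge0 ?exprn_ge0.
Qed.

Lemma rhoE (z : plane) : (rho z)%:C%C = 1 + `|xy z| ^+ 2.
Proof.
rewrite norm_xy -rmorphXn/= sqr_sqrtr ?addr_ge0 ?sqr_ge0//.
by rewrite /rho -addrA rmorphD.
Qed.
Lemma rhoE2 (z : plane) : (rho z)%:C%C = 1 + xy z * (xy z)^*.
Proof. by rewrite rhoE normCK. Qed.

(** Pairings of polynomial sections are combinations of these functions: a power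
    of w, a power of its conjugate, and a power of the metric. *)
Definition mono i j q (z : plane) : R[i] :=
  xy z ^+ i * (xy z)^* ^+ j * ((rho z)^-1 ^+ q)%:C%C.

Lemma mono_cmeasurable i j q : cmeasurable (mono i j q).
Proof.
apply: cmeasurableM; first apply: cmeasurableM.
- by apply: cmeasurableX; split; [exact: measurable_fst|exact: measurable_snd].
- apply: cmeasurableX; split; first exact: measurable_fst.
  apply: (measurableT_comp (f := fun x : R => - x)); last exact: measurable_snd.
  exact: measurable_funN.
- split => //=.
  apply: measurable_funX; apply: inv_ge1_measurable; last exact: rho_ge1.
  exact: measurable_r2.
Qed.

(** |w|^(i + j) <= (1 + |w|^2)^q as soon as i + j <= 2 q. *)
Lemma mono_le1 i j q z : (i + j <= 2 * q)%N -> `|mono i j q z| <= 1.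
Proof.
move=> ijq; rewrite /mono !normrM !normrX norm_conjC -exprD norm_xy.
rewrite (ger0_norm (x := (_%:C)%C)) ?lecR ?exprn_ge0 ?rhoV_ge0//.
rewrite -rmorphXn -rmorphM -[1]/(1%:C%C) lecR.
apply: pow_le1 => //; rewrite ?sqrtr_ge0 ?rhoV_ge0 ?rhoV_le1//.
rewrite sqr_sqrtr ?addr_ge0 ?sqr_ge0// ler_pdivrMr ?rho_gt0// mul1r /rho.
by rewrite -addrA lerDr.
Qed.

Lemma mono_cbdm i j q : (i + j <= 2 * q)%N -> cbdm (mono i j q).
Proof.
move=> ijq; apply: (cmeasurable_cbdm (K := 1)); first exact: mono_cmeasurable.
by move=> z; exact: mono_le1.
Qed.

Lemma monoS i j q z : mono i j q z * ((rho z)^-1)%:C%C = mono i j q.+1 z.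
Proof. by rewrite /mono exprSr rmorphM/= mulrA. Qed.

Definition is_cderive (F : R -> R[i]) (x : R) (dF : R[i]) :=
  is_derive x 1 (fun t => complex.Re (F t)) (complex.Re dF) /\
  is_derive x 1 (fun t => complex.Im (F t)) (complex.Im dF).

Lemma is_cderive_eq F x a b : is_cderive F x a -> a = b -> is_cderive F x b.
Proof. by move=> h <-. Qed.

Lemma is_cderive_ext F G x a : (forall t, F t = G t) -> is_cderive F x a -> is_cderive G x a.
Proof. by move=> e; rewrite (_ : F = G)//; exact/funext. Qed.

Lemma is_derive_ext (f g : R -> R) (x a b : R) : is_derive x 1 f a -> (forall t, f t = g t) -> a = b ->
  is_derive x 1 g b.
Proof. by move=> d e <-; rewrite (_ : g = f)//; apply/funext => t; rewrite e. Qed.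

Lemma is_cderiveM F G x dF dG : is_cderive F x dF -> is_cderive G x dG ->
  is_cderive (fun t => F t * G t) x (dF * G x + F x * dG).
Proof.
move=> [r1 i1] [r2 i2]; split.
  apply: (is_derive_ext (is_derive_funD (is_derive_funM r1 r2) (is_derive_funN (is_derive_funM i1 i2)))).
    by move=> t; case: (F t) => ? ?; case: (G t).
  by case: (F x) dF dG (G x) {r1 i1 r2 i2} => a b [c d] [e f] [g h] /=; ring.
apply: (is_derive_ext (is_derive_funD (is_derive_funM r1 i2) (is_derive_funM i1 r2))).
  by move=> t; case: (F t) => ? ?; case: (G t).
by case: (F x) dF dG (G x) {r1 i1 r2 i2} => a b [c d] [e f] [g h] /=; ring.
Qed.

Lemma is_cderive_cst (c : R[i]) x : is_cderive (fun=> c) x 0.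
Proof. by split => /=; exact: is_derive_fun_cst. Qed.

Lemma is_cderiveD F G x dF dG : is_cderive F x dF -> is_cderive G x dG ->
  is_cderive (fun t => F t + G t) x (dF + dG).
Proof.
move=> [r1 i1] [r2 i2]; split.
  apply: (is_derive_ext (is_derive_funD r1 r2)) => [t|]; first by case: (F t) => ? ?; case: (G t).
  by case: (dF) (dG) => ? ? [].
apply: (is_derive_ext (is_derive_funD i1 i2)) => [t|]; first by case: (F t) => ? ?; case: (G t).
by case: (dF) (dG) => ? ? [].
Qed.

Lemma is_derive_continuous_at (f : R -> R) (x a : R) : is_derive x 1 f a ->
  {for x, continuous f}.
Proof.
move=> d; apply: differentiable_continuous; apply/derivable1_diffP.
by apply: ex_derive.
Qed.

Lemma is_cderiveX F x dF n : is_cderive F x dF ->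
  is_cderive (fun t => F t ^+ n) x (n%:R * F x ^+ n.-1 * dF).
Proof.
move=> h; elim: n => [|n IH].
  by rewrite !mul0r; split => //=; exact: is_derive_fun_cst.
apply: (is_cderive_ext (F := fun t => F t * F t ^+ n)) => [t|]; first by rewrite exprS.
apply: is_cderive_eq (is_cderiveM h IH) _.
case: n {IH} => [|n]; first by rewrite /= expr0; ring.
by rewrite /= [in RHS]mulrS !exprS; ring.
Qed.

(** Derivative along a line on which the coordinate w moves with complex
    velocity c; the two cases of interest are c = 1 (the x direction) and c = 'i
    (the y direction). *)
Lemma mono_cderive (p : R -> plane) (c : R[i]) i j q t :
  (forall t, is_cderive (fun t => xy (p t)) t c) ->
  is_cderive (fun t => mono i j q (p t)) t
   (i%:R * c * mono i.-1 j q (p t) + j%:R * c^* * mono i j.-1 q (p t)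
    - q%:R * (c^* * mono i.+1 j q.+1 (p t) + c * mono i j.+1 q.+1 (p t))).
Proof.
move=> dw; have dw' s : is_cderive (fun t => (xy (p t))^*) s c^*.
  have [r m] := dw s; split.
    by apply: (is_derive_ext r) => [u|]; [case: (xy _)|case: c {dw r m}].
  by apply: (is_derive_ext (is_derive_funN m)) => [u|]; [case: (xy _)|case: c {dw r m}].
pose e s := complex.Re (c * (xy (p s))^* + xy (p s) * c^*).
have eE s : (e s)%:C%C = c * (xy (p s))^* + xy (p s) * c^*.
  by rewrite /e; case: c {dw dw' e} => a b; case: (xy (p s)) => u v /=; simpc; congr Complex; ring.
have dr (s : R) : is_derive s 1 (fun t => rho (p t)) (e s).
  have [r _] := is_cderiveM (dw s) (dw' s).
  by apply: (is_derive_ext (is_derive_funD (is_derive_fun_cst 1 s) r)) => [u|]; rewrite ?add0r// /rho /=; ring.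
have dri s : is_cderive (fun t => ((rho (p t))^-1)%:C%C) s
   (- (rho (p s) ^- 2)%:C%C * (c * (xy (p s))^* + xy (p s) * c^*)).
  rewrite -eE; split => /=.
    have rn : rho (p s) != 0 by rewrite gt_eqF// rho_gt0.
    by apply: (is_derive_ext (@is_derive_funV _ (fun t => rho (p t)) s _ rn (dr s))) => //; ring.
  by apply: (is_derive_ext (is_derive_fun_cst 0 s)) => //; ring.
have := is_cderiveM (is_cderiveM (is_cderiveX i (dw t)) (is_cderiveX j (dw' t))) (is_cderiveX q (dri t)).
move=> h; apply: (is_cderive_eq (is_cderive_ext _ h)).
  by move=> u; rewrite /mono rmorphXn.
set W := xy (p t); rewrite /mono -/W.
set Wb := W^*; set r := (rho (p t))^-1.
rewrite !rmorphXn/= -/r.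
have -> : (rho (p t) ^- 2)%:C%C = r%:C%C ^+ 2 by rewrite -rmorphXn /= /r exprVn.
set rC := r%:C%C.
case: q {h} => [|q]; rewrite ?exprS ?mul0r ?mulr0/=; ring.
Qed.

Definition mono_int i j q : R[i] := cEx (FSP R) (mono i j q).

(** The derivative of mono i j k.+2 at velocity c, divided by rho^-2. Since
    rho^-2 is the Fubini-Study density up to a constant, the integral of that
    derivative for the area is an expectation of dmono, which is bounded. *)
Definition dmono (c : R[i]) i j k (z : plane) : R[i] :=
  i%:R * c * mono i.-1 j k z + j%:R * c^* * mono i j.-1 k z
    - (k.+2)%:R * (c^* * mono i.+1 j k.+1 z + c * mono i j.+1 k.+1 z).

Lemma dmonoE c i j k z : dmono c i j k z * ((rho z)^-1 ^+ 2)%:C%C =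
  i%:R * c * mono i.-1 j k.+2 z + j%:R * c^* * mono i j.-1 k.+2 z
    - (k.+2)%:R * (c^* * mono i.+1 j k.+3 z + c * mono i j.+1 k.+3 z).
Proof. by rewrite /dmono -!monoS expr2 rmorphM /=; ring. Qed.

Lemma dmono_cbdm c i j k : (i <= k)%N -> (j <= k.+1)%N -> cbdm (dmono c i j k).
Proof.
move=> ik jk; have M a b q : (a + b <= 2 * q)%N -> cbdm (mono a b q) by exact: mono_cbdm.
have Z a b q (u : R[i]) : (a + b <= 2 * q)%N -> cbdm (fun z => u * mono a b q z).
  by move=> h; apply: cbdmM; [exact: cbdm_cst|exact: M].
apply: (cbdm_ext (h1 := fun z => (i%:R * c * mono i.-1 j k z + j%:R * c^* * mono i j.-1 k z) +
   (- (k.+2)%:R * c^* * mono i.+1 j k.+1 z + - (k.+2)%:R * c * mono i j.+1 k.+1 z))).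
  by move=> z; rewrite /dmono; ring.
apply: cbdmD; apply: cbdmD.
- case: i ik => [|i] ik; last by apply: Z; lia.
  by apply: (cbdm_ext (h1 := fun=> 0)) => [z|]; [rewrite !mul0r|exact: cbdm_cst].
- case: j jk => [|j] jk; last by apply: Z; lia.
  by apply: (cbdm_ext (h1 := fun=> 0)) => [z|]; [rewrite !mul0r|exact: cbdm_cst].
- by apply: Z; lia.
- by apply: Z; lia.
Qed.

Lemma FS_density_rho z : FS_density z = 2 * (rho z)^-1 ^+ 2.
Proof. by rewrite FS_densityE. Qed.

(** proj stands for the real or the imaginary part. The integrand is a partial
    derivative, so its integral vanishes. *)
Lemma Ex_dmono (proj : R[i] -> R) (cproj : forall (a : R[i]) (r : R), proj (a * r%:C%C) = proj a * r)
   (i j k : nat) (p : bool) (c : R[i] := if p then 1 else 'i%C) :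
  (forall h : plane -> R[i], cbdm h -> bdm (proj \o h)) ->
  (forall (F : R -> R[i]) x dF, is_cderive F x dF -> is_derive x 1 (proj \o F) (proj dF)) ->
  (i <= k)%N -> (j <= k.+1)%N -> Ex (FSP R) (proj \o dmono c i j k) = 0.
Proof.
move=> bproj dproj ik jk.
rewrite Ex_FSP; last by apply: bproj; exact: dmono_cbdm.
pose G (z : plane) := 2 * proj (mono i j k.+2 z).
pose G' (z : plane) := (proj \o dmono c i j k) z * FS_density z.
have bd := bproj _ (dmono_cbdm c ik jk).
have bm : bdm (proj \o mono i j k.+1) by apply: bproj; apply: mono_cbdm; lia.
have [M1 [M10 hM1]] := bdm_bound bd; have [M2 [M20 hM2]] := bdm_bound bm.
have mG' : measurable_fun setT G'.
  by apply: measurable_funM; [exact: bdm_meas|exact: measurable_FS_density].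
have bG' z : `|G' z| <= (M1 + 2 * M2) * FS_density z.
  rewrite /G' normrM (gtr0_norm (FS_density_gt0 z)) ler_wpM2r ?(ltW (FS_density_gt0 z))//.
  by rewrite (le_trans (hM1 z))// lerDl mulr_ge0.
have bG z : `|G z| <= (M1 + 2 * M2) / (1 + z.1 ^+ 2 + z.2 ^+ 2).
  rewrite /G -monoS cproj mulrA normrM -/(rho z) (ger0_norm (rhoV_ge0 z)) ler_wpM2r ?rhoV_ge0//.
  rewrite normrM ger0_norm// (le_trans (y := 2 * M2)) ?lerDr//.
  by rewrite ler_wpM2l// hM2.
have dG (q : R -> plane) (t : R) : (forall s : R, is_cderive (fun t => xy (q t)) s c) ->
   is_derive t 1 (fun t => G (q t)) (G' (q t)).
  move=> dq; have := dproj _ _ _ (mono_cderive i j k.+2 t dq).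
  rewrite -dmonoE cproj => h.
  apply: (is_derive_ext (is_derive_funM (is_derive_fun_cst 2 t) h)) => //.
  by rewrite /G' FS_density_rho/=; ring.
have d2G (q : R -> plane) : (forall s : R, is_cderive (fun t => xy (q t)) s c) ->
   continuous (fun t => G' (q t)).
  move=> dq t; pose u1 := i%:R * c; pose u2 := j%:R * c^*.
  pose u3 := - (k.+2)%:R * c^*; pose u4 := - (k.+2)%:R * c.
  have Z (v : R[i]) a b e := is_cderiveM (is_cderive_cst v t) (mono_cderive a b e t dq).
  have := is_cderiveD (is_cderiveD (Z u1 i.-1 j k.+2) (Z u2 i j.-1 k.+2))
     (is_cderiveD (Z u3 i.+1 j k.+3) (Z u4 i j.+1 k.+3)).
  move=> /dproj h; apply: is_derive_continuous_at (is_derive_ext (is_derive_funM (is_derive_fun_cst 2 t) h) _ erefl) => s.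
  rewrite /G' FS_density_rho mulrCA -cproj dmonoE /=; congr (2 * proj _).
  by rewrite /u1 /u2 /u3 /u4; ring.
suff -> : \int[lebesgue2 R]_z G' z = 0 by rewrite mulr0.
have dx y (s : R) : is_cderive (fun t => xy (t, y)) s 1.
  by split => /=; [exact: is_derive_fun_id|exact: is_derive_fun_cst].
have dy x (s : R) : is_cderive (fun t => xy (x, t)) s 'i%C.
  by split => /=; [exact: is_derive_fun_cst|exact: is_derive_fun_id].
have [E|E] : c = 1 \/ c = 'i%C by rewrite /c; case: p {c bd hM1 mG' bG' dG d2G G'}; [left|right].
  apply: (integral_dx mG' bG' _ _ bG) => [x y|y].
    by apply: dG => s; rewrite E; exact: dx.
  by apply: d2G => s; rewrite E; exact: dx.
apply: (integral_dy mG' bG' _ _ bG) => [x y|x].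
  by apply: dG => s; rewrite E; exact: dy.
by apply: d2G => s; rewrite E; exact: dy.
Qed.

Lemma cEx_dmono (i j k : nat) (p : bool) (c : R[i] := if p then 1 else 'i%C) :
  (i <= k)%N -> (j <= k.+1)%N -> cEx (FSP R) (dmono c i j k) = 0.
Proof.
move=> ik jk; rewrite /cEx.
have -> : Ex (FSP R) (fun x => complex.Re (dmono c i j k x)) = 0.
  apply: (@Ex_dmono (@complex.Re R)) => //.
  - by case=> a b r /=; rewrite mulr0 subr0.
  - by move=> h [].
  - by move=> F x dF [].
have -> : Ex (FSP R) (fun x => complex.Im (dmono c i j k x)) = 0.
  apply: (@Ex_dmono (@complex.Im R)) => //.
  - by case=> a b r /=; rewrite mulr0 add0r.
  - by move=> h [].
  - by move=> F x dF [].
by [].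
Qed.

(** The combination d/dx + 'i d/dy is twice the derivative with respect to the
    conjugate variable, and that derivative ignores the factor w^i. Its integral
    vanishes, which relates the integral of w^(i+1) conj(w)^j / rho^(k+1) to
    that of w^i conj(w)^(j-1) / rho^k. *)
Lemma mono_int_rec i j k : (i <= k)%N -> (j <= k.+1)%N ->
  (k.+2)%:R * mono_int i.+1 j k.+1 = j%:R * mono_int i j.-1 k.
Proof.
move=> ik jk.
have b1 := dmono_cbdm 1 ik jk; have bi := dmono_cbdm 'i%C ik jk.
have : cEx (FSP R) (fun z => dmono 1 i j k z + 'i%C * dmono 'i%C i j k z) = 0.
  rewrite cExD ?cExZ//; first last.
  - by apply: cbdmM => //; exact: cbdm_cst.
  - exact: FSP_setT.
  - exact: FSP_setT.
  by rewrite (cEx_dmono true ik jk) (cEx_dmono false ik jk) mulr0 addr0.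
have i2 : 'i%C * 'i%C = -1 :> R[i] by rewrite -expr2 sqr_i.
have ii : ('i%C)^* = - 'i%C :> R[i] by apply/eqP; rewrite eq_complex /= oppr0 !eqxx.
(* 1 + 'i ^ 2 = 0 removes the derivatives of the powers of w. *)
have E z : dmono 1 i j k z + 'i%C * dmono 'i%C i j k z =
   2 * (j%:R * mono i j.-1 k z - (k.+2)%:R * mono i.+1 j k.+1 z).
  rewrite /dmono rmorph1 ii; move: i2; set I := 'i%C => i2.
  transitivity ((1 + I * I) * (i%:R * mono i.-1 j k z - (k.+2)%:R * mono i j.+1 k.+1 z)
    + (1 - I * I) * (j%:R * mono i j.-1 k z - (k.+2)%:R * mono i.+1 j k.+1 z)); first by ring.
  by rewrite i2; ring.
have m1 : cbdm (fun z => j%:R * mono i j.-1 k z).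
  case: j jk {b1 bi E} => [|j] jk.
    by apply: (cbdm_ext (h1 := fun=> 0)) => [z|]; [rewrite !mul0r|exact: cbdm_cst].
  by apply: cbdmM; [exact: cbdm_cst|apply: mono_cbdm; lia].
have m2 : cbdm (mono i.+1 j k.+1) by apply: mono_cbdm; lia.
have m3 : cbdm (fun z => (k.+2)%:R * mono i.+1 j k.+1 z) by apply: cbdmM => //; exact: cbdm_cst.
have EE z : 2 * (j%:R * mono i j.-1 k z - (k.+2)%:R * mono i.+1 j k.+1 z) =
   2 * (j%:R * mono i j.-1 k z + - 1 * ((k.+2)%:R * mono i.+1 j k.+1 z)) by ring.
rewrite (cEx_ext _ (fun z => etrans (E z) (EE z))) cExZ ?cExD ?cExZ//; try exact: FSP_setT.
- by move/eqP; rewrite mulf_eq0 pnatr_eq0/= mulN1r subr_eq0 => /eqP <-.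
- by apply: mono_cbdm; lia.
- by apply: cbdmM => //; exact: cbdm_cst.
- by apply: cbdmD => //; apply: cbdmM => //; exact: cbdm_cst.
Qed.

Lemma mono_int_conj i j q : (i + j <= 2 * q)%N -> mono_int j i q = (mono_int i j q)^*.
Proof.
move=> h; rewrite /mono_int -cEx_conj; [|exact: FSP_setT|exact: mono_cbdm].
apply: cEx_ext => z; rewrite /mono !rmorphM !rmorphXn /= conjCK [(xy z)^* ^+ i * _]mulrC; congr (_ * _ ^+ _).
by apply/eqP; rewrite eq_complex /= oppr0 !eqxx.
Qed.

(** Writing 1 = (1 + |w|^2) / rho splits the integral for k into those of mono 0
    0 k.+1 and mono 1 1 k.+1, and the recursion expresses the latter by the
    integral for k. *)
Lemma mono_int00 k : mono_int 0 0 k = (k.+1)%:R^-1.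
Proof.
elim: k => [|k IH].
  rewrite invr1 -[RHS](@cEx_cst _ _ _ (FSP R) (FSP_setT R) 1); apply: cEx_ext => z.
  by rewrite /mono !expr0 !mul1r.
have h : (k.+2)%:R * mono_int 1 1 k.+1 = mono_int 0 0 k by rewrite (@mono_int_rec 0%N 1%N k)// mul1r.
have : mono_int 0 0 k = mono_int 0 0 k.+1 + mono_int 1 1 k.+1.
  rewrite /mono_int -cExD; [|exact: FSP_setT|by apply: mono_cbdm; lia..].
  apply: cEx_ext => z; rewrite -(monoS 0 0 k).
  have -> : mono 1 1 k.+1 z = xy z * (xy z)^* * (mono 0 0 k z * ((rho z)^-1)%:C%C).
    by rewrite monoS /mono !expr0 !expr1 !mul1r.
  rewrite -[X in X + _]mul1r -mulrDl -rhoE2 mulrCA -rmorphM/= mulfV ?mulr1//.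
  by rewrite gt_eqF// rho_gt0.
move=> e; have k2 : (k.+2)%:R != 0 :> R[i] by rewrite pnatr_eq0.
have k1 : (k.+1)%:R != 0 :> R[i] by rewrite pnatr_eq0.
have -> : mono_int 0 0 k.+1 = mono_int 0 0 k - mono_int 1 1 k.+1 by rewrite e addrK.
have -> : mono_int 1 1 k.+1 = (k.+2)%:R^-1 * mono_int 0 0 k by rewrite -h mulKf.
rewrite IH; move: k1 k2; rewrite -!natr1 => k1 k2; field.
by rewrite k1 k2.
Qed.

(** The recursion lowers both exponents together, until the smaller one is 0 and
    the integral vanishes. *)
Lemma mono_int_neq i j k : (i <= k)%N -> (j <= k)%N -> i != j -> mono_int i j k = 0.
Proof.
wlog ij : i j / (j < i)%N.
  move=> H ik jk ij; have [ji|ji] := ltnP j i; first exact: H.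
  rewrite mono_int_conj; last by lia.
  by rewrite H ?conjC0// ?[j == i]eq_sym// ltn_neqAle ij.
elim: k i j ij => [|k IH] i j ij ik jk nij; first by lia.
case: i ij ik nij => // i ij ik nij.
have kn : (k.+2)%:R != 0 :> R[i] by rewrite pnatr_eq0.
apply: (mulfI kn); rewrite mulr0 mono_int_rec//.
case: j ij jk nij => [|j] ij jk nij; first by rewrite mul0r.
by rewrite /= IH ?mulr0//; lia.
Qed.

Lemma mono_int_eq i k : (i <= k)%N -> mono_int i i k = ((k.+1)%:R * ('C(k, i))%:R)^-1.
Proof.
elim: k i => [|k IH] [|i] ik //.
- by rewrite mono_int00 bin0 mulr1.
- by rewrite mono_int00 bin0 mulr1.
have kn : (k.+2)%:R != 0 :> R[i] by rewrite pnatr_eq0.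
have c0 : ('C(k.+1, i.+1))%:R != 0 :> R[i] by rewrite pnatr_eq0 -lt0n bin_gt0.
have k1 : (k.+1)%:R != 0 :> R[i] by rewrite pnatr_eq0.
have i1 : (i.+1)%:R != 0 :> R[i] by rewrite pnatr_eq0.
apply: (mulfI kn); rewrite mono_int_rec//= ?IH//.
rewrite -natrM (mul_bin_diag k.+1 i) natrM.
by rewrite !invfM mulVKf// mulVKf.
Qed.
End monomials.

(** * The Toeplitz matrix in the basis of monomials *)

Section toeplitz_matrix.
Variable R : realType.
Notation plane := (plane R).
Notation P := (FSP R).
Let P1 := FSP_setT R.
Local Notation mono_int := (mono_int R).
Variable m : nat.

(** The Toeplitz form of G on monomials, without the normalization of the basis.
    *)
Definition wmono_int (G : plane -> R) i k : R[i] := cEx P (fun z => (G z)%:C%C * mono i k m z).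

Lemma wmono_int_cbdm (G : plane -> R) i k : bdm G -> (i <= m)%N -> (k <= m)%N ->
  cbdm (fun z => (G z)%:C%C * mono i k m z).
Proof.
by move=> bG im km; apply: cbdmM; [exact: cbdm_real|apply: mono_cbdm; lia].
Qed.

Lemma FS_integralE (h : R[i] -> R[i]) : cbdm (fun z : plane => h (xy z)) ->
  FS_integral h = (2 * pi)%:C%C * cEx P (fun z => h (xy z)).
Proof.
move=> [br bi]; rewrite /FS_integral /cEx !Ex_FSP//.
have p0 : 2 * pi != 0 :> R by rewrite mulf_neq0// gt_eqF// pi_gt0.
by simpc; congr Complex; rewrite mulrA mulfV// mul1r.
Qed.

Lemma hol_secE (p : {poly_m.+1 R[i]}) w : hol_sec p w = \sum_(i < m.+1) p`_i * w ^+ i.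
Proof. by rewrite /hol_sec (@horner_coef_wide _ m.+1)// size_npoly. Qed.

(** Since distinct monomials are orthogonal, the second section contributes only
    its coefficient of the same degree. *)
Lemma sec_innerE (g : R[i] -> R) (p r q : {poly_m.+1 R[i]}) (G := fun z : plane => g (xy z)) :
  bdm G ->
  sec_inner m (fun w => (g w)%:C%C * hol_sec p w - hol_sec r w) (hol_sec q) =
  (2 * pi)%:C%C * \sum_(k < m.+1) (q`_k)^* * (\sum_(i < m.+1) p`_i * wmono_int G i k
      - r`_k * ((m.+1)%:R * ('C(m, k))%:R)^-1).
Proof.
move=> bG; rewrite /sec_inner.
pose h (z : plane) := \sum_(k < m.+1) (q`_k)^* * (\sum_(i < m.+1)
   (p`_i * ((G z)%:C%C * mono i k m z) + (- r`_i) * mono i k m z)).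
have hE (z : plane) : (1 + `|xy z| ^+ 2) ^- m * ((g (xy z))%:C%C * hol_sec p (xy z) - hol_sec r (xy z)) *
   (hol_sec q (xy z))^* = h z.
  rewrite !hol_secE rmorph_sum/= /h -rhoE mulr_sumr; apply: eq_bigr => k _.
  have -> : (q`_k * xy z ^+ k)^* = (q`_k)^* * (xy z)^* ^+ k by rewrite rmorphM rmorphXn.
  set A := (rho z)%:C%C ^- m; set B := (q`_k)^*; set D := (xy z)^* ^+ k.
  have AE : A = ((rho z)^-1 ^+ m)%:C%C by rewrite /A rmorphXn/= fmorphV exprVn.
  transitivity (B * (A * D * ((g (xy z))%:C%C * (\sum_(i < m.+1) p`_i * xy z ^+ i)
     - \sum_(i < m.+1) r`_i * xy z ^+ i))); first by ring.
  congr (_ * _); rewrite mulr_sumr -sumrB mulr_sumr; apply: eq_bigr => i _.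
  by rewrite /mono -AE -/D /G; ring.
have bm i k : (i < m.+1)%N -> (k < m.+1)%N -> cbdm (mono i k m : plane -> _).
  by move=> im km; apply: mono_cbdm; lia.
have b1 (i k : 'I_m.+1) : cbdm (fun z => p`_i * ((G z)%:C%C * mono i k m z)).
  by apply: cbdmM; [exact: cbdm_cst|apply: wmono_int_cbdm => //; rewrite -ltnS].
have b2 (i k : 'I_m.+1) : cbdm (fun z : plane => - r`_i * mono i k m z).
  by apply: cbdmM; [exact: cbdm_cst|exact: bm].
have b3 (i k : 'I_m.+1) := cbdmD (b1 i k) (b2 i k).
have b4 (k : 'I_m.+1) : cbdm (fun z : plane => \sum_(i < m.+1)
   (p`_i * ((G z)%:C%C * mono i k m z) + (- r`_i) * mono i k m z)).
  by apply: cbdm_sum => i _; exact: b3.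
have b5 (k : 'I_m.+1) := cbdmM (cbdm_cst plane (q`_k)^*) (b4 k).
rewrite FS_integralE; last by apply: (cbdm_ext (h1 := h)) => //; exact: cbdm_sum.
congr (_ * _); rewrite (cEx_ext _ hE) /h cEx_sum//; apply: eq_bigr => k _.
rewrite cExZ// cEx_sum//; congr (_ * _).
rewrite (eq_bigr (fun i : 'I_m.+1 => p`_i * wmono_int G i k - r`_i * mono_int i k m)).
  rewrite sumrB; congr (_ - _).
  rewrite (bigD1 k)//= mono_int_eq ?leq_ord// big1 ?addr0// => i ik.
  have nik : (i : nat) != k by apply: contra ik => /eqP e; apply/eqP/val_inj.
  by rewrite (@mono_int_neq R i k m (leq_ord i) (leq_ord k) nik) mulr0.
move=> i _; rewrite cExD// cExZ//; last by apply: wmono_int_cbdm => //; rewrite -ltnS.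
by rewrite cExZ ?mulNr//; exact: bm.
Qed.

(** Testing orthogonality against w^k gives the k-th coefficient, so the
    projection exists and is unique. *)
Lemma hol_projE (g : R[i] -> R) (p : {poly_m.+1 R[i]}) (G := fun z : plane => g (xy z)) :
  bdm G -> forall k : 'I_m.+1, (hol_proj m (fun w => (g w)%:C%C * hol_sec p w))`_k =
    (m.+1)%:R * ('C(m, k))%:R * \sum_(i < m.+1) p`_i * wmono_int G i k.
Proof.
move=> bG k.
pose r : {poly_m.+1 R[i]} := npolyp m.+1 (\poly_(k < m.+1) ((m.+1)%:R * ('C(m, k))%:R * \sum_(i < m.+1) p`_i * wmono_int G i k)).
have nz (j : 'I_m.+1) : (m.+1)%:R * ('C(m, j))%:R != 0 :> R[i].
  by rewrite mulf_neq0// pnatr_eq0// -lt0n bin_gt0 leq_ord.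
have rE (j : 'I_m.+1) : r`_j = (m.+1)%:R * ('C(m, j))%:R * \sum_(i < m.+1) p`_i * wmono_int G i j.
  by rewrite coef_npolyp ltn_ord coef_poly ltn_ord.
have p2 : (2 * pi)%:C%C != 0 :> R[i].
  by rewrite -[0]/(0%:C%C) (inj_eq (@complexI R)) mulf_neq0// gt_eqF// pi_gt0.
rewrite /hol_proj (xget_unique _ (x := r)); first exact: rE.
  move=> q; rewrite sec_innerE// big1 ?mulr0// => j _.
  by rewrite rE mulrAC mulfV// mul1r subrr mulr0.
move=> r' Hr'; apply/val_inj/polyP => j.
have [jm|jm] := ltnP j m.+1; last by rewrite !nth_default// (leq_trans (size_npoly _)).
have := Hr' (tnth (npolyX R[i] m.+1) (Ordinal jm)); rewrite sec_innerE// => /eqP.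
rewrite mulf_eq0 (negPf p2)/= [X in X == 0](bigD1 (Ordinal jm))//= [X in _ + X == 0]big1; last first.
  move=> i ij; rewrite npolyXE coefXn.
  have /negPf -> : (i : nat) != j by apply: contra ij => /eqP e; apply/eqP/val_inj.
  by rewrite conjC0 mul0r.
rewrite npolyXE coefXn eqxx conjC1 mul1r addr0 subr_eq0 => /eqP h.
have := rE (Ordinal jm); rewrite /= => ->.
by rewrite h mulrC divfK// (nz (Ordinal jm)).
Qed.

Lemma hol_proj_id (p : {poly_m.+1 R[i]}) : hol_proj m (hol_sec p) = p.
Proof.
have -> : hol_sec p = (fun w => (cst (1 : R) w)%:C%C * hol_sec p w).
  by apply/funext => w; rewrite /= mul1r.
apply/val_inj/polyP => j.
have [jm|jm] := ltnP j m.+1; last by rewrite !nth_default// (leq_trans (size_npoly _)).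
have b1 : bdm (fun z : plane => cst (1 : R) (xy z)) by exact: bdm_cst.
rewrite -[j]/(val (Ordinal jm)) (hol_projE p b1).
rewrite (eq_bigr (fun i : 'I_m.+1 => p`_i * mono_int i j m)); last first.
  by move=> i _; congr (_ * _); apply: cEx_ext => z /=; rewrite mul1r.
rewrite (bigD1 (Ordinal jm))//= big1 ?addr0 => [|i ij].
  rewrite /= mono_int_eq// mulrCA mulfV ?mulr1//.
  by rewrite mulf_neq0// pnatr_eq0// -lt0n bin_gt0 -ltnS.
have nij : (i : nat) != j by apply: contra ij => /eqP e; apply/eqP/val_inj.
have jm' : (j <= m)%N by rewrite -ltnS.
by rewrite (@mono_int_neq R i j m (leq_ord i) jm' nij) mulr0.
Qed.

Lemma toeplitz_mxE (f : CP1 R -> R) (F := f \o @chart0 R \o @xy R : plane -> R) : bdm F ->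
  forall i k, toeplitz_mx m f i k = (m.+1)%:R * ('C(m, k))%:R * wmono_int F i k.
Proof.
move=> bF i k; rewrite mxE /toeplitz hol_proj_id.
rewrite /mult_sec (@hol_projE (fun w => f (chart0 w)))//.
congr (_ * _); rewrite (bigD1 i)//= big1 ?addr0 => [|j ij]; rewrite npolyXE coefXn ?eqxx ?mul1r//.
have /negPf -> : (j : nat) != i by apply: contra ij => /eqP e; apply/eqP/val_inj.
by rewrite mul0r.
Qed.
End toeplitz_matrix.

(** * Reproducing kernel, Berezin transform and spectrum *)

Local Open Scope sesquilinear_scope.
Section spectral_sections.
Variable R : realType.
Notation plane := (plane R).
Notation P := (FSP R).
Let P1 := FSP_setT R.

(** The squared modulus of the inner product of unit vectors on the lines z and
    w, that is, the squared cosine of half their spherical distance. Its m-th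
    power is the squared modulus of the reproducing kernel of the holomorphic
    sections, in unit frames and up to a constant. *)
Definition overlap (z w : plane) : R :=
  ((1 + (z.1 * w.1 + z.2 * w.2)) ^+ 2 + (z.2 * w.1 - z.1 * w.2) ^+ 2) * ((rho z)^-1 * (rho w)^-1).

Lemma conjc_real (r : R) : (r%:C%C)^* = r%:C%C :> R[i].
Proof. by apply/eqP; rewrite eq_complex /= oppr0 !eqxx. Qed.

Lemma overlapE z w : (overlap z w)%:C%C =
  ((1 + xy z * (xy w)^*) * (1 + xy z * (xy w)^*)^*) * (((rho z)^-1)%:C%C * ((rho w)^-1)%:C%C).
Proof.
rewrite /overlap rmorphM/= rmorphM/=; congr (_ * _).
rewrite /xy; case: z => a b; case: w => c d /=.
by simpc; congr Complex; ring.
Qed.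

Lemma overlap_ge0 z w : 0 <= overlap z w.
Proof. by rewrite mulr_ge0 ?addr_ge0 ?sqr_ge0 ?mulr_ge0 ?rhoV_ge0. Qed.

(** Lagrange's identity |1 + z conj(w)|^2 + |z - w|^2 = (1 + |z|^2) (1 + |w|^2).
    *)
Lemma onem_overlapE z w : 1 - overlap z w = ((z.1 - w.1) ^+ 2 + (z.2 - w.2) ^+ 2) * ((rho z)^-1 * (rho w)^-1).
Proof.
have rz : rho z != 0 by rewrite gt_eqF// rho_gt0.
have rw : rho w != 0 by rewrite gt_eqF// rho_gt0.
rewrite /overlap -[X in X - _](mulfV (mulf_neq0 rz rw)) invfM -mulrBl; congr (_ * _).
by rewrite /rho; ring.
Qed.

Lemma overlap_le1 z w : overlap z w <= 1.
Proof. by rewrite -subr_ge0 onem_overlapE mulr_ge0 ?addr_ge0 ?sqr_ge0 ?mulr_ge0 ?rhoV_ge0. Qed.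

Lemma measurable_overlap z : measurable_fun setT (overlap z).
Proof.
have m1 := @measurable_z1 R; have m2 := @measurable_z2 R.
have mr : measurable_fun setT (fun w : plane => (rho w)^-1).
  by apply: inv_ge1_measurable; [exact: measurable_r2|exact: rho_ge1].
apply: measurable_funM; last by apply: measurable_funM.
apply: measurable_funD; apply: measurable_funX.
  by apply: measurable_funD => //; apply: measurable_funD; apply: measurable_funM.
by apply: measurable_funB; apply: measurable_funM.
Qed.

Lemma overlap_bdm z : bdm (overlap z).
Proof.
split; first exact: measurable_overlap.
by exists 1 => w; rewrite ger0_norm ?overlap_ge0 ?overlap_le1.
Qed.

Variable m : nat.
Local Notation N := ((m.+1)%:R : R[i]).
Implicit Types (G : plane -> R) (U : 'M[R[i]]_m.+1).

Definition sqrt_bin (i : 'I_m.+1) : R := Num.sqrt ('C(m, i))%:R.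

Lemma sqrt_bin2 i : sqrt_bin i ^+ 2 = ('C(m, i))%:R. Proof. by rewrite sqr_sqrtr. Qed.
Lemma sqrt_bin_gt0 i : 0 < sqrt_bin i. Proof. by rewrite sqrtr_gt0 ltr0n bin_gt0 leq_ord. Qed.

(** The normalized monomials form an orthonormal basis of the holomorphic
    sections, up to the common factor sqrt (m + 1); here they are read in a unit
    frame, that is, multiplied by rho^(-m/2). *)
Definition onb (i : 'I_m.+1) (z : plane) : R[i] :=
  (sqrt_bin i * Num.sqrt (rho z)^-1 ^+ m)%:C%C * xy z ^+ i.

Lemma onbC i z : (onb i z)^* = (sqrt_bin i * Num.sqrt (rho z)^-1 ^+ m)%:C%C * (xy z)^* ^+ i.
Proof. by rewrite /onb [LHS]rmorphM /= conjc_real rmorphXn. Qed.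

Lemma onbM i l z : onb i z * (onb l z)^* = (sqrt_bin i * sqrt_bin l)%:C%C * mono i l m z.
Proof.
rewrite onbC /onb /mono -[(rho z)^-1 in RHS]sqr_sqrtr ?rhoV_ge0//.
rewrite [in RHS]exprAC; set b := Num.sqrt _ ^+ m.
by rewrite !rmorphM/=; ring.
Qed.

Lemma onb_cbdm i l : cbdm (fun z => onb i z * (onb l z)^*).
Proof.
apply: (cbdm_ext (fun z => esym (onbM i l z))); apply: cbdmM; first exact: cbdm_cst.
by apply: mono_cbdm; rewrite mul2n -addnn leq_add ?leq_ord.
Qed.

Lemma sum_onbE z w : \sum_i onb i z * (onb i w)^* =
  ((Num.sqrt (rho z)^-1 * Num.sqrt (rho w)^-1) ^+ m)%:C%C * (1 + xy z * (xy w)^*) ^+ m.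
Proof.
set a := Num.sqrt (rho z)^-1; set b := Num.sqrt (rho w)^-1.
rewrite exprDn mulr_sumr; apply: eq_bigr => i _.
rewrite onbC /onb -/a -/b expr1n mul1r exprMn -mulr_natl.
have <- : (('C(m, i))%:R : R)%:C%C = ('C(m, i))%:R by rewrite rmorph_nat.
by rewrite -sqrt_bin2 !exprMn !rmorphM/=; ring.
Qed.

Lemma sum_onb1 z : \sum_i onb i z * (onb i z)^* = 1.
Proof.
rewrite sum_onbE -expr2 sqr_sqrtr ?rhoV_ge0// rmorphXn/= -rhoE2 -exprMn -rmorphM/=.
by rewrite mulVf ?expr1n// gt_eqF// rho_gt0.
Qed.

Lemma sum_onb z w : (\sum_i onb i z * (onb i w)^* ) * (\sum_i onb i z * (onb i w)^* )^* = (overlap z w ^+ m)%:C%C.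
Proof.
rewrite sum_onbE; set a := Num.sqrt (rho z)^-1; set b := Num.sqrt (rho w)^-1.
rewrite [X in _ * X]rmorphM/= conjc_real [X in _ * (_ * X)]rmorphXn/= [in RHS]rmorphXn/= overlapE.
rewrite -[(rho z)^-1]sqr_sqrtr ?rhoV_ge0// -[(rho w)^-1]sqr_sqrtr ?rhoV_ge0// -/a -/b.
by rewrite !(rmorphM,rmorphXn)/= !exprMn; ring.
Qed.

(** The reproducing kernel is the sum of the products of basis sections at z and
    w. *)
Lemma overlap_onb z w : (overlap z w ^+ m)%:C%C =
  \sum_j \sum_k (onb j z * (onb k z)^* ) * (onb k w * (onb j w)^* ).
Proof.
rewrite -sum_onb rmorph_sum/= mulr_suml.
apply: eq_bigr => j _; rewrite mulr_sumr; apply: eq_bigr => k _.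
by rewrite [X in _ * X]rmorphM/= conjCK; ring.
Qed.

(** The matrix of the Toeplitz operator in the orthonormal basis; the factor m +
    1 completes the normalization of the sections. *)
Definition onb_mx G : 'M[R[i]]_m.+1 :=
  \matrix_(i, l) (N * cEx P (fun z => (G z)%:C%C * (onb i z * (onb l z)^* ))).

Lemma onb_mx_onb_cbdm G i l : bdm G -> cbdm (fun z => (G z)%:C%C * (onb i z * (onb l z)^* )).
Proof. by move=> bG; apply: cbdmM; [exact: cbdm_real|exact: onb_cbdm]. Qed.

Lemma onb_mx1 : onb_mx (fun=> 1) = 1%:M.
Proof.
apply/matrixP => i l; rewrite !mxE.
rewrite (cEx_ext P (h2 := fun z => (sqrt_bin i * sqrt_bin l)%:C%C * mono i l m z)); last first.
  by move=> z; rewrite mul1r onbM.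
rewrite cExZ//; last by apply: mono_cbdm; rewrite mul2n -addnn leq_add ?leq_ord.
have [->|il] := eqVneq i l.
  rewrite -[cEx _ _]/(mono_int R l l m) (@mono_int_eq R l m (leq_ord l)) -expr2 sqrt_bin2 rmorph_nat.
  have n0 : N != 0 by rewrite pnatr_eq0.
  have c0 : ('C(m, l))%:R != 0 :> R[i] by rewrite pnatr_eq0 -lt0n bin_gt0 leq_ord.
  by rewrite mulrA mulfV// mulf_neq0.
have nil : (i : nat) != l by apply: contra il => /eqP e; apply/eqP/val_inj.
by rewrite -[cEx _ _]/(mono_int R i l m) (@mono_int_neq R i l m (leq_ord i) (leq_ord l) nil) !mulr0.
Qed.

Lemma onb_mx_herm G : bdm G -> onb_mx G \is hermsymmx.
Proof.
move=> bG; apply/is_hermitianmxP; rewrite expr0 scale1r.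
apply/matrixP => i l; rewrite !mxE rmorphM /= conjC_nat -cEx_conj//; last exact: onb_mx_onb_cbdm.
congr (_ * _); apply: cEx_ext => z; rewrite [RHS]rmorphM/= conjc_real; congr (_ * _).
by rewrite [RHS]rmorphM/= conjCK mulrC.
Qed.

(** The basis moved by the matrix U; for U a unitary matrix of eigenvectors
    these are the eigensections. *)
Definition eigsec U j (z : plane) : R[i] := \sum_i U j i * onb i z.

Lemma eigsecM U j k z : eigsec U j z * (eigsec U k z)^* =
  \sum_i \sum_l (U j i * (U k l)^* ) * (onb i z * (onb l z)^* ).
Proof.
rewrite /eigsec rmorph_sum/= mulr_suml; apply: eq_bigr => i _.
rewrite mulr_sumr; apply: eq_bigr => l _; rewrite rmorphM/=; ring.
Qed.

Lemma eigsec_cbdm U j k : cbdm (fun z => eigsec U j z * (eigsec U k z)^* ).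
Proof.
apply: (cbdm_ext (fun z => esym (eigsecM U j k z))).
apply: cbdm_sum => i _; apply: cbdm_sum => l _; apply: cbdmM; last exact: onb_cbdm.
exact: cbdm_cst.
Qed.

Lemma onb_mx_eigsec U G j k : bdm G ->
  N * cEx P (fun z => (G z)%:C%C * (eigsec U j z * (eigsec U k z)^* )) = (U *m onb_mx G *m U ^t* ) j k.
Proof.
move=> bG.
have bil i l : cbdm (fun z => (U j i * (U k l)^* ) * ((G z)%:C%C * (onb i z * (onb l z)^* ))).
  by apply: cbdmM; [exact: cbdm_cst|exact: onb_mx_onb_cbdm].
rewrite (cEx_ext P (h2 := fun z => \sum_i \sum_l
    (U j i * (U k l)^* ) * ((G z)%:C%C * (onb i z * (onb l z)^* )))); last first.
  move=> z; rewrite eigsecM mulr_sumr; apply: eq_bigr => i _; rewrite mulr_sumr.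
  by apply: eq_bigr => l _; rewrite mulrCA.
rewrite cEx_sum//; last by move=> i _; apply: cbdm_sum => l _; exact: bil.
rewrite mulr_sumr mxE; under [RHS]eq_bigr => l _ do rewrite mxE mulr_suml.
rewrite exchange_big/=; apply: eq_bigr => i _.
rewrite cEx_sum// mulr_sumr; apply: eq_bigr => l _.
rewrite cExZ//; last exact: onb_mx_onb_cbdm.
rewrite !mxE; ring.
Qed.

(** The reproducing kernel does not depend on the orthonormal basis. *)
Lemma sum_eigsec U z w : U \is unitarymx ->
  \sum_j eigsec U j z * (eigsec U j w)^* = \sum_i onb i z * (onb i w)^*.
Proof.
move=> Uu.
have UU : U ^t* *m U = 1%:M by rewrite -invmx_unitary// mulVmx// unitarymx_unit.
have E j : eigsec U j z * (eigsec U j w)^* = \sum_i \sum_l (U j i * (U j l)^* ) * (onb i z * (onb l w)^* ).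
  rewrite /eigsec rmorph_sum/= mulr_suml; apply: eq_bigr => i _.
  by rewrite mulr_sumr; apply: eq_bigr => l _; rewrite rmorphM/=; ring.
under eq_bigr do rewrite E.
rewrite exchange_big; apply: eq_bigr => i _; rewrite exchange_big/=.
under eq_bigr => l _ do rewrite -mulr_suml.
have D l : \sum_j U j i * (U j l)^* = (l == i)%:R.
  have /matrixP/(_ l i) := UU; rewrite !mxE => <-; apply: eq_bigr => j _.
  by rewrite !mxE mulrC.
rewrite (bigD1 i)//= D eqxx mul1r big1 ?addr0// => l li.
by rewrite D (negPf li) mul0r.
Qed.

(** The Berezin transform of G, up to the factor m + 1. *)
Definition berezin G z : R := Ex P (fun w => G w * overlap z w ^+ m).

Let N0 : N != 0. Proof. by rewrite pnatr_eq0. Qed.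

Lemma berezinE G z : bdm G -> N * (berezin G z)%:C%C =
  \sum_j \sum_k (onb j z * (onb k z)^* ) * onb_mx G k j.
Proof.
move=> bG; rewrite -cEx_real//.
rewrite (cEx_ext P (h2 := fun w => \sum_j \sum_k (onb j z * (onb k z)^* ) *
   ((G w)%:C%C * (onb k w * (onb j w)^* )))); last first.
  move=> w; rewrite rmorphM/= overlap_onb mulr_sumr; apply: eq_bigr => j _; rewrite mulr_sumr.
  by apply: eq_bigr => k _; rewrite mulrCA.
have bjk j k : cbdm (fun w : plane => (onb j z * (onb k z)^* ) * ((G w)%:C%C * (onb k w * (onb j w)^* ))).
  by apply: cbdmM; [exact: cbdm_cst|exact: onb_mx_onb_cbdm].
rewrite cEx_sum//; last by move=> j _; apply: cbdm_sum => k _.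
rewrite mulr_sumr; apply: eq_bigr => j _.
rewrite cEx_sum// mulr_sumr; apply: eq_bigr => k _.
by rewrite cExZ// ?mxE 1?mulrCA//; exact: onb_mx_onb_cbdm.
Qed.

Lemma berezin1 z : berezin (fun=> 1) z = (m.+1)%:R^-1.
Proof.
apply: (@complexI R); apply: (mulfI N0); rewrite berezinE; last exact: bdm_cst.
rewrite onb_mx1 fmorphV rmorph_nat/= mulfV// -[RHS](sum_onb1 z); apply: eq_bigr => j _.
rewrite (bigD1 j)//= big1 ?addr0 => [|k kj]; rewrite mxE; first by rewrite eqxx mulr1.
by rewrite (negPf kj) mulr0.
Qed.

Lemma berezin_bdm G : bdm G -> bdm (berezin G).
Proof.
move=> bG; have [br _] : cbdm (fun z => N^-1 * \sum_j \sum_k (onb j z * (onb k z)^* ) * onb_mx G k j).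
  apply: cbdmM; first exact: cbdm_cst.
  apply: cbdm_sum => j _; apply: cbdm_sum => k _.
  by apply: cbdmM; [exact: onb_cbdm|exact: cbdm_cst].
move: br; congr bdm; apply/funext => z.
by rewrite -berezinE// mulKf.
Qed.

(** Expanding the kernel in the basis separates the two variables of the double
    integral and turns it into a trace. *)
Lemma Ex_berezin G H : bdm G -> bdm H ->
  (Ex P (fun z => H z * berezin G z))%:C%C = N^-1 ^+ 2 * \tr (onb_mx H *m onb_mx G).
Proof.
move=> bG bH; rewrite -cEx_real//.
apply: (mulfI (mulf_neq0 N0 N0)); rewrite -expr2 mulrA -exprMn mulfV// expr1n mul1r expr2 -mulrA.
rewrite -cExZ//; last by apply: cbdm_real; apply: bdmM => //; exact: berezin_bdm.
rewrite (cEx_ext P (h2 := fun z => \sum_j \sum_k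
   onb_mx G k j * ((H z)%:C%C * (onb j z * (onb k z)^* )))); last first.
  move=> z; rewrite rmorphM/= mulrCA berezinE// mulr_sumr; apply: eq_bigr => j _.
  by rewrite mulr_sumr; apply: eq_bigr => k _; ring.
have bjk j k : cbdm (fun z : plane => onb_mx G k j * ((H z)%:C%C * (onb j z * (onb k z)^* ))).
  by apply: cbdmM; [exact: cbdm_cst|exact: onb_mx_onb_cbdm].
rewrite cEx_sum//; last by move=> j _; apply: cbdm_sum => k _.
rewrite mulr_sumr; apply: eq_bigr => j _; rewrite mxE.
rewrite cEx_sum// mulr_sumr; apply: eq_bigr => k _.
rewrite cExZ//; last exact: onb_mx_onb_cbdm.
by rewrite !mxE; ring.
Qed.

Lemma tr_onb_mx G : bdm G -> \tr (onb_mx G) = N * (Ex P G)%:C%C.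
Proof.
move=> bG; rewrite -cEx_real//.
rewrite (cEx_ext P (h2 := fun z => \sum_j ((G z)%:C%C * (onb j z * (onb j z)^* )))); last first.
  by move=> z; rewrite -mulr_sumr sum_onb1 mulr1.
rewrite cEx_sum//; last by move=> j _; exact: onb_mx_onb_cbdm.
by rewrite mulr_sumr; apply: eq_bigr => j _; rewrite mxE.
Qed.

End spectral_sections.

Section variance.
Variable R : realType.
Notation plane := (plane R).
Notation P := (FSP R).
Let P1 := FSP_setT R.

(** The left side is the double integral of (F z - F w)^2 against the density (m
    + 1) overlap^m, which is a probability density in w for each z: the
    hypothesis bounds it by eps plus C times the mean of 1 - overlap, and that
    mean is 1 / (m + 2). *)
Lemma Ex_variance m (F : plane -> R) (eps C : R) : bdm F ->
  (forall z w, (F z - F w) ^+ 2 <= eps + C * (1 - overlap z w)) ->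
  2 * (Ex P (fun z => F z ^+ 2) - (m.+1)%:R^-1 * complex.Re (\tr (onb_mx m F *m onb_mx m F)))
    <= eps + C / (m.+2)%:R.
Proof.
move=> bF hF; set N : R := (m.+1)%:R.
have N0 : 0 < N by rewrite ltr0n.
have Nn0 : N != 0 by rewrite gt_eqF.
pose F2 z := F z ^+ 2.
have bF2 : bdm F2 by exact: bdmX.
have bk z : bdm (fun w : plane => overlap z w ^+ m) by apply: bdmX; exact: overlap_bdm.
have bG G z : bdm G -> bdm (fun w : plane => G w * overlap z w ^+ m) by move=> h; exact: bdmM.
have pw z : N * (F z ^+ 2 * N^-1 - 2 * F z * berezin m F z + berezin m F2 z) <= eps + C / (m.+2)%:R.
  have -> : F z ^+ 2 * N^-1 - 2 * F z * berezin m F z + berezin m F2 z =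
     Ex P (fun w => (F z - F w) ^+ 2 * overlap z w ^+ m).
    rewrite -(berezin1 m z) /berezin -!ExZ//; [|exact: bG|by apply: bG; exact: bdm_cst].
    rewrite -ExB//; last 2 first.
    - by apply: bdmM; [exact: bdm_cst|apply: bG; exact: bdm_cst].
    - by apply: bdmM; [exact: bdm_cst|exact: bG].
    rewrite -ExD//; last 2 first.
    - by apply: bdmB; apply: bdmM; try exact: bdm_cst; apply: bG => //; exact: bdm_cst.
    - exact: bG.
    by congr Ex; apply/funext => w; rewrite /F2; ring.
  have bd : bdm (fun w => (F z - F w) ^+ 2 * overlap z w ^+ m).
    by apply: bG; apply: bdmX; apply: bdmB => //; exact: bdm_cst.
  have bk1 : bdm (fun w : plane => overlap z w ^+ m.+1) by apply: bdmX; exact: overlap_bdm.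
  have bZ c k : bdm (fun w : plane => c * overlap z w ^+ k).
    by apply: bdmM; [exact: bdm_cst|apply: bdmX; exact: overlap_bdm].
  have : Ex P (fun w => (F z - F w) ^+ 2 * overlap z w ^+ m) <=
         Ex P (fun w => (eps + C) * overlap z w ^+ m - C * overlap z w ^+ m.+1).
    apply: Ex_le => //; first exact: bdmB.
    move=> w; rewrite (exprS (overlap z w)).
    have -> : (eps + C) * overlap z w ^+ m - C * (overlap z w * overlap z w ^+ m) =
       (eps + C * (1 - overlap z w)) * overlap z w ^+ m by ring.
    by rewrite ler_wpM2r// exprn_ge0// overlap_ge0.
  rewrite ExB// !ExZ// => h.
  have e1 k : Ex P (fun w => overlap z w ^+ k) = (k.+1)%:R^-1.
    by rewrite -(berezin1 k z); congr Ex; apply/funext => w; rewrite mul1r.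
  rewrite !e1 in h.
  apply: (le_trans (ler_wpM2l (ltW N0) h)).
  rewrite le_eqVlt; apply/orP; left; apply/eqP.
  have n2 : (m.+2)%:R = N + 1 :> R by rewrite natr1.
  have n2n : N + 1 != 0 by rewrite -n2 pnatr_eq0.
  rewrite n2 -/N; clearbody N; field.
  by rewrite Nn0 n2n.
have bB := berezin_bdm m bF; have bB2 := berezin_bdm m bF2.
have bFB : bdm (fun z => F z * berezin m F z) by exact: bdmM.
have := @Ex_le _ _ _ P P1 _ _ _ (bdm_cst _ _) pw.
rewrite Ex_cst// => H; apply: le_trans (H _).
  have -> : (fun z => N * (F z ^+ 2 * N^-1 - 2 * F z * berezin m F z + berezin m F2 z)) =
    (fun z => F2 z + (- 2 * N) * (F z * berezin m F z) + N * berezin m F2 z).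
    apply/funext => z; rewrite /F2; field.
    by [].
  (* The kernel integrates to 1 in either variable. *)
  have EB2 : N * Ex P (berezin m F2) = Ex P F2.
    apply: (@complexI R); rewrite rmorphM/=.
    have := Ex_berezin m bF2 (bdm_cst _ 1).
    rewrite onb_mx1 mul1mx tr_onb_mx//.
    have -> : (fun z => 1 * berezin m F2 z) = berezin m F2 by apply/funext => z; rewrite mul1r.
    move=> ->; rewrite expr2 -mulrA mulKf ?pnatr_eq0//.
    by rewrite rmorph_nat mulVKf// pnatr_eq0.
  have EB : N * Ex P (fun z => F z * berezin m F z) = N^-1 * complex.Re (\tr (onb_mx m F *m onb_mx m F)).
    have := Ex_berezin m bF bF => /(congr1 (@complex.Re R)) /= ->.
    have -> : ((m.+1)%:R : R[i])^-1 ^+ 2 = (N^-1 ^+ 2)%:C%C by rewrite rmorphXn/= fmorphV rmorph_nat.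
    by case: (\tr _) => a b /=; rewrite mul0r subr0; field.
  rewrite ExD//; last 2 first.
  - by apply: bdmD => //; apply: bdmM => //; exact: bdm_cst.
  - by apply: bdmM => //; exact: bdm_cst.
  rewrite ExD//; last by apply: bdmM => //; exact: bdm_cst.
  rewrite !ExZ// EB2 -mulrA EB -/F2.
  by rewrite le_eqVlt; apply/orP; left; apply/eqP; ring.
apply: bdmM; first exact: bdm_cst.
apply: bdmD => //; apply: bdmB; first by apply: bdmM => //; exact: bdm_cst.
apply: bdmM => //; apply: bdmM => //; exact: bdm_cst.
Qed.
End variance.

Section toeplitz_spectrum.
Variable R : realType.
Notation plane := (plane R).
Notation P := (FSP R).
Let P1 := FSP_setT R.
Variable m : nat.
Local Notation sqrt_bin := (sqrt_bin R).

Lemma char_poly_intertwine (n : nat) (A B D : 'M[R[i]]_n.+1) : D \in unitmx ->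
  D *m A = B *m D -> char_poly A = char_poly B.
Proof.
move=> uD DA; rewrite /char_poly.
have dn0 : \det (map_mx polyC D) != 0.
  by rewrite det_map_mx polyC_eq0 -unitfE -unitmxE.
apply: (mulfI dn0); rewrite -det_mulmx mulrC -det_mulmx; congr (\det _).
rewrite /char_poly_mx mulmxBr mulmxBl -!map_mxM DA; congr (_ - _).
by rewrite scalar_mxC.
Qed.

(** The j-th weight is the squared modulus of the j-th normalized eigensection,
    divided by m + 1: the weights sum to 1 because the reproducing kernel is
    constant on the diagonal, and testing the Toeplitz operator on an
    eigensection gives the mean of F for its weight. The Toeplitz matrix in the
    basis of monomials becomes hermitian after rescaling by the square roots of
    binomial coefficients. *)
Lemma toeplitz_spectrum (f : CP1 R -> R) (F := f \o @chart0 R \o @xy R : plane -> R)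
    (l := toeplitz_eigenvalues m f) : bdm F ->
  exists p : 'I_m.+1 -> plane -> R,
  [/\ forall j, bdm (p j), forall j z, 0 <= p j z, forall z, \sum_j p j z = 1,
      forall j, Ex P (p j) = (m.+1)%:R^-1 &
      forall j, Ex P (fun z => F z * p j z) = (m.+1)%:R^-1 * l 0 j] /\
  \sum_j l 0 j ^+ 2 = complex.Re (\tr (onb_mx m F *m onb_mx m F)).
Proof.
move=> bF; pose H := onb_mx m F.
pose U := spectralmx H; pose sp := spectral_diag H.
have Uu : U \is unitarymx by exact: spectral_unitarymx.
have HE : H = invmx U *m diag_mx sp *m U.
  by apply/orthomx_spectralP/hermitian_normalmx; exact: onb_mx_herm.
have UH : U *m H *m U ^t* = diag_mx sp.
  by rewrite HE -invmx_unitary// !mulmxA mulmxV ?spectral_unit// mul1mx mulmxK// spectral_unit.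
have spR j : (complex.Re (sp 0 j))%:C%C = sp 0 j.
  have /mxOverP/(_ 0 j) := hermitian_spectral_diag_real (onb_mx_herm m bF).
  by move=> /RRe_real.
pose D : 'M[R[i]]_m.+1 := diag_mx (\row_j (sqrt_bin j)%:C%C).
have bcn0 j : (sqrt_bin j)%:C%C != 0 by rewrite -[0]/(0%:C%C) (inj_eq (@complexI R)) gt_eqF// sqrt_bin_gt0.
have DT : D *m toeplitz_mx m f = H *m D.
  apply/matrixP => i k.
  transitivity ((sqrt_bin i)%:C%C * toeplitz_mx m f i k); first by rewrite mul_diag_mx !mxE.
  transitivity (H i k * (sqrt_bin k)%:C%C); last by rewrite mul_mx_diag !mxE.
  rewrite toeplitz_mxE// [H _ _]mxE.
  rewrite (cEx_ext P (h2 := fun z => (sqrt_bin i * sqrt_bin k)%:C%C * ((F z)%:C%C * mono i k m z))); last first.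
    by move=> z; rewrite onbM mulrCA.
  rewrite cExZ//; last by apply: wmono_int_cbdm => //; exact: leq_ord.
  rewrite -/(wmono_int m F i k); have <- : ((sqrt_bin k ^+ 2)%:C%C) = ('C(m, k))%:R :> R[i].
    by rewrite sqrt_bin2 rmorph_nat.
  by rewrite !(rmorphM,rmorphXn)/=; ring.
have uD : D \in unitmx.
  rewrite unitmxE det_diag unitfE; apply/prodf_neq0 => j _; rewrite mxE; exact: bcn0.
have cT : char_poly (toeplitz_mx m f) = \prod_(k < m.+1) ('X - (sp 0 k)%:P).
  rewrite (char_poly_intertwine uD DT).
  rewrite (@char_poly_intertwine _ _ (diag_mx sp) U).
  - rewrite char_poly_trig ?diag_mx_is_trig//; apply: eq_bigr => k _.
    by rewrite mxE eqxx.
  - exact: spectral_unit.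
  - by rewrite HE !mulmxA mulmxV ?spectral_unit// mul1mx.
have lE : char_poly (toeplitz_mx m f) = \prod_(k < m.+1) ('X - ((l 0 k)%:C%C)%:P).
  rewrite /l /toeplitz_eigenvalues.
  apply: (xgetPex 0 (P := [set l : 'rV[R]_m.+1 |
    char_poly (toeplitz_mx m f) = \prod_(k < m.+1) ('X - ((l 0 k)%:C%C)%:P)])).
  exists (\row_k complex.Re (sp 0 k)); rewrite /= cT; apply: eq_bigr => k _.
  by rewrite mxE spR.
(* The eigenvalues are only known up to order, from the characteristic
   polynomial. *)
have [s sE] : exists s : 'S_m.+1, forall k, l 0 k = complex.Re (sp 0 (s k)).
  have : perm_eq [tuple (l 0 k)%:C%C | k < m.+1] [tuple sp 0 k | k < m.+1].
    apply: prod_XsubC_eq; rewrite !big_tuple.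
    under eq_bigr => k _ do rewrite tnth_mktuple.
    under [RHS]eq_bigr => k _ do rewrite tnth_mktuple.
    by rewrite -lE cT.
  move=> /tuple_permP[s se]; exists s => k.
  have := congr1 (fun t => tnth t k) (val_inj se).
  by rewrite !tnth_mktuple => <-.
have vR j z : (complex.Re (eigsec U j z * (eigsec U j z)^* ))%:C%C = eigsec U j z * (eigsec U j z)^*.
  by case: (eigsec U j z) => a b; simpc; congr Complex; ring.
have v0 j z : 0 <= complex.Re (eigsec U j z * (eigsec U j z)^* ).
  by case: (eigsec U j z) => a b /=; rewrite mulrN opprK addr_ge0// -expr2 sqr_ge0.
have N0 : (m.+1)%:R != 0 :> R[i] by rewrite pnatr_eq0.
have EG (G : plane -> R) j : bdm G -> Ex P (fun z => G z * complex.Re (eigsec U j z * (eigsec U j z)^* )) =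
    (m.+1)%:R^-1 * complex.Re ((U *m onb_mx m G *m U ^t* ) j j).
  move=> bG; apply: (@complexI R); apply: (mulfI N0).
  rewrite -cEx_real// (cEx_ext P (h2 := fun z => (G z)%:C%C * (eigsec U j z * (eigsec U j z)^* ))).
    rewrite -[in RHS]onb_mx_eigsec// rmorphM/= fmorphV rmorph_nat/=.
    set c := cEx _ _.
    have cR : (complex.Re c)%:C%C = c.
      rewrite /c (cEx_ext P (h2 := fun z => (G z * complex.Re (eigsec U j z * (eigsec U j z)^* ))%:C%C)) ?cEx_real//.
      by move=> z; rewrite rmorphM/= vR.
    have NE : (m.+1)%:R = ((m.+1)%:R : R)%:C%C :> R[i] by rewrite rmorph_nat.
    by clearbody c; rewrite mulVKf// NE -cR -rmorphM.
  by move=> z; rewrite rmorphM/= vR.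
have bp j : bdm (fun z : plane => complex.Re (eigsec U j z * (eigsec U j z)^* )) by have [] := eigsec_cbdm U j j.
exists (fun j z => complex.Re (eigsec U (s j) z * (eigsec U (s j) z)^* )); split; first split.
- by move=> j; exact: bp.
- by move=> j z; exact: v0.
- move=> z; apply: (@complexI R); rewrite rmorph_sum/=.
  under eq_bigr do rewrite vR.
  have -> : \sum_j eigsec U (s j) z * (eigsec U (s j) z)^* = \sum_j eigsec U j z * (eigsec U j z)^*.
    by rewrite [RHS](reindex_inj (@perm_inj _ s)).
  by rewrite sum_eigsec// sum_onb1.
- move=> j; have := EG (fun=> 1) (s j) (bdm_cst _ 1).
  rewrite onb_mx1 mulmx1; move/unitarymxP: Uu => ->; rewrite mxE eqxx /= mulr1 => <-.
  by congr Ex; apply/funext => z; rewrite mul1r.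
- by move=> j; rewrite EG// UH mxE eqxx sE.
have -> : \tr (onb_mx m F *m onb_mx m F) = \sum_j sp 0 j ^+ 2.
  rewrite -/H {1}HE -!mulmxA mxtrace_mulC -!mulmxA.
  have -> : U *m (H *m invmx U) = diag_mx sp by rewrite mulmxA invmx_unitary.
  rewrite /mxtrace; apply: eq_bigr => j _; rewrite mul_diag_mx !mxE eqxx expr2 //.
rewrite raddf_sum/= [RHS](reindex_inj (@perm_inj _ s)); apply: eq_bigr => j _.
by rewrite sE -[in RHS](spR (s j)) -rmorphXn.
Qed.
End toeplitz_spectrum.

(** * Step functions and monotone couplings *)

Section unit_interval.
Variable R : realType.
Notation I01 := (measurableTypeR R).
Notation L := (lebesgue01 R).

Lemma lebesgue01E (A : set R) : L A = lebesgue_measure (A `&` `[0, 1]).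
Proof. by []. Qed.

Lemma lebesgue01_setT : L setT = 1%E.
Proof. by rewrite lebesgue01E setTI lebesgue_measure_itv/= lte01 oppr0 adde0. Qed.

Lemma ae01 (Q : R -> Prop) : (forall t, 0 < t < 1 -> Q t) -> {ae L, forall t : I01, Q t}.
Proof.
move=> HQ; exists ([set t : R | t <= 0] `|` [set t : R | 1 <= t]); split.
- by rewrite -set_itvNyc -set_itvcy; exact: measurableU.
- rewrite lebesgue01E; apply: (@subset_measure0 _ _ _ (@lebesgue_measure R) _ [set 0; 1]).
  + by apply: measurableI => //; rewrite -set_itvNyc -set_itvcy; exact: measurableU.
  + exact: measurableU.
  + move=> t /= [[t0|t1]]; rewrite in_itv/= => /andP[t0' t1'].
      by left; apply/eqP; rewrite eq_le t0 t0'.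
    by right; apply/eqP; rewrite eq_le t1 t1'.
  + by apply: countable_lebesgue_measure0; exact: finite_set_countable.
- move=> t /= nQ; have [t0|t0] := leP t 0; first by left.
  have [t1|t1] := leP 1 t; first by right.
  by exfalso; apply: nQ; apply: HQ; rewrite t0 t1.
Qed.

Lemma Ex01_eq (g h : I01 -> R) : bdm g -> bdm h -> (forall t, 0 < t < 1 -> g t = h t) ->
  Ex L g = Ex L h.
Proof.
move=> bg bh e; apply: Ex_ae => //; have [A [mA A0 sA]] := ae01 e.
by exists A; split => // t /= nh; apply: sA => /= h2; apply: nh.
Qed.

Variable m : nat.
Local Notation N := ((m.+1)%:R : R).

Definition cell (k : nat) : set I01 := `[k%:R / N, k.+1%:R / N[%classic.

Lemma cellE k (t : R) : (t \in cell k) = (k%:R <= t * N < k.+1%:R).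
Proof.
have N0 : 0 < N by rewrite ltr0n.
by apply/idP/idP; rewrite inE /cell /= in_itv/= ler_pdivrMr// ltr_pdivlMr.
Qed.

Lemma cellP (t : R) : 0 <= t < 1 -> exists j : 'I_m.+1, forall k : nat, t \in cell k = (k == j :> nat).
Proof.
move=> /andP[t0 t1].
have N0 : 0 < N by rewrite ltr0n.
have x0 : 0 <= t * N by rewrite mulr_ge0// ltW.
have /andP[xl xu] := truncn_itv x0.
have jm : (Num.truncn (t * N) < m.+1)%N.
  rewrite -(@ltr_nat R); apply: le_lt_trans xl _.
  by rewrite -[ltRHS]mul1r ltr_pM2r.
exists (Ordinal jm) => k /=; rewrite cellE; apply/idP/idP => [h|/eqP ->].
  by rewrite (truncn_def h).
by rewrite xl xu.
Qed.

Lemma cell_measurable k : measurable (cell k).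
Proof. exact: measurable_itv. Qed.

Lemma cell_bdm k : bdm (\1_(cell k) : I01 -> R).
Proof. by apply: bdm_indic; exact: cell_measurable. Qed.

Lemma Ex_cell (k : 'I_m.+1) : Ex L \1_(cell k) = N^-1.
Proof.
have N0 : 0 < N by rewrite ltr0n.
rewrite Ex_indic//; last exact: cell_measurable.
rewrite lebesgue01E (_ : cell k `&` _ = cell k); last first.
  apply/setIidPl => t /mem_set; rewrite cellE => /andP[a b].
  rewrite /= in_itv/= -(ler_pM2r N0) mul0r (le_trans _ a)//= -(ler_pM2r N0) mul1r.
  by rewrite (le_trans (ltW b))// ler_nat ltn_ord.
rewrite lebesgue_measure_itv/= lte_fin ltr_pM2r ?invr_gt0// ltr_nat ltnS leqnn /=.
by rewrite -mulrBl -natrB// subSnn mul1r.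
Qed.

Definition steps (a : 'I_m.+1 -> R) : I01 -> R := fun t => \sum_k a k * \1_(cell k) t.

Lemma steps_bdm a : bdm (steps a).
Proof.
by apply: bdm_sum => k _; apply: bdmM; [exact: bdm_cst|exact: cell_bdm].
Qed.

(** Describing the index of the cell by comparisons with the grid points k / N
    is what monotonicity arguments use. *)
Lemma stepsP (t : R) : 0 <= t < 1 -> exists j : 'I_m.+1,
  (forall k : nat, (t < k%:R / N) = (j < k)%N) /\ forall a, steps a t = a j.
Proof.
move=> t01; have [j jP] := cellP t01; exists j; split => [k|a].
  have N0 : 0 < N by rewrite ltr0n.
  have := jP j; rewrite eqxx cellE => /andP[a b]; rewrite ltr_pdivlMr//.
  apply/idP/idP => [h|jk]; first by rewrite -(ltr_nat R) (le_lt_trans a).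
  by rewrite (lt_le_trans b)// ler_nat.
rewrite /steps (bigD1 j)//= big1 ?addr0 => [|k kj]; rewrite indicE jP.
  by rewrite eqxx mulr1.
by rewrite (_ : (k == j :> nat) = false) ?mulr0//; apply/negbTE.
Qed.

Lemma sum_cell_le1 t : \sum_(k < m.+1) \1_(cell k) t <= 1 :> R.
Proof.
have [t01|t01] := boolP (0 <= t < 1).
  have [j [_ sj]] := stepsP t01; have := sj (fun=> 1).
  by rewrite /steps; under eq_bigr do rewrite mul1r; move=> ->.
rewrite big1 // => k _; rewrite indicE; case: (boolP (t \in cell k)) => //.
have N0 : 0 < N by rewrite ltr0n.
rewrite cellE => /andP[a b]; case/negP: t01; apply/andP; split.
  by rewrite -(ler_pM2r N0) mul0r (le_trans _ a).
by rewrite -(ltr_pM2r N0) mul1r (lt_le_trans b)// ler_nat.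
Qed.

Section weights.
Context d (T : measurableType d) (mu : {measure set T -> \bar R}).
Hypothesis mu1 : mu setT = 1%E.
Variable p : 'I_m.+1 -> T -> R.
Hypotheses (bp : forall j, bdm (p j)) (p0 : forall j x, 0 <= p j x)
  (p1 : forall x, \sum_j p j x <= 1) (Ep : forall j, Ex mu (p j) = N^-1).

(** The means of the weights already sum to 1, so their sum is 1 almost
    everywhere. *)
Lemma weights_total (g : T -> R) : bdm g -> \sum_j Ex mu (fun x => g x * p j x) = Ex mu g.
Proof.
move=> bg; have bS : bdm (fun x => \sum_j p j x) by exact: bdm_sum.
rewrite -Ex_sum//; last by move=> j _; exact: bdmM.
have -> : (fun x => \sum_j g x * p j x) = (fun x => g x * \sum_j p j x).
  by apply/funext => x; rewrite mulr_sumr.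
have b1 : bdm (fun x => 1 - \sum_j p j x) by apply: bdmB => //; exact: bdm_cst.
have bgS : bdm (fun x => g x * \sum_j p j x) by exact: bdmM.
have bg1 : bdm (fun x => g x * (1 - \sum_j p j x)) by exact: bdmM.
have E1 : Ex mu (fun x => 1 - \sum_j p j x) = 0.
  rewrite ExB//; last exact: bdm_cst.
  rewrite Ex_cst// Ex_sum//; under eq_bigr do rewrite Ep.
  by rewrite sumr_const card_ord -[X in 1 - X]mulr_natl mulfV ?subrr// pnatr_eq0.
apply/eqP; rewrite eq_sym -subr_eq0 -ExB//.
have -> : (fun x => g x - g x * \sum_j p j x) = (fun x => g x * (1 - \sum_j p j x)).
  by apply/funext => x; ring.
rewrite -normr_le0; apply: le_trans (Ex_norm mu1 bg1) _.
have [M [M0 gM]] := bdm_bound bg.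
apply: (@le_trans _ _ (Ex mu (fun x => M * (1 - \sum_j p j x)))); last by rewrite ExZ// E1 mulr0.
apply: Ex_le => //.
- by split; [apply: measurableT_comp => //; exact: bdm_meas
    | have [K [_ hK]] := bdm_bound bg1; exists K => x; rewrite normr_id].
- by apply: bdmM => //; exact: bdm_cst.
by move=> x; rewrite normrM (ger0_norm (x := 1 - _)) ?subr_ge0// ler_wpM2r// subr_ge0.
Qed.

Lemma cost_expand (g : T -> R) (a : 'I_m.+1 -> R) : bdm g ->
  \sum_j Ex mu (fun x => (g x - a j) ^+ 2 * p j x) =
  Ex mu (fun x => g x ^+ 2) - 2 * (\sum_j a j * Ex mu (fun x => g x * p j x)) + N^-1 * \sum_j a j ^+ 2.
Proof.
move=> bg; have bg2 : bdm (fun x => g x ^+ 2) by exact: bdmX.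
rewrite -(weights_total bg2) mulr_sumr mulr_sumr -sumrB -big_split; apply: eq_bigr => j _ /=.
have b1 : bdm (fun x => g x * p j x) by exact: bdmM.
have b2 : bdm (fun x => g x ^+ 2 * p j x) by exact: bdmM.
have -> : (fun x => (g x - a j) ^+ 2 * p j x) =
   (fun x => g x ^+ 2 * p j x + (- 2 * a j) * (g x * p j x) + a j ^+ 2 * p j x).
  by apply/funext => x; ring.
have sqrt_bin c (h : T -> R) : bdm h -> bdm (fun x => c * h x) by move=> bh; apply: bdmM => //; exact: bdm_cst.
rewrite ExD//; [|by apply: bdmD => //; exact: sqrt_bin|exact: sqrt_bin].
rewrite ExD//; last exact: sqrt_bin.
by rewrite !ExZ// Ep; ring.
Qed.

(** A weight P with 0 <= P <= 1 satisfies g P <= max (g - c) 0 + c P pointwise.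
    *)
Lemma weights_partial (g : T -> R) (c : R) (k : nat) : bdm g -> (k <= m.+1)%N ->
  \sum_(j < m.+1 | (j < k)%N) Ex mu (fun x => g x * p j x) <=
  Ex mu (fun x => Num.max (g x - c) 0) + c * (k%:R / N).
Proof.
move=> bg km.
have bj j : bdm (fun x => g x * p j x) by exact: bdmM.
have bS : bdm (fun x => \sum_(j < m.+1 | (j < k)%N) p j x) by exact: bdm_sum.
have bm : bdm (fun x => Num.max (g x - c) 0) by apply: bdm_max0; apply: bdmB => //; exact: bdm_cst.
have -> : k%:R / N = Ex mu (fun x => \sum_(j < m.+1 | (j < k)%N) p j x).
  rewrite Ex_sum//; under eq_bigr do rewrite Ep.
  by rewrite (big_ord_narrow km) sumr_const card_ord -[RHS]mulr_natl.
have bcS : bdm (fun x => c * \sum_(j < m.+1 | (j < k)%N) p j x) by apply: bdmM => //; exact: bdm_cst.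
rewrite -ExZ// -ExD// -Ex_sum//; apply: Ex_le => //.
- by apply: bdm_sum.
- exact: bdmD.
move=> x; rewrite -mulr_sumr; set S := \sum_(j < _ | _) _.
have S0 : 0 <= S by apply: sumr_ge0.
have S1 : S <= 1.
  apply: le_trans (p1 x); rewrite [leRHS](bigID (fun j : 'I_m.+1 => (j < k)%N))/= lerDl.
  exact: sumr_ge0.
rewrite -lerBlDr -mulrBl.
have [gc|gc] := leP 0 (g x - c).
  by rewrite -[leRHS]mulr1 ler_wpM2l.
by rewrite mulr_le0_ge0// ltW.
Qed.
End weights.

End unit_interval.

(** Summation by parts: the decrements of a and the partial sums of d have the
    same sign. *)
Lemma abel_sum (R : realType) (a d : nat -> R) n :
  (forall j, (j < n)%N -> a j.+1 <= a j) ->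
  (forall k, (k <= n)%N -> 0 <= \sum_(j < k.+1) d j) ->
  a n * (\sum_(j < n.+1) d j) <= \sum_(j < n.+1) a j * d j.
Proof.
elim: n => [|n IH] ha hd; first by rewrite !big_ord1.
rewrite big_ord_recr [leRHS]big_ord_recr/= mulrDr lerD2r.
apply: le_trans (IH _ _).
- by apply: ler_wpM2r; [exact: hd|exact: ha].
- by move=> j jn; apply: ha; rewrite ltnS ltnW.
- by move=> k kn; apply: hd; rewrite leqW.
Qed.

Section coupling.
Variable R : realType.
Notation I01 := (measurableTypeR R).
Notation L := (lebesgue01 R).
Let L1 := lebesgue01_setT R.
Variables (d : measure_display) (T : measurableType d) (mu : {measure set T -> \bar R}).
Hypothesis mu1 : mu setT = 1%E.
Variable m : nat.
Local Notation N := ((m.+1)%:R : R).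

(** Among all ways of matching the law of F with the values a_j of mass 1 / N
    each, the monotone one has the least quadratic cost. The squares have the
    same total on both sides, so the claim is that the mixed term sum_j a_j E[F
    p_j] is largest for the monotone matching. By summation by parts it is
    enough to compare the sums over j < k, and there the bathtub principle
    applies: a weight of mass k / N collects at most the integral of q over [0,
    k / N]. *)
Lemma coupling (F : T -> R) (q : I01 -> R) (a : 'I_m.+1 -> R) (p : 'I_m.+1 -> T -> R) :
  bdm F -> bdm q -> equimeas L mu q F ->
  (forall x y, 0 < x -> x <= y -> y < 1 -> q y <= q x) ->
  (forall i j : 'I_m.+1, (i <= j)%N -> a j <= a i) ->
  (forall j, bdm (p j)) -> (forall j x, 0 <= p j x) -> (forall x, \sum_j p j x <= 1) ->
  (forall j, Ex mu (p j) = N^-1) ->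
  Ex L (fun t => (steps a t - q t) ^+ 2) <= \sum_j Ex mu (fun x => (F x - a j) ^+ 2 * p j x).
Proof.
move=> bF bq eqm qmon amon bp p0 p1 Ep.
have N0 : 0 < N by rewrite ltr0n.
have bC (k : 'I_m.+1) : bdm (\1_(@cell R m k) : I01 -> R) by exact: cell_bdm.
have C0 (k : 'I_m.+1) (x : I01) : 0 <= \1_(@cell R m k) x :> R by [].
have EC (k : 'I_m.+1) : Ex L \1_(@cell R m k) = N^-1 by exact: Ex_cell.
have C1 (t : I01) : \sum_(k < m.+1) \1_(@cell R m k) t <= 1 :> R by exact: sum_cell_le1.
have eqE (phi : R -> R) : measurable_fun setT phi -> bdm (phi \o q) -> bdm (phi \o F) ->
   Ex L (phi \o q) = Ex mu (phi \o F).
  by move=> mphi b1 b2; exact: (equimeas_Ex L1 mu1).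
have -> : Ex L (fun t => (steps a t - q t) ^+ 2) =
   \sum_(j < m.+1) Ex L (fun t => (q t - a j) ^+ 2 * \1_(@cell R m j) t).
  have bj (j : 'I_m.+1) : bdm (fun t => (q t - a j) ^+ 2 * \1_(@cell R m j) t).
    by apply: bdmM => //; apply: bdmX; apply: bdmB => //; exact: bdm_cst.
  rewrite -Ex_sum//; apply: Ex01_eq.
  - by apply: bdmX; apply: bdmB => //; exact: steps_bdm.
  - exact: bdm_sum.
  - move=> t /andP[t0 t1]; have t01 : 0 <= t < 1 by rewrite ltW.
    have [j [_ sj]] := stepsP m t01; rewrite sj.
    by have := sj (fun j => (q t - a j) ^+ 2); rewrite /steps => ->; ring.
rewrite (cost_expand L1 bC C1 EC)// (cost_expand mu1 bp p1 Ep)//.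
rewrite lerD2r.
have -> : Ex mu (fun x => F x ^+ 2) = Ex L (fun t => q t ^+ 2).
  by apply/esym/(eqE (fun x => x ^+ 2)) => //; exact: bdmX.
rewrite lerD2l lerN2 ler_pM2l// -subr_ge0 -sumrB.
pose d' k : R := Ex L (fun t => q t * \1_(@cell R m (@inord m k)) t) - Ex mu (fun x => F x * p (inord k) x).
pose a' k := a (inord k).
have -> : \sum_(j < m.+1) (a j * Ex L (fun t => q t * \1_(@cell R m j) t) - a j * Ex mu (fun x => F x * p j x)) =
   \sum_(j < m.+1) a' j * d' j.
  by apply: eq_bigr => j _; rewrite /a' /d' inord_val mulrBr.
have d'E (k : nat) : (k <= m.+1)%N -> \sum_(j < k) d' j =
    \sum_(j < m.+1 | (j < k)%N) Ex L (fun t => q t * \1_(@cell R m j) t) -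
    \sum_(j < m.+1 | (j < k)%N) Ex mu (fun x => F x * p j x).
  move=> km; rewrite -sumrB (big_ord_narrow km); apply: eq_bigr => j _.
  by rewrite /d' (_ : inord j = widen_ord km j)//; apply/val_inj; rewrite /= inordK// (leq_trans (ltn_ord j)).
have tot : \sum_(j < m.+1) d' j = 0.
  rewrite d'E// (eq_bigl xpredT) => [|j]; last by rewrite ltn_ord.
  rewrite [X in _ - X](eq_bigl xpredT) => [|j]; last by rewrite ltn_ord.
  rewrite (weights_total L1 bC C1 EC)// (weights_total mu1 bp p1 Ep)//.
  by rewrite (eqE id)//= subrr.
apply: le_trans (abel_sum _ _); first by rewrite tot mulr0.
  move=> j jm; apply: amon; rewrite !inordK//; lia.
move=> k km; have [->|knm] := eqVneq k m; first by rewrite tot.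
have {}km : (k < m)%N by rewrite ltn_neqAle knm.
rewrite d'E; last by lia.
pose s : R := k.+1%:R / N.
have s0 : 0 < s by rewrite divr_gt0// ltr0n.
have s1 : s < 1 by rewrite ltr_pdivrMr// mul1r ltr_nat.
(* The threshold c of the bathtub principle is the value of q at k.+1 / N. *)
pose c := q s.
rewrite subr_ge0; apply: le_trans (weights_partial mu1 bp p0 p1 Ep c bF _) _; first by lia.
have bqc : bdm (fun t => Num.max (q t - c) 0) by apply: bdm_max0; apply: bdmB => //; exact: bdm_cst.
have bqj (j : 'I_m.+1) : bdm (fun t => q t * \1_(@cell R m j) t) by exact: bdmM.
have <- : Ex L (fun t => Num.max (q t - c) 0) = Ex mu (fun x => Num.max (F x - c) 0).
  apply: (eqE (fun x => Num.max (x - c) 0)) => //=.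
    apply: measurable_funrpos; apply: measurable_funB => //.
  by apply: bdm_max0; apply: bdmB => //; exact: bdm_cst.
have -> : k.+1%:R / N = Ex L (fun t => \sum_(j < m.+1 | (j < k.+1)%N) \1_(@cell R m j) t).
  rewrite Ex_sum//; under eq_bigr do rewrite EC.
  by rewrite (big_ord_narrow (ltnW km : (k.+1 <= m.+1)%N)) sumr_const card_ord -[RHS]mulr_natl.
have bS : bdm (fun t : I01 => \sum_(j < m.+1 | (j < k.+1)%N) \1_(@cell R m j) t : R) by exact: bdm_sum.
have bcS : bdm (fun t : I01 => c * \sum_(j < m.+1 | (j < k.+1)%N) \1_(@cell R m j) t : R).
  by apply: bdmM => //; exact: bdm_cst.
rewrite -ExZ// -ExD// -Ex_sum//.
rewrite le_eqVlt; apply/orP; left; apply/eqP; apply: Ex01_eq.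
- exact: bdmD.
- exact: bdm_sum.
move=> t /andP[t0 t1]; have t01 : 0 <= t < 1 by rewrite ltW.
have [j [tk sj]] := stepsP m t01.
have -> : \sum_(i < m.+1 | (i < k.+1)%N) \1_(@cell R m i) t = (j < k.+1)%:R :> R.
  have := sj (fun i => (i < k.+1)%:R); rewrite /steps => <-; rewrite big_mkcond/=.
  by apply: eq_bigr => i _; case: ifP; rewrite ?mul1r ?mul0r.
rewrite -mulr_sumr.
have -> : \sum_(i < m.+1 | (i < k.+1)%N) \1_(@cell R m i) t = (j < k.+1)%:R :> R.
  have := sj (fun i => (i < k.+1)%:R); rewrite /steps => <-; rewrite big_mkcond/=.
  by apply: eq_bigr => i _; case: ifP; rewrite ?mul1r ?mul0r.
have := tk k.+1; rewrite -/s; case: ltnP => _ ts.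
  rewrite !mulr1 (max_idPl _) ?subrK// subr_ge0; apply: qmon => //.
  by rewrite ltW// ts.
rewrite !mulr0 addr0 (max_idPr _)// subr_le0; apply: qmon => //.
by rewrite leNgt ts.
Qed.
End coupling.

(** * The decreasing rearrangement *)

Lemma noninc01_measurable (R : realType) (g : R -> R) :
  (forall x y, 0 < x -> x <= y -> y < 1 -> g y <= g x) ->
  measurable_fun (`]0, 1[%classic : set R) g.
Proof.
move=> g_ni; apply: (measurability (@RGenCInfty.G R)) => [|/= _ [_] [r] -> <-].
  exact: RGenCInfty.measurableE.
apply: is_interval_measurable => s t /=.
rewrite !in_itv/= !andbT => -[/andP[s0 s1] rs] [/andP[t0 t1] rt] u /andP[su ut].
have u0 : 0 < u by apply: lt_le_trans su.
have u1 : u < 1 by apply: le_lt_trans ut t1.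
by rewrite !in_itv/= u0 u1 andbT; split=> //; rewrite (le_trans rt)// g_ni.
Qed.

Section rearrangement.
Variable R : realType.
Notation plane := (plane R).
Notation P := (FSP R).
Notation I01 := (measurableTypeR R).
Notation L := (lebesgue01 R).
Let P1 := FSP_setT R.
Variable f : CP1 R -> R.
Let F : plane -> R := f \o @chart0 R \o @xy R.
Hypothesis bF : bdm F.

(** Outside ]0, 1[ the infimum defining the rearrangement may be taken over an
    empty or unbounded set; the value 0 there makes the function bounded without
    changing its class. *)
Definition rearr01 : I01 -> R := (decr_rearr f : R -> R) \_ (`]0, 1[%classic : set R).

Let mF A : measurable A -> measurable (F @^-1` A).
Proof. by move=> mA; rewrite -[X in measurable X]setTI; apply: (bdm_meas bF). Qed.

Let pr (A : set plane) : R := fine (P A).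
Let prE A : measurable A -> P A = (pr A)%:E.
Proof.
move=> mA; rewrite /pr fineK// ge0_fin_numE//.
have : (P setT < +oo)%E by rewrite P1 ltry.
by apply: le_lt_trans; apply: le_measure; rewrite ?inE.
Qed.
Let pr_le A B : measurable A -> measurable B -> A `<=` B -> pr A <= pr B.
Proof.
by move=> mA mB AB; rewrite -lee_fin -!prE// le_measure// inE.
Qed.
Let pr_setT : pr setT = 1. Proof. by rewrite /pr P1. Qed.
Let pr_ge0 A : 0 <= pr A. Proof. by rewrite fine_ge0. Qed.

Let mlt t : measurable [set z | F z < t].
Proof.
rewrite (_ : [set z | F z < t] = F @^-1` `]-oo, t[%classic); first exact: mF.
by apply/seteqP; split => z /=; rewrite in_itv.
Qed.
Let mge t : measurable [set z | t <= F z].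
Proof.
rewrite (_ : [set z | t <= F z] = F @^-1` `[t, +oo[%classic); first exact: mF.
by apply/seteqP; split => z /=; rewrite in_itv/= andbT.
Qed.
Let mgt t : measurable [set z | t < F z].
Proof.
rewrite (_ : [set z | t < F z] = F @^-1` `]t, +oo[%classic); first exact: mF.
by apply/seteqP; split => z /=; rewrite in_itv/= andbT.
Qed.

Let distrE t : 1 - distr_fun f t = pr [set z | t <= F z].
Proof.
have -> : distr_fun f t = pr [set z | F z < t].
  rewrite /distr_fun /pr; congr fine.
  have -> : [set omega | f omega < t] = f @^-1` `]-oo, t[%classic.
    by apply/seteqP; split => z /=; rewrite in_itv.
  rewrite FSP_prob; last exact: mF.
  by congr (P _); apply/seteqP; split => z /=; rewrite in_itv.
apply/eqP; rewrite subr_eq -eqe EFinD -!prE// -measureU//.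
- by rewrite -P1; apply/eqP; congr (P _); apply/seteqP; split => z //= _; case: (leP t (F z)); [left|right].
- by apply/seteqP; split => z //= -[/le_lt_trans h /h]; rewrite ltxx.
Qed.

Lemma decr_rearrE s : decr_rearr f s = inf [set t | pr [set z | t <= F z] < s].
Proof. by rewrite /decr_rearr; congr inf; apply/seteqP; split => t /=; rewrite distrE. Qed.

Let A s : set R := [set t | pr [set z | t <= F z] < s].

Let A_lb M s : (forall z, `|F z| <= M) -> s < 1 -> lbound (A s) (- M).
Proof.
move=> hM s1 t; rewrite /A/= => h; rewrite leNgt; apply/negP => tM.
have : pr [set z | t <= F z] = 1.
  rewrite -pr_setT; congr pr; apply/seteqP; split => z //= _.
  by rewrite (le_trans (ltW tM))//; have := hM z; rewrite ler_norml => /andP[].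
by move=> e; move: h; rewrite e => /(lt_trans s1); rewrite ltxx.
Qed.

Let A_in M s t : (forall z, `|F z| <= M) -> 0 < s -> M < t -> A s t.
Proof.
move=> hM s0 Mt; rewrite /A/= (_ : [set z | t <= F z] = set0).
  by rewrite /pr measure0.
apply/seteqP; split => z //=; rewrite leNgt => /negP; apply.
by apply: le_lt_trans Mt; rewrite (le_trans (ler_norm _)).
Qed.

Let A_inf s : 0 < s < 1 -> has_inf (A s).
Proof.
move=> /andP[s0 s1]; have [M [M0 hM]] := bdm_bound bF; split.
  by exists (M + 1); apply: (A_in hM) => //; rewrite ltrDl.
by exists (- M); exact: A_lb.
Qed.

Lemma decr_rearr_le_mono x y : 0 < x -> x <= y -> y < 1 -> decr_rearr f y <= decr_rearr f x.
Proof.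
move=> x0 xy y1; rewrite !decr_rearrE.
apply: lb_le_inf; first by have [] := A_inf (introT andP (conj x0 (le_lt_trans xy y1))).
move=> t /= h; apply: ge_inf.
  by have [] := A_inf (introT andP (conj (lt_le_trans x0 xy) y1)).
exact: lt_le_trans h xy.
Qed.

Lemma decr_rearr_bound M s : (forall z, `|F z| <= M) -> 0 < s < 1 -> `|decr_rearr f s| <= M.
Proof.
move=> hM s01; have /andP[s0 s1] := s01; rewrite decr_rearrE ler_norml; apply/andP; split.
  by apply: lb_le_inf; [have [] := A_inf s01 | exact: A_lb].
apply/ler_addgt0Pr => e e0; apply: ge_inf; first by have [] := A_inf s01.
by apply: (A_in hM) => //; rewrite ltrDl.
Qed.

Lemma rearr01E t : 0 < t < 1 -> rearr01 t = decr_rearr f t.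
Proof. by move=> t01; rewrite /rearr01 patchE mem_set//= in_itv. Qed.

Lemma rearr01_mono x y : 0 < x -> x <= y -> y < 1 -> rearr01 y <= rearr01 x.
Proof.
move=> x0 xy y1; rewrite !rearr01E ?decr_rearr_le_mono// ?x0 ?y1 ?andbT ?(le_lt_trans xy)//.
by rewrite (lt_le_trans x0 xy).
Qed.

Lemma rearr01_bdm : bdm rearr01.
Proof.
split.
  rewrite /rearr01; have mI : measurable (`]0, 1[%classic : set I01) by exact: measurable_itv.
  have h := noninc01_measurable decr_rearr_le_mono.
  by apply: (proj1 (measurable_restrictT _ mI)); exact: h.
have [M [M0 hM]] := bdm_bound bF; exists M => t.
rewrite /rearr01 patchE; case: ifPn => [|_]; last by rewrite normr0.
by rewrite inE/= in_itv/= => /(decr_rearr_bound hM).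
Qed.

Let q_le c t : 0 < t < 1 -> rearr01 t <= c -> pr [set z | c < F z] <= t.
Proof.
move=> t01 qc; rewrite -lee_fin -prE//.
have : P [set z | c + n.+1%:R^-1 <= F z] @[n --> \oo] --> P (\bigcup_n [set z | c + n.+1%:R^-1 <= F z]).
  apply: nondecreasing_cvg_mu => //.
    by apply: bigcupT_measurable.
  move=> i j ij; apply/subsetPset => z /= h; apply: le_trans h.
  by rewrite lerD2l lef_pV2 ?posrE// ler_nat ltnS.
have -> : \bigcup_n [set z | c + n.+1%:R^-1 <= F z] = [set z | c < F z].
  apply/seteqP; split => z /= => [[n _ /=]|h].
    by apply: lt_le_trans; rewrite ltrDl invr_gt0.
  have h0 : 0 < F z - c by rewrite subr_gt0.
  exists (Num.truncn (F z - c)^-1) => //=; rewrite -lerBrDl -[leRHS]invrK lef_pV2 ?posrE ?invr_gt0//.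
  by apply/ltW/truncnS_gt.
move=> cv; rewrite -(cvg_lim _ cv)//; apply: lime_le; [by apply: cvgP cv|apply: nearW => n].
rewrite prE// lee_fin.
have [u Au ut] : exists2 u, A t u & u < c + n.+1%:R^-1.
  apply: inf_lt; first by have [] := A_inf t01.
  by rewrite -decr_rearrE -rearr01E// (le_lt_trans qc)// ltrDl invr_gt0.
apply: le_trans (ltW Au); apply: pr_le => // z /=.
by apply: le_trans; rewrite ltW.
Qed.

Let q_gt c t : 0 < t < 1 -> pr [set z | c < F z] < t -> rearr01 t <= c.
Proof.
move=> t01 pt; rewrite rearr01E// decr_rearrE; apply/ler_addgt0Pr => e e0.
apply: ge_inf; first by have [] := A_inf t01.
apply: le_lt_trans pt; apply: pr_le => // z /=.
by apply: lt_le_trans; rewrite ltrDl.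
Qed.

(** For p the measure of the set where c < F, the rearrangement exceeds c on ]0,
    p[ and nowhere on ]p, 1[. *)
Lemma rearr01_equimeas : equimeas L P rearr01 F.
Proof.
move=> c; rewrite prE//; set p := pr _.
have p0 : 0 <= p by exact: pr_ge0.
have p1 : p <= 1 by rewrite -pr_setT; apply: pr_le.
have mq : measurable [set t | c < rearr01 t].
  rewrite (_ : [set t | c < rearr01 t] = rearr01 @^-1` `]c, +oo[%classic).
    by rewrite -[X in measurable X]setTI; apply: (bdm_meas rearr01_bdm).
  by apply/seteqP; split => z /=; rewrite in_itv/= andbT.
apply/eqP; rewrite eq_le; apply/andP; split.
  rewrite lebesgue01E; apply: (@le_trans _ _ (@lebesgue_measure R (`[0, p]%classic `|` [set 1]))).
    apply: le_measure; rewrite ?inE.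
    - by apply: measurableI.
    - exact: measurableU.
    - move=> t /= [cq]; rewrite in_itv/= => /andP[t0 t1].
      move: t1; rewrite le_eqVlt => /predU1P[->|t1]; [by right|left].
      move: t0; rewrite le_eqVlt => /predU1P[<-|t0]; first by rewrite /= in_itv/= lexx.
      rewrite /= in_itv/= ltW//= leNgt; apply/negP => pt.
      have t01 : 0 < t < 1 by rewrite t0.
      by have := lt_le_trans cq (q_gt t01 pt); rewrite ltxx.
  apply: (@le_trans _ _ (@lebesgue_measure R `[0%R, p]%classic + @lebesgue_measure R [set 1%R])%E).
    exact: measureU2.
  rewrite lebesgue_measure_set1 adde0 lebesgue_measure_itv/= lte_fin.
  by case: ifP => _; rewrite ?oppr0 ?adde0// lee_fin.
apply: (@le_trans _ _ (@lebesgue_measure R `]0, p[%classic)).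
  rewrite lebesgue_measure_itv/= lte_fin; case: ltP => h; first by rewrite oppr0 adde0.
  by rewrite lee_fin.
rewrite lebesgue01E; apply: le_measure; rewrite ?inE//; first exact: measurableI.
move=> t /=; rewrite in_itv/= => /andP[t0 tp].
have t1 : t < 1 by apply: lt_le_trans tp p1.
have t01 : 0 < t < 1 by rewrite t0.
split; last by rewrite in_itv/= !ltW.
rewrite ltNge; apply/negP => qc.
by have := lt_le_trans tp (q_le t01 qc); rewrite ltxx.
Qed.
End rearrangement.

(** * Modulus of continuity on the sphere *)

Section continuous_on_plane.
Variable R : realType.
Implicit Types (F : R * R -> R) (z w : R * R).

Lemma continuous_plane F z e : continuous F -> 0 < e ->
  exists2 d, 0 < d & forall w, `|z.1 - w.1| < d -> `|z.2 - w.2| < d -> `|F z - F w| < e.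
Proof.
move=> cF e0; have /cvgrPdist_lt /(_ e e0) := cF z.
move=> /nbhs_ballP[d /= d0 H]; exists d => // w h1 h2; apply: H.
by split; rewrite /ball/= /ball_.
Qed.

Definition box (B : R) : set (R * R) := `[- B, B]%classic `*` `[- B, B]%classic.

Lemma box_compact B : compact (box B).
Proof. by apply: compact_setX; exact: segment_compact. Qed.

Lemma boxP B z : 0 <= B -> z.1 ^+ 2 + z.2 ^+ 2 <= B ^+ 2 -> box B z.
Proof.
move=> B0 h; split; rewrite /= in_itv/= -ler_norml -ler_sqr ?nnegrE// real_normK ?num_real//;
 by apply: le_trans h; rewrite ?lerDl ?lerDr sqr_ge0.
Qed.

Lemma continuous_box_bounded F B : continuous F -> exists M, forall z, box B z -> `|F z| <= M.
Proof.
move=> cF; have := box_compact (B:=B); rewrite compact_near_coveringP.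
move=> /(_ _ (+oo)%R (fun M z => `|F z| <= M) _) /= H.
have : \forall M \near +oo, box B `<=` [set z | `|F z| <= M].
  apply: H => z _; have [d d0 hd] := continuous_plane (F:=F) z cF (ltr01 (R:=R)).
  exists ([set w | `|z.1 - w.1| < d /\ `|z.2 - w.2| < d], [set M | `|F z| + 1 < M]).
    split => /=; last by exists (`|F z| + 1); split; rewrite ?num_real.
    by apply/nbhs_ballP; exists d => //= w [/= h1 h2].
  move=> [w M] /= [[h1 h2] hM].
  have := hd w h1 h2; have := ler_dist_dist (F w) (F z); rewrite distrC => h3 h4.
  have := le_lt_trans h3 h4; rewrite ltr_norml => /andP[_]; rewrite ltrBlDl => h5.
  by apply/ltW/(lt_trans h5).
move=> [M [_ h]]; exists (M + 1) => z Bz; apply: (h (M + 1)) => //; by rewrite ltrDl.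
Qed.

(** Heine's theorem, from the near-covering form of compactness. *)
Lemma continuous_box_uniform F B e (cF : continuous F) (e0 : 0 < e) :
  exists2 d, 0 < d & forall z w, box B z ->
    `|z.1 - w.1| < d -> `|z.2 - w.2| < d -> `|F z - F w| < e.
Proof.
have := box_compact (B:=B); rewrite compact_near_coveringP.
move=> /(_ _ (0^'+)%R (fun d z => forall w, `|z.1 - w.1| < d -> `|z.2 - w.2| < d -> `|F z - F w| < e) _) /= H.
have : \forall d \near 0^'+, box B `<=` [set z | forall w, `|z.1 - w.1| < d -> `|z.2 - w.2| < d -> `|F z - F w| < e].
  apply: H => z _; have e20 : 0 < e / 2 by rewrite divr_gt0.
  have [d d0 hd] := continuous_plane (F:=F) z cF e20.
  have d20 : 0 < d / 2 by rewrite divr_gt0.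
  exists ([set w | `|z.1 - w.1| < d / 2 /\ `|z.2 - w.2| < d / 2], [set d' | d' < d / 2]).
    split => /=; last exact: nbhs_right_lt.
    by apply/nbhs_ballP; exists (d / 2) => //= w [/= h1 h2].
  move=> [w d'] /= [[h1 h2] hd'] v hv1 hv2.
  have hw : `|F z - F w| < e / 2.
    by apply: hd; [apply: lt_trans h1 _|apply: lt_trans h2 _]; rewrite ltr_pdivrMr// ltr_pMr// ltr1n.
  have hv : `|F z - F v| < e / 2.
    apply: hd; rewrite (splitr d).
      rewrite (_ : z.1 - v.1 = (z.1 - w.1) + (w.1 - v.1)); last by ring.
      by rewrite (le_lt_trans (ler_normD _ _))// ltrD// (lt_trans hv1).
    rewrite (_ : z.2 - v.2 = (z.2 - w.2) + (w.2 - v.2)); last by ring.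
    by rewrite (le_lt_trans (ler_normD _ _))// ltrD// (lt_trans hv2).
  rewrite (_ : F w - F v = (F z - F v) - (F z - F w)); last by ring.
  by rewrite (le_lt_trans (ler_normB _ _))// [ltRHS]splitr ltrD.
move=> [d /= d0 h]; exists (d / 2); first by rewrite divr_gt0.
move=> z w Bz; apply: h => //=; last by rewrite divr_gt0.
by rewrite sub0r normrN gtr0_norm ?divr_gt0// ltr_pdivrMr// ltr_pMr// ltr1n.
Qed.

(** Away from the diagonal the overlap is bounded away from 1 on bounded sets.
    *)
Lemma overlap_separated (z w : plane R) d : 0 < d -> ~ (`|z.1 - w.1| < d /\ `|z.2 - w.2| < d) ->
  d ^+ 2 <= (1 - overlap z w) * (rho z * rho w).
Proof.
move=> d0 h; rewrite onem_overlapE.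
have rz : rho z != 0 by rewrite gt_eqF// (lt_le_trans ltr01)// r2_ge1.
have rw : rho w != 0 by rewrite gt_eqF// (lt_le_trans ltr01)// r2_ge1.
have -> : ((z.1 - w.1) ^+ 2 + (z.2 - w.2) ^+ 2) * ((rho z)^-1 / rho w) * (rho z * rho w) =
  (z.1 - w.1) ^+ 2 + (z.2 - w.2) ^+ 2 by field; rewrite rz rw.
have dd x : d <= `|x| -> d ^+ 2 <= x ^+ 2.
  by move=> h1; rewrite -(real_normK (num_real x)) ler_sqr// nnegrE// ltW.
have [h1|h1] := ltP `|z.1 - w.1| d; last first.
  by rewrite (le_trans (dd _ h1))// lerDl sqr_ge0.
have [h2|h2] := ltP `|z.2 - w.2| d; first by case: h.
by rewrite (le_trans (dd _ h2))// lerDr sqr_ge0.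
Qed.

(** Near the diagonal uniform continuity gives e; elsewhere 1 - overlap is
    bounded below and a large C absorbs the oscillation of F. *)
Lemma box_modulus F B M e : continuous F -> (forall z, box B z -> `|F z| <= M) -> 0 < e ->
  exists2 C, 0 <= C & forall z w, box B z -> box B w ->
    (F z - F w) ^+ 2 <= e + C * (1 - overlap z w).
Proof.
move=> cF FM e0; have se0 : 0 < Num.sqrt e by rewrite sqrtr_gt0.
have [d d0 hd] := continuous_box_uniform B cF se0.
pose r := 1 + B ^+ 2 + B ^+ 2; have r0 : 0 <= r by rewrite !addr_ge0 ?sqr_ge0.
exists ((2 * M) ^+ 2 * (r * r / d ^+ 2)) => [|z w Bz Bw].
  by rewrite mulr_ge0 ?sqr_ge0// divr_ge0 ?sqr_ge0// mulr_ge0.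
have K0 : 0 <= 1 - overlap z w by rewrite subr_ge0 overlap_le1.
have rB x : box B x -> rho x <= r.
  have sq y : y \in `[- B, B] -> y ^+ 2 <= B ^+ 2.
    rewrite in_itv/= -ler_norml => h; rewrite -(real_normK (num_real y)) ler_sqr ?nnegrE//.
    by rewrite (le_trans _ h).
  by case=> h1 h2; rewrite lerD// ?sq// lerD2l sq.
have [[h1 h2]|h] := pselect (`|z.1 - w.1| < d /\ `|z.2 - w.2| < d).
  rewrite -[leLHS]addr0 lerD//.
    by rewrite -(sqr_sqrtr (ltW e0)) -(real_normK (num_real (_ - _))) ler_sqr ?nnegrE// ltW// hd.
  by rewrite mulr_ge0// mulr_ge0 ?sqr_ge0// divr_ge0 ?sqr_ge0// mulr_ge0.
rewrite -[leLHS]add0r lerD// ?(ltW e0)//.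
have FF : (F z - F w) ^+ 2 <= (2 * M) ^+ 2.
  rewrite -(real_normK (num_real (_ - _))) ler_sqr ?nnegrE//.
    by rewrite (le_trans (ler_normB _ _))// mulr2n mulrDl mul1r lerD// FM.
  by rewrite mulr_ge0// (le_trans _ (FM z Bz)).
apply: le_trans FF _; rewrite -mulrA ler_peMr ?sqr_ge0//.
rewrite mulrAC ler_pdivlMr ?exprn_gt0// mul1r.
apply: le_trans (overlap_separated d0 h) _; rewrite mulrC ler_wpM2r//.
have rp x : 0 <= rho x by rewrite (le_trans ler01)// r2_ge1.
by apply: ler_pM; rewrite ?rp//; exact: rB.
Qed.

(** A superlevel set of F is open, hence a countable union of open boxes with
    rational corners. *)
Lemma continuous_plane_measurable F : continuous F ->
  measurable_fun setT (F : plane R -> R).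
Proof.
move=> cF.
have mR (c : R) :
   measurable (\bigcup_(k in [set k : (rat * rat) * (rat * rat) | forall z : R * R,
     (ratr k.1.1 < z.1 < ratr k.1.2) && (ratr k.2.1 < z.2 < ratr k.2.2) -> c < F z])
      (`]ratr k.1.1, ratr k.1.2[%classic `*` `]ratr k.2.1, ratr k.2.2[%classic : set (plane R))).
  rewrite bigcup_mkcond; apply: countable_bigcupT_measurable; first exact: countableP.
  by move=> k; case: ifPn => // _; apply: measurableX; exact: measurable_itv.
apply: (measurability (@RGenOInfty.G R)) => [|/= _ [_] [c] -> <-].
  exact: RGenOInfty.measurableE.
rewrite setTI; have := mR c; congr measurable.
apply/seteqP; split => z /=; rewrite in_itv/= andbT.
  by case=> k /= hk [/=]; rewrite !in_itv/= => h1 h2; apply: hk; rewrite h1 h2.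
rewrite -subr_gt0 => h; have [d d0 hd] := continuous_plane z cF h.
have R2 x : exists k : rat * rat, (ratr k.1 < x < ratr k.2) /\
    forall y : R, ratr k.1 < y < ratr k.2 -> `|x - y| < d.
  have xd : x - d < x by rewrite ltrBlDr ltrDl.
  have dx : x < x + d by rewrite ltrDl.
  have [a] := rat_in_itvoo xd; have [b] := rat_in_itvoo dx.
  rewrite !in_itv/= => /andP[b1 b2] /andP[a1 a2].
  exists (a, b); rewrite /= b1 a2; split=> // y /andP[y1 y2].
  by rewrite ltr_distlC (lt_trans a1 y1) (lt_trans y2 b2).
have [k1 [h1 g1]] := R2 z.1; have [k2 [h2 g2]] := R2 z.2.
exists (k1, k2); last by split; rewrite /= in_itv/=.
move=> w /= /andP[/g1 w1 /g2 w2]; have := hd w w1 w2.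
by rewrite ltr_norml => /andP[_]; rewrite ltrD2l ltrN2.
Qed.
End continuous_on_plane.

Section sphere_modulus.
Variable R : realType.
Implicit Types z w : R * R.

Lemma chart01 (w w' : R[i]) : w * w' = 1 -> chart0 w = chart1 w'.
Proof.
move=> ww; apply: val_inj => /=.
have w0 : w != 0 by apply/eqP => w0; move/eqP: ww; rewrite w0 mul0r eq_sym oner_eq0.
have e : hvec 1 w = w *: hvec w' 1.
  by apply/rowP => j; rewrite !mxE; case: ifP => _; rewrite ?ww ?mulr1.
apply/eqP; rewrite eqEsubv -!memvE e memvZ ?memv_line//=.
by rewrite -[X in X \in _]scale1r -(mulVf w0) -scalerA memvZ ?memv_line.
Qed.

Definition sqn z := z.1 ^+ 2 + z.2 ^+ 2.
Definition inv2 z : R * R := (z.1 / sqn z, - z.2 / sqn z).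

Lemma chart0_inv2 z : sqn z != 0 -> chart0 (xy z) = chart1 (xy (inv2 z)).
Proof.
rewrite /sqn => z0; apply: chart01; rewrite /xy/inv2/sqn/=; apply/eqP.
by rewrite eq_complex/=; apply/andP; split; apply/eqP; field.
Qed.

Lemma sqn_inv2 z : sqn z != 0 -> sqn (inv2 z) = (sqn z)^-1.
Proof. by rewrite /inv2 /sqn/= => z0; field. Qed.

(** Inversion is an isometry of the sphere. *)
Lemma overlap_inv2 z w : sqn z != 0 -> sqn w != 0 -> overlap (inv2 z) (inv2 w) = overlap z w.
Proof.
move=> z0 w0; apply: (can_inj (subKr 1)); rewrite !onem_overlapE.
have rz : rho z != 0 by rewrite gt_eqF// (lt_le_trans ltr01)// r2_ge1.
have rw : rho w != 0 by rewrite gt_eqF// (lt_le_trans ltr01)// r2_ge1.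
have r_inv x : sqn x != 0 -> rho (inv2 x) = rho x / sqn x.
  by move=> x0; rewrite /rho -addrA -/(sqn _) sqn_inv2// -[1 + _ + _]addrA -/(sqn _) mulrDl mul1r divff// addrC.
rewrite !r_inv//; move: z0 w0 rz rw; rewrite /inv2/sqn/= => z0 w0 rz rw.
by field; rewrite z0 w0 rz rw.
Qed.

(** A point with |z| <= 1/2 and a point with |w| >= 2 are at a definite distance
    on the sphere. *)
Lemma overlap_far z w : sqn z <= 4^-1 -> 4 <= sqn w -> 7 / 25 <= 1 - overlap z w.
Proof.
move=> hz hw; rewrite onem_overlapE.
have rE x : rho x = 1 + sqn x by rewrite /rho /sqn addrA.
have s0 x : 0 <= sqn x by rewrite addr_ge0 ?sqr_ge0.
have rz0 : 0 < rho z by rewrite (lt_le_trans ltr01)// r2_ge1.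
have rw0 : 0 < rho w by rewrite (lt_le_trans ltr01)// r2_ge1.
rewrite -invfM ler_pdivlMr ?mulr_gt0//.
apply: (@le_trans _ _ (sqn w / 2 - sqn z)); last first.
  rewrite /sqn; have := sqr_ge0 (z.1 - w.1 / 2); have := sqr_ge0 (z.2 - w.2 / 2); nra.
have h1 : rho z <= 5 / 4 by rewrite rE; lra.
have h2 : rho w <= 5 / 4 * sqn w by rewrite rE; lra.
have := ler_pM (ltW rz0) (ltW rw0) h1 h2; lra.
Qed.

Lemma overlapC z w : overlap z w = overlap w z.
Proof. by rewrite /overlap; congr (_ * _); [ring|rewrite mulrC]. Qed.

Variable f : CP1 R -> R.
Hypothesis sf : smooth_CP1 f.
Let F z := f (chart0 (xy z)).
Let G z := f (chart1 (xy z)).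
Let cF : continuous F. Proof. by have [] := sf 0. Qed.
Let cG : continuous G. Proof. by have [] := sf 0. Qed.

Let FG z : sqn z != 0 -> F z = G (inv2 z).
Proof. by move=> z0; rewrite /F chart0_inv2. Qed.

Let box2 z : sqn z <= 4 -> box 2 z.
Proof. by move=> h; apply: boxP => //; rewrite (le_trans h)// -natrX. Qed.

Let box2_inv z : 4^-1 <= sqn z -> box 2 (inv2 z) /\ sqn z != 0.
Proof.
move=> h; have z0 : 0 < sqn z by apply: lt_le_trans h; rewrite invr_gt0.
split; last by rewrite gt_eqF.
by apply: box2; rewrite sqn_inv2 ?gt_eqF// -[leRHS]invrK lef_pV2// posrE invr_gt0.
Qed.

Lemma sphere_bounded : exists M, forall z, `|F z| <= M.
Proof.
have [M1 h1] := continuous_box_bounded 2 cF; have [M2 h2] := continuous_box_bounded 2 cG.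
exists (Num.max M1 M2) => z; rewrite le_max; have [h|h] := leP (sqn z) 4.
  by rewrite h1//; exact: box2.
have [b z0] := box2_inv (z:=z) (ltac:(lra)); by rewrite FG// h2 ?orbT.
Qed.

Lemma smooth_bdm : bdm (f \o @chart0 R \o @xy R : plane R -> R).
Proof. by split; [exact: continuous_plane_measurable|exact: sphere_bounded]. Qed.

(** Two points with |z| <= 2 are compared in the chart [1, w], two points with
    |z| >= 1/2 in the other one, and in the remaining case the points are far
    apart. *)
Lemma sphere_modulus eps : 0 < eps ->
  exists2 C, 0 <= C & forall z w, (F z - F w) ^+ 2 <= eps + C * (1 - overlap z w).
Proof.
move=> e0; have [M hM] := sphere_bounded.
have [C1 C10 h1] := box_modulus (B:=2) cF (fun z _ => hM z) e0.
have [M2 hM2] := continuous_box_bounded 2 cG.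
have [C2 C20 h2] := box_modulus cG hM2 e0.
pose C3 := (2 * M) ^+ 2 * (25 / 7).
have C30 : 0 <= C3 by rewrite mulr_ge0 ?sqr_ge0.
(* The constant 25/7 is the inverse of the bound of overlap_far. *)
have far z w : sqn z <= 4^-1 -> 4 <= sqn w -> (F z - F w) ^+ 2 <= C3 * (1 - overlap z w).
  move=> hz hw; apply: (@le_trans _ _ ((2 * M) ^+ 2)).
    rewrite -(real_normK (num_real (_ - _))) ler_sqr ?nnegrE//.
      by rewrite (le_trans (ler_normB _ _))// mulr2n mulrDl mul1r lerD// hM.
    by rewrite mulr_ge0// (le_trans _ (hM z)).
  by rewrite -mulrA ler_peMr ?sqr_ge0//; have := overlap_far hz hw; lra.
exists (C1 + C2 + C3) => [|z w]; first by rewrite !addr_ge0.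
have K0 : 0 <= 1 - overlap z w by rewrite subr_ge0 overlap_le1.
have up C : 0 <= C -> C <= C1 + C2 + C3 -> (F z - F w) ^+ 2 <= eps + C * (1 - overlap z w) ->
    (F z - F w) ^+ 2 <= eps + (C1 + C2 + C3) * (1 - overlap z w).
  by move=> _ CC /le_trans; apply; rewrite lerD2l ler_wpM2r.
have inn : 4^-1 <= sqn z -> 4^-1 <= sqn w -> (F z - F w) ^+ 2 <= eps + C2 * (1 - overlap z w).
  move=> hz hw; have [bz z0] := box2_inv hz; have [bw w0] := box2_inv hw.
  by rewrite !FG// -(overlap_inv2 z0 w0); exact: h2.
have [hz|hz] := leP (sqn z) 4.
  have [hw|hw] := leP (sqn w) 4.
    by apply: (up C1) => //; [lra|apply: h1; exact: box2].
  have [hz'|hz'] := leP (sqn z) 4^-1.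
    by apply: (up C3) => //; [lra|have := far _ _ hz' (ltW hw); lra].
  by apply: (up C2) => //; [lra|apply: inn; lra].
have [hw|hw] := leP (sqn w) 4^-1.
  apply: (up C3) => //; [lra|have := far _ _ hw (ltW hz)].
  by rewrite -(opprB (F z)) sqrrN (overlapC w); lra.
by apply: (up C2) => //; [lra|apply: inn; lra].
Qed.
End sphere_modulus.

(** * Classes of bounded functions in L2 *)

Section L2_inner_product.
Variable R : realType.
Notation I01 := (measurableTypeR R).
Notation L := (lebesgue01 R).

Definition L2fun (g : L2I R) : I01 -> R := (g : LspaceType2 L).

Lemma L2fun_Lfun g : L2fun g \in Lfun L 2%:E.
Proof. exact: (LfunP (Lspace_repr (g : LspaceType2 L))). Qed.

Lemma L2fun_measurable g : measurable_fun setT (L2fun g).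
Proof. by have := L2fun_Lfun g; rewrite inE => /andP[]; rewrite inE. Qed.

Lemma L2fun_inj g h : ae_eq L setT (L2fun g) (L2fun h) -> g = h.
Proof. exact: Lspace_eqP. Qed.

Lemma L2funD g h : ae_eq L setT (L2fun (g + h)) (L2fun g \+ L2fun h).
Proof. exact: LspaceDE. Qed.

Lemma L2funZ (a : R) g : ae_eq L setT (L2fun (a *: g)) (fun x => a * L2fun g x).
Proof. exact: LspaceZE. Qed.

Lemma L2funB g h : ae_eq L setT (L2fun (g - h)) (L2fun g \- L2fun h).
Proof.
rewrite -scaleN1r; near=> x => _.
by rewrite (near (L2funD g (-1 *: h)) x)//= (near (L2funZ (-1) h) x)//= mulN1r.
Unshelve. all: by end_near. Qed.

Lemma ae_Rintegral (h1 h2 : I01 -> R) : measurable_fun setT h1 -> measurable_fun setT h2 ->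
  ae_eq L setT h1 h2 -> \int[L]_x h1 x = \int[L]_x h2 x.
Proof.
move=> m1 m2 h; rewrite /Rintegral; congr fine; apply: ae_eq_integral => //.
- exact/measurable_EFinP.
- exact/measurable_EFinP.
- by apply: filterS h => x /(_ I) -> _.
Qed.

Definition dotL2 (g u : L2I R) : R := \int[L]_x (L2fun g x * L2fun u x).

Lemma dotL2_integrable g u : L.-integrable setT (EFin \o (L2fun g \* L2fun u)).
Proof. by apply/Lfun1_integrable; apply: Lfun2_mul_Lfun1; exact: L2fun_Lfun. Qed.

Lemma dotL2C g u : dotL2 g u = dotL2 u g.
Proof. by rewrite /dotL2; congr Rintegral; apply/funext => x; rewrite mulrC. Qed.

Let mM g u : measurable_fun setT (fun x => L2fun g x * L2fun u x).
Proof. by apply: measurable_funM; exact: L2fun_measurable. Qed.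

Lemma dotL2Dl g h u : dotL2 (g + h) u = dotL2 g u + dotL2 h u.
Proof.
rewrite /dotL2 -RintegralD//; [|exact: dotL2_integrable|exact: dotL2_integrable].
apply: ae_Rintegral => //; first by apply: measurable_funD.
by near=> x => _; rewrite (near (L2funD g h) x)//= mulrDl.
Unshelve. all: by end_near. Qed.

Lemma dotL2Zl (a : R) g u : dotL2 (a *: g) u = a * dotL2 g u.
Proof.
rewrite /dotL2 -RintegralZl//; last exact: dotL2_integrable.
apply: ae_Rintegral => //; first by apply: measurable_funM.
by near=> x => _; rewrite (near (L2funZ a g) x)//= mulrA.
Unshelve. all: by end_near. Qed.

Lemma dotL2_norm g : dotL2 g g = `|g| ^+ 2.
Proof.
rewrite Lspace_normE -/(L2fun g).
have two0 : 2 != 0 :> R by rewrite pnatr_eq0.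
have h := poweR_Lnorm L (EFin \o L2fun g) two0.
have /fineK e : ('N[L]_2%:E[EFin \o L2fun g] \is a fin_num)%E.
  by rewrite ge0_fin_numE ?Lnorm_ge0//; exact: Lebesgue_finite.
rewrite /dotL2 /Rintegral -[RHS]/(fine (_%:E)); congr fine.
rewrite -powR_mulrn ?fine_ge0 ?Lnorm_ge0// -poweR_EFin e h.
by apply: eq_integral => x _; rewrite /= powR_mulrn// real_normK ?num_real// expr2.
Qed.

Lemma bdm_Lfun (h : I01 -> R) : bdm h -> h \in Lfun L 2%:E.
Proof.
move=> bh; rewrite inE; apply/andP; split; rewrite inE/=; first exact: bdm_meas bh.
rewrite /finite_norm unlock poweR_lty//=.
under eq_integral => x _ do rewrite powR_mulrn// real_normK ?num_real//.
have /integrable_lty := bdm_integrable (lebesgue01_setT R) (bdmX 2 bh); exact.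
Qed.

(** The class is chosen by xget; it exists because h is square-integrable. *)
Lemma L2_classE (h : I01 -> R) : bdm h -> ae_eq L setT (L2fun (L2_class h)) h.
Proof.
move=> bh; rewrite /L2_class; case: xgetP => [g _ //|].
move=> /(_ (Lspace_class (Lfun_Sub (lee1n 2) (bdm_Lfun bh)))) []/=.
exact: (Lspace_classE (Lfun_Sub (lee1n 2) (bdm_Lfun bh))).
Qed.

Lemma L2_class_ext (h1 h2 : R -> R) : ae_eq L setT h1 h2 -> L2_class h1 = L2_class h2.
Proof.
move=> h12; congr xget; apply/seteqP; split => g /= gh.
  exact: ae_eq_trans gh h12.
by apply: ae_eq_trans gh _; exact: ae_eq_sym.
Qed.

Lemma L2_class_comb (a b : R) (h1 h2 : I01 -> R) : bdm h1 -> bdm h2 ->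
  L2_class (fun t => a * h1 t + b * h2 t) = a *: L2_class h1 + b *: L2_class h2.
Proof.
move=> b1 b2; apply: L2fun_inj.
have b3 : bdm (fun t => a * h1 t + b * h2 t).
  by apply: bdmD; apply: bdmM => //; exact: bdm_cst.
near=> x => _; rewrite (near (L2_classE b3) x)//.
rewrite (near (L2funD (a *: L2_class h1) (b *: L2_class h2)) x)//=.
rewrite (near (L2funZ a (L2_class h1)) x)// (near (L2funZ b (L2_class h2)) x)//.
by rewrite (near (L2_classE b1) x)// (near (L2_classE b2) x).
Unshelve. all: by end_near. Qed.

Lemma L2_class_dist (h1 h2 : I01 -> R) : bdm h1 -> bdm h2 ->
  `|L2_class h1 - L2_class h2| ^+ 2 = Ex L (fun t => (h1 t - h2 t) ^+ 2).
Proof.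
move=> b1 b2; rewrite -dotL2_norm; apply: ae_Rintegral => //.
  by have := bdmX 2 (bdmB b1 b2) => /bdm_meas.
near=> x => _; rewrite -expr2 (near (L2funB (L2_class h1) (L2_class h2)) x)//=.
by rewrite (near (L2_classE b1) x)// (near (L2_classE b2) x).
Unshelve. all: by end_near. Qed.

Lemma L2_class_norm (h : I01 -> R) : bdm h ->
  `|L2_class h| ^+ 2 = Ex L (fun t => h t ^+ 2).
Proof.
move=> b; rewrite -dotL2_norm; apply: ae_Rintegral => //.
  by have := bdmX 2 b => /bdm_meas.
near=> x => _; by rewrite -expr2 (near (L2_classE b) x).
Unshelve. all: by end_near. Qed.

Lemma step_funE m (a : 'rV[R]_m.+1) : step_fun a = L2_class (steps (a 0)).
Proof. by []. Qed.

Lemma step_fun_comb m (u v : R) (a b : 'rV[R]_m.+1) :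
  step_fun (u *: a + v *: b) = u *: step_fun a + v *: step_fun b.
Proof.
rewrite !step_funE -L2_class_comb; [|exact: steps_bdm|exact: steps_bdm].
congr (L2_class _); apply/funext => t; rewrite /steps !mulr_sumr -big_split/=.
by apply: eq_bigr => k _; rewrite !mxE; ring.
Qed.

End L2_inner_product.

(** * Convergence of sorted eigenvalues, orbits and step approximations *)

Section szego.
Variable R : realType.
Notation I01 := (measurableTypeR R).
Notation L := (lebesgue01 R).

Lemma sorting_perm n (a : 'I_n -> R) :
  exists s : 'S_n, forall i j : 'I_n, (i <= j)%N -> a (s j) <= a (s i).
Proof.
pose t := [tuple a i | i < n]; pose le := fun x y : R => y <= x.
have tot : total le by move=> x y; rewrite /le le_total.
have [s es] : exists s : 'S_n, sort le t = [tuple tnth t (s i) | i < n].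
  by apply/tuple_permP; rewrite perm_sort.
exists s => i j ij.
have := sort_sorted tot t; rewrite es => st.
have letr : transitive le by move=> y x z; rewrite /le => h1 h2; exact: le_trans h2 h1.
have lerf : reflexive le by move=> x; rewrite /le.
have := sorted_leq_nth letr lerf 0 st.
move=> /(_ i j); rewrite !inE !size_tuple !ltn_ord => /(_ isT isT ij).
by rewrite -!tnth_nth !tnth_mktuple.
Qed.

Variable f : CP1 R -> R.
Hypothesis sf : smooth_CP1 f.

(** The Szego-type limit theorem in the form needed here: sorted eigenvalues,
    seen as a step function, converge to the rearrangement of f. The coupling
    inequality with the weights of the spectrum bounds the squared distance by
    E[F^2] - (sum of the squared eigenvalues) / (m + 1), which is half the
    double integral of Ex_variance. *)
Lemma szego_rearrangement eps : 0 < eps -> exists m0, forall m, (m0 <= m)%N ->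
  exists s : 'S_m.+1, let a := fun j => toeplitz_eigenvalues m f 0 (s j) in
    (forall i j : 'I_m.+1, (i <= j)%N -> a j <= a i) /\
    Ex L (fun t => (steps a t - rearr01 f t) ^+ 2) <= eps.
Proof.
move=> e0; have bF := smooth_bdm sf.
have [C C0 hC] := sphere_modulus sf e0.
(* For m >= m0 one has C / (m + 2) <= eps, and the bound is half of the sum. *)
pose m0 := Num.truncn (C / eps); exists m0 => m m0m.
set l := toeplitz_eigenvalues m f; have [s as_] := sorting_perm (l 0).
exists s; split=> //=; set a := (fun j => l 0 (s j)).
have [p [[bp p0 p1 Ep EFp] tr]] := toeplitz_spectrum m bF.
pose p' j := p (s j).
have p'1 x : \sum_j p' j x = 1 by rewrite -[RHS](p1 x) [RHS](reindex_inj (@perm_inj _ s)).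
have p'le x : \sum_j p' j x <= 1 by rewrite p'1.
have bp' j : bdm (p' j) by exact: bp.
have Ep' j : Ex (FSP R) (p' j) = m.+1%:R^-1 by exact: Ep.
have p'0 j x : 0 <= p' j x by exact: p0.
have mono := @rearr01_mono R f bF.
have := coupling (FSP_setT R) bF (rearr01_bdm bF) (rearr01_equimeas bF) mono as_ bp' p'0 p'le Ep'.
move=> /le_trans; apply.
rewrite (cost_expand (FSP_setT R) bp' p'le Ep' a bF).
have := Ex_variance m bF hC; rewrite -tr -/l.
set A := Ex _ _; set S := \sum_j l 0 j ^+ 2.
have -> : \sum_j a j ^+ 2 = S by rewrite /S [RHS](reindex_inj (@perm_inj _ s)).
have -> : \sum_j a j * Ex (FSP R) (fun x => (f \o @chart0 R \o @xy R) x * p' j x) = m.+1%:R^-1 * S.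
  rewrite mulr_sumr [RHS](reindex_inj (@perm_inj _ s)); apply: eq_bigr => j _.
  by rewrite EFp -/l /a expr2 mulrCA.
have : C / m.+2%:R <= eps.
  rewrite ler_pdivrMr// -ler_pdivrMl// mulrC; apply/ltW.
  apply: lt_le_trans (truncnS_gt _) _; rewrite ler_nat; exact: leq_trans m0m _.
by move: (m.+1%:R^-1 * S) (C / m.+2%:R) => u v h1 h2; lra.
Qed.
End szego.

Section orbit.
Variable R : realType.
Notation I01 := (measurableTypeR R).
Notation L := (lebesgue01 R).
(** Elements of Smeas are arbitrary outside [0, 1], where the composite is
    replaced by 0. *)
Definition precomp01 (u : I01 -> R) (phi : R -> R) : I01 -> R :=
  (u \o phi) \_ (`[0, 1]%classic : set R).

Lemma precomp01_bdm u phi : bdm u -> Smeas phi -> bdm (precomp01 u phi).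
Proof.
move=> bu [mphi _ _]; split.
  have mI : measurable (`[0, 1]%classic : set I01) by exact: measurable_itv.
  have mu : measurable_fun setT (u : R -> R) := bdm_meas bu.
  have h : measurable_fun (`[0, 1]%classic : set R) (u \o phi).
    exact: measurableT_comp mu mphi.
  by apply: (proj1 (measurable_restrictT _ mI)); exact: h.
have [M [M0 hM]] := bdm_bound bu; exists M => t.
by rewrite /precomp01 patchE; case: ifPn => [_|_]; rewrite ?normr0//=.
Qed.

Lemma precomp01_equimeas u phi : bdm u -> Smeas phi -> equimeas L L u (precomp01 u phi).
Proof.
move=> bu [mphi phi01 pres] c; rewrite !lebesgue01E.
set A := [set x | c < u x] `&` `[0, 1]%classic.
have mu : measurable_fun setT (u : R -> R) := bdm_meas bu.
have mA : measurable A.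
  apply: measurableI => //.
  have -> : [set x | c < u x] = u @^-1` `]c, +oo[%classic.
    by apply/seteqP; split => x /=; rewrite in_itv/= andbT.
  by rewrite -[X in measurable X]setTI; apply: mu.
rewrite -(pres A mA); last by move=> x [].
congr (lebesgue_measure _); apply/seteqP; split => x /= [].
  by move=> x01 [h _]; split=> //; rewrite /precomp01 patchE mem_set.
move=> h x01; split=> //; move: h; rewrite /precomp01 patchE mem_set//= => h; split=> //.
by have := phi01 x; rewrite !in_itv/= in x01 * => /(_ x01).
Qed.

Lemma Ex_precomp01 u phi : bdm u -> Smeas phi -> Ex L (precomp01 u phi) = Ex L u.
Proof.
move=> bu sphi; have L1 := lebesgue01_setT R; have bp := precomp01_bdm bu sphi.
by apply/esym; exact: (equimeas_Ex L1 L1 bu bp (phi := id) (precomp01_equimeas bu sphi)).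
Qed.

(** A measure preserving map takes the values 0 and 1 only on a null set. *)
Lemma orbit_class (f : CP1 R -> R) phi : Smeas phi -> L2_class (decr_rearr f \o phi) = L2_class (precomp01 (rearr01 f) phi).
Proof.
move=> [mphi phi01 pres]; apply: L2_class_ext.
pose B : set R := [set 0; 1].
have mB : measurable B by apply: measurableU.
exists (~` `[0, 1]%classic `|` (`[0, 1]%classic `&` phi @^-1` B)); split.
- apply: measurableU; first by apply: measurableC.
  exact: mphi.
- rewrite lebesgue01E; apply/eqP; rewrite eq_le measure_ge0 andbT.
  have <- : @lebesgue_measure R B = 0%E.
    apply/eqP; rewrite eq_le measure_ge0 andbT.
    apply: (@le_trans _ _ (@lebesgue_measure R [set 0%R] + @lebesgue_measure R [set 1%R])%E).
      exact: measureU2.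
    by rewrite !lebesgue_measure_set1 adde0.
  rewrite -(pres B mB).
    apply: le_measure; rewrite ?inE.
    + apply: measurableI => //; apply: measurableU; first by apply: measurableC.
      exact: mphi.
    + exact: mphi.
    + by move=> x [[|//]] .
  by move=> x [] ->; rewrite /= in_itv/= lexx ler01.
- move=> x /= /not_implyP[_ h]; have [x01|] := pselect (`[0, 1]%classic x); last by left.
  right; split=> //; apply: contrapT => nB; apply: h.
  rewrite /precomp01 patchE mem_set//= rearr01E//.
  have := phi01 x; rewrite !in_itv/= in x01 * => /(_ x01) /andP[p0 p1].
  rewrite !lt_neqAle p0 p1 !andbT; apply/andP; split; apply/eqP => e; apply: nB.
    by left.
  by right.
Qed.
End orbit.
Section step_approximation.
Variable R : realType.
Notation I01 := (measurableTypeR R).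
Notation L := (lebesgue01 R).

Lemma integral_L (h : I01 -> R) : bdm h ->
  (\int[L]_x (h x)%:E = \int[@lebesgue_measure R]_(x in `[0%R, 1%R]%classic) (h x)%:E)%E.
Proof.
move=> bh.
have mI : measurable (`[0, 1]%classic : set I01) by exact: measurable_itv.
transitivity (\int[L]_(x in `[0%R, 1%R]%classic) (h x)%:E)%E.
  pose N : set I01 := ~` `[0, 1]%classic; rewrite (negligible_integral (N := N))//.
  - by rewrite setTD setCK.
  - exact: measurableC.
  - exact: (bdm_integrable (lebesgue01_setT R)).
  - by rewrite lebesgue01E setICl measure0.
apply: eq_measure_integral => A mA A01.
by rewrite lebesgue01E setIidl.
Qed.

Lemma clamp_dist (M x y : R) : `|x| <= M ->
  `|x - Num.max (- M) (Num.min M y)| <= `|x - y|.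
Proof.
rewrite ler_norml => /andP[h1 h2].
have [h3|h3] := leP M y.
  rewrite (max_idPr _); last by rewrite lerNl; lra.
  by rewrite !ler0_norm; lra.
have [h4|h4] := leP (- M) y; first exact: lexx.
by rewrite !ger0_norm; lra.
Qed.

(** Continuous functions are dense in L1, and clamping the approximation to [-M,
    M] only improves it; between functions bounded by M, the squared L2 distance
    is at most 2 M times the L1 distance. *)
Lemma L2_continuous_approx (h : I01 -> R) eps : bdm h -> 0 < eps ->
  exists g : R -> R, [/\ continuous g, bdm (g : I01 -> R) & Ex L (fun t => (h t - g t) ^+ 2) <= eps].
Proof.
move=> bh e0; have [M [M0 hM]] := bdm_bound bh.
have mh : measurable_fun setT (h : R -> R) := bdm_meas bh.
have mI : measurable (`[0, 1]%classic : set I01) by exact: measurable_itv.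
have fI : (@lebesgue_measure R `[0%R, 1%R]%classic < +oo)%E.
  by rewrite lebesgue_measure_itv/= lte01 oppr0 adde0 ltry.
have iI : lebesgue_measure.-integrable `[0, 1]%classic (EFin \o h).
  apply: measurable_bounded_integrable => //.
    exact: measurable_funTS mh.
  by exists M; split; rewrite ?num_real// => x Mx y _ /=; rewrite (le_trans (hM y))// ltW.
have [g_ [cg ig cv]] := approximation_continuous_integrable mI fI iI.
pose K := 2 * M + 1; have K0 : 0 < K by rewrite ltr_wpDl// mulr_ge0.
have [n _ /(_ n (leqnn n))/= hn] : \forall n \near \oo,
   (\int[lebesgue_measure]_(z in `[0%R, 1%R]%classic) `|(h z - g_ n z)%:E| < (eps / K)%:E)%E.
  apply: (cv [set x | (x < (eps / K)%:E)%E]); apply: open_nbhs_nbhs; split => /=.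
    exact: open_ereal_lt_ereal.
  by rewrite lte_fin divr_gt0.
pose g x := Num.max (- M) (Num.min M (g_ n x)).
have cg' : continuous g.
  have c0 (c : R) : continuous (fun _ : R => c) by move=> x; exact: cvg_cst.
  exact: (max_fun_continuous (c0 (- M)) (min_fun_continuous (c0 M) (cg n))).
have gM x : `|g x| <= M.
  rewrite ler_norml /g le_max lexx/= ge_max.
  by rewrite ge_min lexx/= (le_trans _ M0)// oppr_le0.
have bg : bdm (g : I01 -> R) by split; [exact: continuous_measurable_fun|exists M].
exists g; split => //.
have b2 : bdm (fun t => (h t - g t) ^+ 2) by apply: bdmX; exact: bdmB.
have iE : (\int[L]_x ((h x - g x) ^+ 2)%:E = (Ex L (fun t => (h t - g t) ^+ 2))%:E)%E.
  rewrite /Ex /Rintegral fineK//; apply: integrable_fin_num => //.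
  exact: (bdm_integrable (lebesgue01_setT R) b2).
rewrite -lee_fin -iE (integral_L b2).
apply: (@le_trans _ _ (\int[lebesgue_measure]_(z in `[0%R, 1%R]%classic) (K%:E * `|(h z - g_ n z)%:E|))%E).
  apply: ge0_le_integral => //.
  - by move=> x _; rewrite lee_fin sqr_ge0.
  - apply/measurable_EFinP; apply: measurable_funTS; exact: bdm_meas b2.
  - apply: measurable_funeM; apply/measurableT_comp => //.
    apply/measurable_EFinP/measurable_funTS/measurable_funB; first exact: mh.
    exact: continuous_measurable_fun.
  - move=> x _; rewrite -EFinM lee_fin -(real_normK (num_real (_ - _))) expr2.
    apply: ler_pM => //; last exact: clamp_dist.
    by have := ler_normB (h x) (g x); have := hM x; have := gM x; rewrite /K; lra.
rewrite ge0_integralZl//; last 2 first.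
- apply/measurableT_comp => //.
  apply/measurable_EFinP/measurable_funTS/measurable_funB; first exact: mh.
  exact: continuous_measurable_fun.
- by rewrite lee_fin ltW.
apply: (@le_trans _ _ (K%:E * (eps / K)%:E)%E).
  by rewrite lee_pmul2l// ltW.
by rewrite -EFinM lee_fin mulrCA divff ?mulr1// gt_eqF.
Qed.

Lemma continuous_segment_uniform (g : R -> R) e : continuous g -> 0 < e ->
  exists2 d, 0 < d & forall x y, 0 <= x <= 1 -> `|x - y| < d -> `|g x - g y| < e.
Proof.
move=> cg e0.
have cF : continuous (fun z : R * R => g z.1).
  by move=> z; apply: (@continuous_comp _ _ _ fst g); [exact: cvg_fst|exact: cg].
have [d d0 hd] := continuous_box_uniform 1 cF e0.
exists d => // x y /andP[x0 x1] xy; apply: (hd (x, 0) (y, 0)) => //=; last by rewrite subrr normr0.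
by split; rewrite /= in_itv/= ?oppr_le0 ?ler01// x1 andbT (le_trans _ x0)// oppr_le0.
Qed.

Lemma Ex01_le (u : I01 -> R) c : bdm u -> (forall t, 0 < t < 1 -> u t <= c) -> Ex L u <= c.
Proof.
move=> bu uc; have L1 := lebesgue01_setT R.
have b1 : bdm (fun t => u t - c) by apply: bdmB => //; exact: bdm_cst.
have b2 := bdm_max0 b1.
apply: (@le_trans _ _ (Ex L (fun t => Num.max (u t - c) 0 + c))).
  apply: Ex_le => //; first by apply: bdmD => //; exact: bdm_cst.
  by move=> t; rewrite -lerBlDr le_max lexx.
rewrite ExD//; last exact: bdm_cst.
rewrite Ex_cst// (@Ex01_eq _ _ (fun=> 0)) ?Ex_cst ?add0r//; first exact: bdm_cst.
by move=> t /uc h; apply/max_idPr; rewrite subr_le0.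
Qed.

Lemma L2_step_approx (h : I01 -> R) eps : bdm h -> 0 < eps ->
  exists m0, forall m, (m0 <= m)%N -> exists b : 'I_m.+1 -> R,
    Ex L (fun t => (h t - steps b t) ^+ 2) <= eps.
Proof.
move=> bh e0; have e4 : 0 < eps / 4 by rewrite divr_gt0.
have [g [cg bg hg]] := L2_continuous_approx bh e4.
have s0 : 0 < Num.sqrt (eps / 4) by rewrite sqrtr_gt0.
have [d d0 hd] := continuous_segment_uniform cg s0.
exists (Num.truncn d^-1) => m mm; pose b (k : 'I_m.+1) := g (k%:R / m.+1%:R); exists b.
have bs : bdm (fun t : I01 => steps b t) by exact: steps_bdm.
have bgs : bdm (fun t : I01 => (g t - steps b t) ^+ 2) by apply: bdmX; exact: bdmB.
have bhg : bdm (fun t : I01 => (h t - g t) ^+ 2) by apply: bdmX; exact: bdmB.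
have b2 (u : I01 -> R) : bdm u -> bdm (fun t => 2 * u t).
  by move=> bu; apply: bdmM => //; exact: bdm_cst.
apply: (@le_trans _ _ (Ex L (fun t => 2 * (h t - g t) ^+ 2 + 2 * (g t - steps b t) ^+ 2))).
  apply: Ex_le; [exact: lebesgue01_setT| | |].
  - by apply: bdmX; exact: bdmB.
  - by apply: bdmD; exact: b2.
  - by move=> t; have := sqr_ge0 (h t - g t - (g t - steps b t)); lra.
rewrite ExD ?lebesgue01_setT//; [|exact: b2|exact: b2].
rewrite !ExZ ?lebesgue01_setT//.
suff : Ex L (fun t => (g t - steps b t) ^+ 2) <= eps / 4 by lra.
apply: Ex01_le => // t /andP[t0 t1].
have t01 : 0 <= t < 1 by rewrite ltW.
have [j [jP sj]] := stepsP m t01; rewrite sj -(sqr_sqrtr (ltW e4)).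
rewrite -(real_normK (num_real (_ - _))) ler_sqr ?nnegrE//.
apply/ltW/hd; first by rewrite !ltW.
have N0 : 0 < m.+1%:R :> R by rewrite ltr0n.
have h1 : j%:R / m.+1%:R <= t by rewrite leNgt jP ltnn.
have h2 : t < j.+1%:R / m.+1%:R by rewrite jP.
rewrite ger0_norm ?subr_ge0// ltrBlDl; apply: lt_le_trans h2 _.
rewrite -natr1 mulrDl mul1r lerD2l -[leRHS]invrK lef_pV2 ?posrE ?invr_gt0//.
by apply/ltW; apply: lt_le_trans (truncnS_gt _) _; rewrite ler_nat.
Qed.
End step_approximation.

(** * Interval exchanges *)

Section interval_exchange.
Variable R : realType.
Notation I01 := (measurableTypeR R).
Notation L := (lebesgue01 R).

Lemma lebesgue_measure_shift (c : R) (A : set R) : measurable A ->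
  lebesgue_measure ((fun x => x + c) @^-1` A) = lebesgue_measure A.
Proof.
move=> mA; have ms : measurable_fun setT (fun x : R => x + c) by exact: measurable_funD.
pose mu := @pushforward _ _ (measurableTypeR R) (measurableTypeR R) R lebesgue_measure (fun x : R => x + c).
change (mu A = lebesgue_measure A).
apply/esym/(@lebesgue_measure_unique R mu) => // _ [[a b]] _ <-.
transitivity (lebesgue_measure (`]a - c, b - c]%classic : set R)); last first.
  rewrite /mu /pushforward/=; congr (lebesgue_measure _).
  by apply/seteqP; split => x /=; rewrite !in_itv/= ltrBlDr lerBrDr.
rewrite /= !lebesgue_measure_itv/= !lte_fin ltrD2r.
by case: ifP => // _; rewrite -!EFinB; congr EFin; ring.
Qed.

Variable m : nat.
Local Notation N := ((m.+1)%:R : R).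
Local Notation cell := (@cell R m).
Let L1 := lebesgue01_setT R.

Lemma cell_sub01 (k : 'I_m.+1) t : t \in cell k -> 0 <= t < 1.
Proof.
have N0 : 0 < N by rewrite ltr0n.
rewrite cellE => /andP[a b]; apply/andP; split.
  by rewrite -(ler_pM2r N0) mul0r (le_trans _ a).
by rewrite -(ltr_pM2r N0) mul1r (lt_le_trans b)// ler_nat.
Qed.

Lemma steps_cell (a : 'I_m.+1 -> R) (k : 'I_m.+1) t : t \in cell k -> steps a t = a k.
Proof.
move=> tk; have [j [jP ->]] := stepsP m (cell_sub01 tk).
move: tk; rewrite cellE; have N0 : 0 < N by rewrite ltr0n.
rewrite -ler_pdivrMr// -ltr_pdivlMr// jP leNgt jP => /andP[h1 h2].
by congr a; apply: val_inj; apply/eqP; rewrite eqn_leq -ltnS h2 leqNgt.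
Qed.

Lemma measure_cells (B : set I01) : measurable B ->
  \sum_(k < m.+1) fine (L (B `&` cell k)) = fine (L B).
Proof.
move=> mB; have bB : bdm (\1_B : I01 -> R) by exact: bdm_indic.
have bC (k : 'I_m.+1) : bdm (\1_(cell k) : I01 -> R) by exact: cell_bdm.
have := weights_total L1 bC (@sum_cell_le1 R m) (@Ex_cell R m) bB.
rewrite Ex_indic// => <-; apply: eq_bigr => k _.
rewrite -Ex_indic//; last by apply: measurableI => //; exact: cell_measurable.
by congr Ex; apply/funext => t; rewrite indicI.
Qed.

Variable s : 'S_m.+1.
Let c (k : 'I_m.+1) : R := ((s k)%:R - k%:R) / N.
(** Translates the k-th cell onto the (s k)-th one; steps vanishes outside [0,
    1[, so 1 is fixed. *)
Definition exchange (t : R) : R := t + steps c t.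

Lemma exchange_cell (k : 'I_m.+1) t : t \in cell k -> exchange t = t + c k.
Proof. by move=> tk; rewrite /exchange (steps_cell _ tk). Qed.

Lemma exchange_in_cell (k : 'I_m.+1) t : (t + c k \in cell (s k)) = (t \in cell k).
Proof.
have N0 : N != 0 by rewrite pnatr_eq0.
rewrite !cellE /c mulrDl divfK// -!natr1.
apply/idP/idP => /andP[h1 h2]; apply/andP; split; lra.
Qed.

Lemma exchange_steps (a : 'I_m.+1 -> R) t : 0 <= t < 1 ->
  steps a (exchange t) = steps (fun k => a (s k)) t.
Proof.
move=> t01; have [j jP] := cellP m t01.
have tj : t \in cell j by rewrite jP.
by rewrite (steps_cell _ tj) (exchange_cell tj); apply: steps_cell; rewrite exchange_in_cell.
Qed.

Lemma exchange_01 t : 0 <= t < 1 -> 0 <= exchange t < 1.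
Proof.
move=> t01; have [j jP] := cellP m t01.
have tj : t \in cell j by rewrite jP.
by rewrite (exchange_cell tj); apply: (@cell_sub01 (s j)); rewrite exchange_in_cell.
Qed.

Lemma exchange_1 : exchange 1 = 1.
Proof.
rewrite /exchange /steps big1 ?addr0// => k _; rewrite indicE.
case: (boolP (1 \in cell k)) => [/cell_sub01|_]; last by rewrite mulr0.
by rewrite ltxx andbF.
Qed.

(** On each cell the map is a translation, and the cells are permuted. *)
Lemma exchange_Smeas : Smeas exchange.
Proof.
have mE : measurable_fun setT (exchange : R -> R).
  by apply: measurable_funD => //; exact: bdm_meas (steps_bdm _).
have E01 x : x \in `[0, 1] -> exchange x \in `[0, 1].
  rewrite !in_itv/= => /andP[x0]; rewrite le_eqVlt => /predU1P[->|x1].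
    by rewrite exchange_1 ler01 lexx.
  have /exchange_01 /andP[-> /ltW ->] : 0 <= x < 1 by rewrite x0.
  by [].
split=> //; first exact: measurable_funTS.
move=> A mA A01; set B := `[0, 1]%classic `&` exchange @^-1` A.
have mB : measurable B.
  by apply: measurableI => //; rewrite -[X in measurable X]setTI; exact: mE.
have LE (X : set R) : X `<=` `[0, 1]%classic -> L X = lebesgue_measure X.
  by move=> X01; rewrite lebesgue01E setIidl.
have c01 (k : 'I_m.+1) : cell k `<=` `[0, 1]%classic.
  by move=> t /mem_set/cell_sub01 /andP[t0 t1]; rewrite /= in_itv/= t0 ltW.
rewrite -(LE A)// -LE; last by move=> x [].
have fin (X : set I01) : measurable X -> L X = (fine (L X))%:E.
  move=> mX; rewrite fineK// ge0_fin_numE//.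
  have : (L setT < +oo)%E by rewrite L1 ltry.
  by apply: le_lt_trans; apply: le_measure; rewrite ?inE.
rewrite fin// [in RHS]fin//; congr (_%:E).
rewrite -(measure_cells mB) -(measure_cells mA) [RHS](reindex_inj (@perm_inj _ s)).
apply: eq_bigr => k _; congr fine; rewrite !LE; try by apply: subIset; right.
rewrite -[RHS](lebesgue_measure_shift (c k)); last by apply: measurableI => //; exact: cell_measurable.
congr (lebesgue_measure _); apply/seteqP; split => t /=.
  move=> [[t01 tA] tk]; rewrite -(exchange_cell (mem_set tk)); split=> //.
  by apply: set_mem; rewrite (exchange_cell (mem_set tk)) exchange_in_cell mem_set.
move=> [tA tk]; have tk' : t \in cell k by rewrite -exchange_in_cell mem_set.
split; last exact: set_mem.
split; first by apply: c01 (set_mem tk').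
by rewrite /= (exchange_cell tk').
Qed.
End interval_exchange.

(** * Convex hulls, limits of sets and weak closure *)

Section convexity.
Variables (R : realType).

Lemma convex_setP (V : lmodType R) (A : set V) : @convex_set R V A <->
  forall x y (t : R), 0 <= t <= 1 -> A x -> A y -> A (t *: x + (1 - t) *: y).
Proof.
split=> [cA x y t /andP[t0 t1] Ax Ay|cA x y l].
  have := cA x y (Itv01 t0 t1); rewrite !inE => /(_ Ax Ay); exact.
by rewrite !inE => Ax Ay; apply: cA => //; apply/andP; split.
Qed.

Lemma conv_hull_convex (V : lmodType R) (A : set V) : @convex_set R V (conv_hull A).
Proof.
apply/convex_setP => x y t t01 hx hy C [cC AC].
by move/convex_setP: (cC); apply => //; [exact: hx|exact: hy].
Qed.

Lemma closed_conv_hull_convex (V : normedModType R) (A : set V) :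
  @convex_set R V (closed_conv_hull A).
Proof.
apply/convex_setP => x y t t01 hx hy C [[clC cC] AC].
by move/convex_setP: (cC); apply => //; [exact: hx|exact: hy].
Qed.

Lemma closed_conv_hull_closed (V : normedModType R) (A : set V) :
  closed (closed_conv_hull A).
Proof.
move=> x hx C hC; have [[clC _] _] := hC; apply: clC => B /hx [y [hy By]].
by exists y; split=> //; exact: hy hC.
Qed.

Lemma closed_dist (V : normedModType R) (K : set V) : closed K <->
  forall x, (forall e, 0 < e -> exists2 c, K c & `|x - c| <= e) -> K x.
Proof.
split=> [clK x h|h x clx].
  apply: clK => B /nbhs_ballP[e /= e0 eB]; have e20 : 0 < e / 2 by rewrite divr_gt0.
  have [c Kc xc] := h _ e20; exists c; split=> //; apply: eB.
  by rewrite -ball_normE /ball_/=; apply: le_lt_trans xc _; rewrite ltr_pdivrMr// ltr_pMr// ltr1n.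
apply: h => e e0; have [c [Kc]] := clx _ (nbhsx_ballx x e e0).
by rewrite -ball_normE /ball_/= => xc; exists c => //; exact: ltW.
Qed.

Lemma Ls_dist (V : normedModType R) (E : nat -> set V) x : Ls E x ->
  forall e n, 0 < e -> exists m, (n <= m)%N /\ exists2 g, E m g & `|x - g| <= e.
Proof.
move=> h e n e0; have hinf := h _ (nbhsx_ballx x e e0).
apply: contrapT => H; apply: hinf; apply: (sub_finite_set _ (finite_II n)) => m /= [g [Bg Eg]].
rewrite ltnNge; apply/negP => nm; apply: H; exists m; split=> //; exists g => //.
by move: Bg; rewrite -ball_normE /ball_/= => /ltW.
Qed.

Lemma sub_Ls (V : normedModType R) (E : nat -> set V) x :
  (forall e, 0 < e -> exists m0, forall m, (m0 <= m)%N -> exists2 g, E m g & `|x - g| <= e) ->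
  Ls E x.
Proof.
move=> h B /nbhs_ballP[e /= e0 eB]; have e20 : 0 < e / 2 by rewrite divr_gt0.
have [m0 hm] := h _ e20 => fin.
apply: infinite_nat; apply: (@sub_finite_set _ _ (`I_m0 `|` [set m | B `&` E m !=set0])).
  move=> m _; have [mm|mm] := ltnP m m0; [by left|right].
  have [g Eg xg] := hm m mm; exists g; split=> //; apply: eB.
  by rewrite -ball_normE /ball_/=; apply: le_lt_trans xg _; rewrite ltr_pdivrMr// ltr_pMr// ltr1n.
by rewrite finite_setU; split=> //; exact: finite_II.
Qed.

Lemma lipschitz_continuous (V : normedModType R) (l : V -> R^o) (C : R) :
  (forall x y, `|l x - l y| <= C * `|x - y|) -> continuous l.
Proof.
move=> lip x; apply/cvgrPdist_lt => e e0; apply/nbhs_ballP.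
exists (e / (`|C| + 1)) => /=; first by rewrite divr_gt0// ltr_wpDl.
move=> y; rewrite -ball_normE /ball_/= => xy; apply: le_lt_trans (lip x y) _.
move: xy; rewrite ltr_pdivlMr ?ltr_wpDl// => xy; apply: le_lt_trans xy.
rewrite mulrC ler_wpM2l//; have := ler_norm C; lra.
Qed.

Lemma open_weak (V : normedModType R) (l : {linear V -> R^o}) (x : V) a :
  continuous l -> a < l x -> @nbhs _ (weak_topology V) x [set y | a < l y].
Proof.
move=> cl ax.
have := cvg_sup (fun l : {l : {linear V -> R^o} | continuous l} =>
    Topological.class (initial_topology (sval l : V -> R^o))) x (nbhs_filter (x : weak_topology V)).
move=> [/(_ (fun _ => id)) /(_ (exist _ l cl)) h _]; apply: h => /=.
have hn : nbhs (l x) [set r : R^o | a < r] by exact: (@lt_nbhsr R a (l x) ax).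
exact: (@initial_continuous V R^o (l : V -> R^o) x _ hn).
Qed.
End convexity.
Section weakly_closed.
Variable R : realType.
Implicit Types (x y z u : L2I R) (K : set (L2I R)).

Definition dotL2_form u : L2I R -> R^o := fun g => dotL2 g u.

Fact dotL2_form_linear u : linear (dotL2_form u).
Proof. by move=> a x y; rewrite /dotL2_form dotL2Dl dotL2Zl. Qed.

HB.instance Definition _ u := GRing.isLinear.Build R (L2I R) R^o *:%R (dotL2_form u) (dotL2_form_linear u).

Lemma dotL2Bl x y u : dotL2 (x - y) u = dotL2 x u - dotL2 y u.
Proof. by rewrite -scaleN1r dotL2Dl dotL2Zl mulN1r. Qed.

Lemma norm_sub_scale x y (t : R) : `|x - t *: y| ^+ 2 = `|x| ^+ 2 - 2 * t * dotL2 y x + t ^+ 2 * `|y| ^+ 2.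
Proof.
have dotL2Br (a b c : L2I R) : dotL2 c (a - b) = dotL2 c a - dotL2 c b by rewrite (dotL2C c (a - b)) dotL2Bl (dotL2C a) (dotL2C b).
have dotL2Zr s (a c : L2I R) : dotL2 c (s *: a) = s * dotL2 c a by rewrite (dotL2C c (s *: a)) dotL2Zl (dotL2C a).
by rewrite -!dotL2_norm dotL2Bl !dotL2Br !dotL2Zr !dotL2Zl (dotL2C x y); ring.
Qed.

Lemma dotL2_CauchySchwarz x u : `|dotL2 x u| <= `|x| * `|u|.
Proof.
have [u0|u0] := eqVneq `|u| 0.
  move/eqP: u0; rewrite normr_eq0 => /eqP ->; rewrite normr0 mulr0.
  by rewrite -(scale0r 0) dotL2C dotL2Zl mul0r normr0.
have u2 : 0 < `|u| ^+ 2 by rewrite exprn_gt0// lt_neqAle eq_sym u0 normr_ge0.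
rewrite -ler_sqr ?nnegrE ?mulr_ge0// real_normK ?num_real// exprMn.
have := sqr_ge0 `|x - (dotL2 u x / `|u| ^+ 2) *: u|; rewrite norm_sub_scale (dotL2C u x).
rewrite -(pmulr_lge0 _ u2) => h; rewrite -subr_ge0; move: h; congr (0 <= _).
by field; rewrite u0.
Qed.

Lemma dotL2_form_continuous u : continuous (dotL2_form u).
Proof.
apply: (@lipschitz_continuous _ _ _ `|u|) => x y.
by rewrite /dotL2_form -dotL2Bl mulrC dotL2_CauchySchwarz.
Qed.

(** A bounded case of Mazur's theorem, by separation with an approximate
    projection. If c0 in K is within t^2 of minimizing the squared distance to
    x, comparing c0 with the points c0 + t (c - c0) of K bounds (c - c0, x - c0)
    by a multiple of t for every c in K, whereas (x - c0, x - c0) is at least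
    the squared distance from x to K. *)
Lemma weakly_closed K M : closed K -> @convex_set R _ K -> K !=set0 ->
  (forall c, K c -> `|c| <= M) -> weak_closure K `<=` K.
Proof.
move=> /closed_dist clK /convex_setP cK [c1 Kc1] KM x wx; apply: contrapT => nKx.
have [r r0 hr] : exists2 r, 0 < r & forall c, K c -> r < `|x - c|.
  apply: contrapT => H; apply: nKx; apply: clK => e e0; apply: contrapT => H'.
  apply: H; exists e => // c Kc; rewrite ltNge; apply/negP => h; apply: H'.
  by exists c.
pose S := [set `|x - c| ^+ 2 | c in K].
have S0 : has_inf S.
  by split; [exists (`|x - c1| ^+ 2), c1|exists 0 => _ [c _ <-]; exact: sqr_ge0].
pose D := (2 * M) ^+ 2; have D0 : 0 <= D by exact: sqr_ge0.
(* Small enough for t (1 + D) / 2 to stay below r^2 / 2, half of the gap. *)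
pose t := Num.min 1 (r ^+ 2 / (1 + D)).
have t0 : 0 < t by rewrite lt_min ltr01 divr_gt0 ?exprn_gt0// ltr_pwDl.
have t1 : t <= 1 by rewrite ge_min lexx.
have tD : t * (1 + D) <= r ^+ 2 by rewrite -ler_pdivlMr ?ltr_pwDl// ge_min lexx orbT.
have [_ [c0 Kc0 <-] hc0] : exists2 v, S v & v < inf S + t ^+ 2.
  by apply: inf_lt; [exact: S0.1|rewrite ltrDl exprn_gt0].
pose u := x - c0.
have bound c : K c -> dotL2 (c - c0) u <= r ^+ 2 / 2.
  move=> Kc; set z := c - c0.
  have zD : `|z| ^+ 2 <= D.
    have := ler_normB c c0; have := KM c Kc; have := KM c0 Kc0 => h1 h2 h3.
    rewrite /D ler_sqr ?nnegrE//; last by have := normr_ge0 c; lra.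
    by rewrite (le_trans h3)//; lra.
  have Kc' : K (t *: c + (1 - t) *: c0) by apply: cK => //; rewrite (ltW t0) t1.
  have : inf S <= `|x - (t *: c + (1 - t) *: c0)| ^+ 2.
    by apply: ge_inf; [exact: S0.2|exists (t *: c + (1 - t) *: c0)].
  have -> : x - (t *: c + (1 - t) *: c0) = u - t *: z.
    have -> : t *: c + (1 - t) *: c0 = c0 + t *: z.
      by rewrite /z scalerBl scale1r scalerBr [RHS]addrCA.
    by rewrite opprD addrA.
  rewrite norm_sub_scale => h.
  have : 2 * t * dotL2 z u <= t ^+ 2 * (1 + D).
    have := ler_wpM2l (sqr_ge0 t) zD; move: hc0; rewrite -/u; lra.
  rewrite expr2 -mulrA -mulrA (mulrCA 2) ler_pM2l// => h'.
  by rewrite ler_pdivlMr// mulrC; exact: le_trans h' tD.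
have hx : dotL2 c0 u + r ^+ 2 / 2 < dotL2_form u x.
  rewrite -ltrBrDl /dotL2_form -dotL2Bl -/u dotL2_norm.
  have := hr c0 Kc0; rewrite -/u => h.
  have : r ^+ 2 < `|u| ^+ 2 by rewrite ltr_sqr ?nnegrE// ltW.
  have := exprn_gt0 2 r0; lra.
have [c [Kc /=]] := wx _ (open_weak (l := dotL2_form u) (@dotL2_form_continuous u) hx).
by rewrite -ltrBrDl /dotL2_form -dotL2Bl; move=> /(le_lt_trans (bound c Kc)); rewrite ltxx.
Qed.
End weakly_closed.
(** * The hulls of the Toeplitz spectra *)

Section toeplitz_hulls.
Variables (R : realType) (f : CP1 R -> R).
Hypothesis sf : smooth_CP1 f.
Notation I01 := (measurableTypeR R).
Notation L := (lebesgue01 R).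
Notation q := (rearr01 f).
Notation K := (closed_conv_hull (Smeas_orbit (decr_rearr f))).
Let L1 := lebesgue01_setT R.
Let bF := smooth_bdm sf.
Let bq : bdm q := rearr01_bdm bF.

Lemma L2_class_dist_le (h1 h2 : I01 -> R) e : bdm h1 -> bdm h2 -> 0 <= e ->
  Ex L (fun t => (h1 t - h2 t) ^+ 2) <= e ^+ 2 -> `|L2_class h1 - L2_class h2| <= e.
Proof. by move=> b1 b2 e0; rewrite -L2_class_dist// ler_sqr ?nnegrE. Qed.

Lemma orbit_in_hull phi : Smeas phi -> K (L2_class (precomp01 q phi)).
Proof.
by move=> sphi; rewrite -(orbit_class f sphi) => C [_]; apply; exists phi.
Qed.

(** Permuting the cells of a step function amounts to composing with the
    corresponding interval exchange, and composing both functions with it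
    preserves their distance. *)
Lemma exchange_dist m (s : 'S_m.+1) (a : 'I_m.+1 -> R) :
  `|L2_class (steps (fun k => a (s k))) - L2_class (precomp01 q (exchange s))| ^+ 2 =
  Ex L (fun t => (steps a t - q t) ^+ 2).
Proof.
have sE : Smeas (exchange s : R -> R) by exact: exchange_Smeas.
have bu : bdm (fun t => (steps a t - q t) ^+ 2).
  by apply: bdmX; apply: bdmB => //; exact: steps_bdm.
have bp : bdm (precomp01 q (exchange s)) by exact: precomp01_bdm.
rewrite L2_class_dist//; last exact: steps_bdm.
rewrite -(Ex_precomp01 bu sE); apply: Ex01_eq.
- by apply: bdmX; apply: bdmB => //; exact: steps_bdm.
- exact: precomp01_bdm.
move=> t /andP[t0 t1]; rewrite /precomp01 !patchE mem_set/=; last by rewrite in_itv/= !ltW.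
by rewrite exchange_steps// ltW.
Qed.

(** The points v whose step function is eps-close to K form a convex set, so it
    is enough to treat the permutations of the sorted eigenvalues, and these are
    moved by interval exchanges. *)
Lemma hull_near_orbit eps : 0 < eps -> exists m0, forall m, (m0 <= m)%N ->
  forall g, toeplitz_hull f m g -> exists2 c, K c & `|g - c| <= eps.
Proof.
move=> e0; have [m0 hm0] := szego_rearrangement sf (exprn_gt0 2 e0).
exists m0 => m mm; have [s0 [as_ hs]] := hm0 m mm.
set l := toeplitz_eigenvalues m f in hs as_ *.
move=> _ [v hv <-]; move: v hv.
apply: (@smallest_sub _ _ _ [set v | exists2 c, K c & `|step_fun v - c| <= eps]).
  apply/convex_setP => x y t /andP[t0 t1] /= [c1 Kc1 h1] [c2 Kc2 h2].
  exists (t *: c1 + (1 - t) *: c2).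
    by have /convex_setP := @closed_conv_hull_convex R _ (Smeas_orbit (decr_rearr f)); apply => //; rewrite t0.
  rewrite step_fun_comb opprD addrACA -!scalerBr.
  apply: le_trans (ler_normD _ _) _; rewrite !normrZ (ger0_norm t0) ger0_norm ?subr_ge0//.
  have := ler_wpM2l t0 h1; have t10 : 0 <= 1 - t by rewrite subr_ge0.
  have := ler_wpM2l t10 h2; lra.
move=> _ [s _ <-] /=; pose s' := (s * s0^-1)%g.
exists (L2_class (precomp01 q (exchange s'))); first by apply: orbit_in_hull; exact: exchange_Smeas.
rewrite step_funE -ler_sqr ?nnegrE ?(ltW e0)//; apply: le_trans hs.
rewrite -(exchange_dist s') le_eqVlt; apply/orP; left; apply/eqP.
congr (`|L2_class (steps _) - _| ^+ 2).
by apply/funext => k; rewrite !mxE /s' permM permKV.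
Qed.

Lemma hull_bounded : exists M, forall c, K c -> `|c| <= M.
Proof.
have [M [M0 hM]] := bdm_bound bq; exists M.
apply: (@smallest_sub _ _ _ [set c | `|c| <= M]).
  split.
    apply/closed_dist => x h; apply/ler_addgt0Pr => e e0; have [c /= cM xc] := h e e0.
    by rewrite -(subrK c x) (le_trans (ler_normD _ _))// addrC lerD.
  apply/convex_setP => x y t /andP[t0 t1] /= h1 h2.
  apply: le_trans (ler_normD _ _) _; rewrite !normrZ (ger0_norm t0) ger0_norm ?subr_ge0//.
  have := ler_wpM2l t0 h1; have t10 : 0 <= 1 - t by rewrite subr_ge0.
  have := ler_wpM2l t10 h2; lra.
move=> _ [phi sphi <-] /=; rewrite orbit_class//.
have bp : bdm (precomp01 q phi) by exact: precomp01_bdm.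
rewrite -ler_sqr ?nnegrE// L2_class_norm//.
rewrite -[leRHS](Ex_cst L1); apply: Ex_le => //; [exact: bdmX|exact: bdm_cst|].
move=> t; rewrite -(real_normK (num_real _)) ler_sqr ?nnegrE//.
by rewrite /precomp01 patchE; case: ifPn => _; rewrite ?normr0//=.
Qed.

Lemma Ls_sub_hull : Ls (toeplitz_hull f) `<=` K.
Proof.
move=> x Lx; have /closed_dist := closed_conv_hull_closed (A := Smeas_orbit (decr_rearr f)).
apply => e e0; have e2 : 0 < e / 2 by rewrite divr_gt0.
have [m0 hm] := hull_near_orbit e2.
have [m [mm [g Eg xg]]] := Ls_dist Lx m0 e2.
have [c Kc gc] := hm m mm g Eg; exists c => //.
by rewrite -(subrK g x) -addrA (le_trans (ler_normD _ _))// [leRHS]splitr lerD.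
Qed.

Lemma Ex_steps_sq m (a b : 'I_m.+1 -> R) :
  Ex L (fun t => (steps a t - steps b t) ^+ 2) = m.+1%:R^-1 * \sum_k (a k - b k) ^+ 2.
Proof.
have bC (k : 'I_m.+1) : bdm (\1_(@cell R m k) : I01 -> R) by exact: cell_bdm.
have bs (c : 'I_m.+1 -> R) : bdm (steps c : I01 -> R) by exact: steps_bdm.
transitivity (Ex L (steps (fun k => (a k - b k) ^+ 2))).
  apply: Ex01_eq => //; first by apply: bdmX; exact: bdmB.
  move=> t /andP[t0 t1]; have t01 : 0 <= t < 1 by rewrite ltW.
  by have [j [_ sj]] := stepsP m t01; rewrite !sj.
rewrite /steps Ex_sum//; last by move=> k _; apply: bdmM => //; exact: bdm_cst.
rewrite mulr_sumr; apply: eq_bigr => k _.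
by rewrite ExZ// Ex_cell mulrC.
Qed.

Lemma toeplitz_hull_convex m : @convex_set R _ (toeplitz_hull f m).
Proof.
apply/convex_setP => _ _ t t01 [v hv <-] [w hw <-].
exists (t *: v + (1 - t) *: w); last exact: step_fun_comb.
by have /convex_setP := @conv_hull_convex R _ (perm_orbit (toeplitz_eigenvalues m f)); apply.
Qed.

(** The lower limit of the hulls: it is convex because they are, which fails for
    the upper limit of convex sets in general. *)
Let Li (x : L2I R) := forall e, 0 < e -> exists m0, forall m, (m0 <= m)%N ->
  exists2 g, toeplitz_hull f m g & `|x - g| <= e.

(** Approximate h by a step function b on the same cells as the eigenvalues.
    Sorting b gives a step function close to q, by the coupling inequality
    applied to h and to the permuted cells. The sorted eigenvalues are close to
    q as well, hence to the sorted b, and undoing the sorting permutation on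
    both keeps the distance: this gives a permutation of the eigenvalues close
    to b, hence to h. *)
Lemma orbit_sub_Li phi : Smeas phi -> Li (L2_class (precomp01 q phi)).
Proof.
move=> sphi e e0; set h := precomp01 q phi.
have bh : bdm h by exact: precomp01_bdm.
have e3 : 0 < e / 3 by rewrite divr_gt0.
have [m1 hm1] := szego_rearrangement sf (exprn_gt0 2 e3).
have [m2 hm2] := L2_step_approx bh (exprn_gt0 2 e3).
exists (maxn m1 m2) => m; rewrite geq_max => /andP[mm1 mm2].
have [s [am hs]] := hm1 m mm1; have [b hb] := hm2 m mm2.
set l := toeplitz_eigenvalues m f in am hs *.
have [sg bm] := sorting_perm b.
pose a j := l 0 (s j); pose a' j := b (sg j).
have bS (c : 'I_m.+1 -> R) : bdm (steps c : I01 -> R) by exact: steps_bdm.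
have bC (k : 'I_m.+1) : bdm (\1_(@cell R m k) : I01 -> R) by exact: cell_bdm.
have hb' : Ex L (fun t => (steps a' t - q t) ^+ 2) <= (e / 3) ^+ 2.
  apply: le_trans hb.
  pose p (j : 'I_m.+1) : I01 -> R := \1_(@cell R m (sg j)).
  have p1 x : \sum_j p j x <= 1.
    by apply: le_trans (sum_cell_le1 m x); rewrite [leRHS](reindex_inj (@perm_inj _ sg)).
  apply: (le_trans (coupling L1 bh bq (precomp01_equimeas bq sphi) (@rearr01_mono R f bF) bm
    (p := p) (fun j => bC (sg j)) _ p1 (fun j => Ex_cell R (sg j)))).
    by move=> j x; rewrite /p indicE.
  rewrite le_eqVlt; apply/orP; left; apply/eqP.
  rewrite [RHS](_ : _ = \sum_k Ex L (fun t => (h t - b k) ^+ 2 * \1_(@cell R m k) t)).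
    by rewrite [RHS](reindex_inj (@perm_inj _ sg)).
  rewrite -Ex_sum//; last first.
    by move=> k _; apply: bdmM => //; apply: bdmX; apply: bdmB => //; exact: bdm_cst.
  apply: Ex01_eq.
  - by apply: bdmX; exact: bdmB.
  - by apply: bdm_sum => k _; apply: bdmM => //; apply: bdmX; apply: bdmB => //; exact: bdm_cst.
  move=> t /andP[t0 t1]; have t01 : 0 <= t < 1 by rewrite ltW.
  have [j [_ sj]] := stepsP m t01; rewrite sj.
  by have := sj (fun k => (h t - b k) ^+ 2); rewrite /steps => ->.
pose c k := a ((sg^-1)%g k).
exists (step_fun (col_perm (sg^-1 * s)%g l)).
  exists (col_perm (sg^-1 * s)%g l) => //.
  by apply: sub_gen_smallest; exists (sg^-1 * s)%g.
have -> : step_fun (col_perm (sg^-1 * s)%g l) = L2_class (steps c).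
  by rewrite step_funE; congr (L2_class (steps _)); apply/funext => k; rewrite !mxE permM.
have d1 : `|L2_class h - L2_class (steps b)| <= e / 3.
  by apply: L2_class_dist_le => //; exact: ltW.
have d2 : `|L2_class (steps a') - L2_class q| <= e / 3.
  by apply: L2_class_dist_le => //; exact: ltW.
have d3 : `|L2_class (steps a) - L2_class q| <= e / 3.
  by apply: L2_class_dist_le => //; exact: ltW.
have d4 : `|L2_class (steps b) - L2_class (steps c)| = `|L2_class (steps a') - L2_class (steps a)|.
  apply/eqP; rewrite -(@eqrXn2 _ 2)// !L2_class_dist// !Ex_steps_sq; apply/eqP; congr (_ * _).
  rewrite [LHS](reindex_inj (@perm_inj _ sg)); apply: eq_bigr => j _.
  by rewrite /c /a' permK.
have d5 : `|L2_class (steps a') - L2_class (steps a)| <= e / 3 + e / 3.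
  rewrite -(subrK (L2_class q) (L2_class (steps a'))) -addrA (le_trans (ler_normD _ _))// lerD//.
  by rewrite distrC.
rewrite -(subrK (L2_class (steps b)) (L2_class h)) -addrA (le_trans (ler_normD _ _))// d4.
lra.
Qed.

Lemma hull_sub_Li x : K x -> Li x.
Proof.
move: x; apply: (@smallest_sub _ _ _ [set x | Li x]).
  split.
    apply/closed_dist => x h e e0; have e2 : 0 < e / 2 by rewrite divr_gt0.
    have [c Lc xc] := h _ e2; have [m0 hm] := Lc _ e2.
    exists m0 => m /hm[g Eg cg]; exists g => //.
    by rewrite -(subrK c x) -addrA (le_trans (ler_normD _ _))// [leRHS]splitr lerD.
  apply/convex_setP => x y t /[dup] t01 /andP[t0 t1] /= hx hy e e0.
  have [m1 h1] := hx e e0; have [m2 h2] := hy e e0.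
  exists (maxn m1 m2) => m; rewrite geq_max => /andP[/h1[g Eg xg] /h2[k Ek yk]].
  exists (t *: g + (1 - t) *: k).
    by have /convex_setP := toeplitz_hull_convex (m := m); apply.
  rewrite opprD addrACA -!scalerBr.
  apply: le_trans (ler_normD _ _) _; rewrite !normrZ (ger0_norm t0) ger0_norm ?subr_ge0//.
  have := ler_wpM2l t0 xg; have t10 : 0 <= 1 - t by rewrite subr_ge0.
  have := ler_wpM2l t10 yk; lra.
by move=> _ [phi sphi <-] /=; rewrite orbit_class//; exact: orbit_sub_Li.
Qed.
End toeplitz_hulls.

Theorem theorem3p4 (R : realType) (f : CP1 R -> R) :
  smooth_CP1 f ->
  closed_conv_hull (Smeas_orbit (decr_rearr f)) =
    weak_closure (Ls (toeplitz_hull f)).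
Proof.
move=> sf; apply/seteqP; split => [x Kx|x wx].
  by apply: subset_closure; apply: sub_Ls; exact: hull_sub_Li.
have [M KM] := hull_bounded sf.
apply: (weakly_closed _ _ _ KM).
- exact: closed_conv_hull_closed.
- exact: closed_conv_hull_convex.
- by exists (L2_class (precomp01 (rearr01 f) (@exchange R 0 1%g))); apply: orbit_in_hull; exact: exchange_Smeas.
- by move=> B /wx[y [Ly By]]; exists y; split=> //; exact: Ls_sub_hull Ly.
Qed.
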